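(* For every $s\in\mathbb{C}$ with $\Re(s)>1$, \[ \sum_{n=0}^{\infty}\bigl(\zeta(s-n-2,n+2)-\zeta(-n,s+n)\bigr)=\zeta(s). \]
   Context: For complex $s_1,\dots,s_r$, the Euler–Zagier multiple zeta function is $\zeta(s_1,\dots,s_r):=\sum_{1\le n_1<\cdots<n_r} n_1^{-s_1}\cdots n_r^{-s_r}$, which converges absolutely on $\{\Re(s_l+\cdots+s_r)>r-l+1\ (1\le l\le r)\}$ and is understood via its meromorphic continuation to $\mathbb{C}^r$ elsewhere. $\zeta(s)$ is the Riemann zeta function.
   Formalization: At s = 2 both double zeta values in each summand lie on the polar line s_1+s_2 = 2 and are undefined; there the n-th summand is taken as the limit of the difference as s tends to 2 (a removable singularity). For all other s with Re(s) > 1 the statement is literal. *)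

(* Defs.v *)
From Stdlib Require Import Reals Lra Arith.
From Coquelicot Require Import Coquelicot.
Open Scope R_scope.

Definition Cexp (z : C) : C :=
  (exp (Re z) * cos (Im z), exp (Re z) * sin (Im z)).

(** [npow m s] is [m ^ s] for a positive integer [m]; it is meaningless for
    [m = 0], which never occurs below. *)
Definition npow (m : nat) (s : C) : C := Cexp (s * RtoC (ln (INR m)))%C.

(** Absolutely convergent double series over [nat * nat], with sum [l]. By
    absolute convergence the sum does not depend on the exhaustion by squares. *)
Definition is_dseries (a : nat -> nat -> C) (l : C) : Prop :=
  (exists M : R, forall N : nat,
     sum_n (fun j => sum_n (fun k => Cmod (a j k)) N) N <= M) /\
  filterlim (fun N : nat => sum_n (fun j => sum_n (fun k => a j k) N) N)
            eventually (locally l).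

(** Holomorphy in two variables: near [(z0, w0)] the function is the sum of an
    absolutely convergent power series on a polydisc. *)
Definition holomorphic_at (f : C -> C -> C) (z0 w0 : C) : Prop :=
  exists (c : nat -> nat -> C) (r : R), 0 < r /\
    forall z w : C, Cmod (z - z0)%C < r -> Cmod (w - w0)%C < r ->
      is_dseries (fun j k => c j k * (z - z0) ^ j * (w - w0) ^ k)%C (f z w).

(** [g] is holomorphic near [(z0, w0)] and its germ there is not zero. *)
Definition nonzero_germ (g : C -> C -> C) (z0 w0 : C) : Prop :=
  holomorphic_at g z0 w0 /\
  ~ locally (z0, w0) (fun q : C * C => g (fst q) (snd q) = RtoC 0).

(** Equality near [(z0, w0)] outside the zero set of [g]. *)
Definition eq_off (g F G : C -> C -> C) (z0 w0 : C) : Prop :=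
  locally (z0, w0) (fun q : C * C =>
    g (fst q) (snd q) <> RtoC 0 -> F (fst q) (snd q) = G (fst q) (snd q)).

(** A meromorphic function on [C * C], given as a total function: locally a
    quotient [f / g] of holomorphic functions (first clause), and taking the
    right value wherever it is regular (second clause). Its values at the other
    points (poles and points of indeterminacy) are unconstrained. *)
Definition meromorphic (Z : C -> C -> C) : Prop :=
  (forall z0 w0 : C, exists f g : C -> C -> C,
     holomorphic_at f z0 w0 /\ nonzero_germ g z0 w0 /\
     eq_off g Z (fun z w => f z w / g z w)%C z0 w0) /\
  (forall (z0 w0 : C) (h g : C -> C -> C),
     holomorphic_at h z0 w0 -> nonzero_germ g z0 w0 -> eq_off g Z h z0 w0 ->
     Z z0 w0 = h z0 w0).

Definition double_zeta_term (s1 s2 : C) (n1 n2 : nat) : C :=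
  if ((1 <=? n1) && (n1 <? n2))%nat%bool
  then (npow n1 (- s1) * npow n2 (- s2))%C else RtoC 0.

(** [Z] is the meromorphic continuation to [C * C] of
    [sum_{1 <= n1 < n2} n1^(-s1) n2^(-s2)]. By the identity theorem, two such
    functions can differ only at non-regular points. *)
Definition is_double_zeta (Z : C -> C -> C) : Prop :=
  meromorphic Z /\
  (forall s1 s2 : C, 2 < Re (s1 + s2)%C -> 1 < Re s2 ->
     is_dseries (double_zeta_term s1 s2) (Z s1 s2)).

Definition CSeries (a : nat -> C) : C :=
  (Series (fun n => Re (a n)), Series (fun n => Im (a n))).

(** The Riemann zeta function; only meaningful for [1 < Re s]. *)
Definition zeta (s : C) : C := CSeries (fun n => npow (S n) (- s)%C).

Definition summand (Z : C -> C -> C) (n : nat) (s : C) : C :=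
  (Z (s - RtoC (INR n) - RtoC 2) (RtoC (INR n) + RtoC 2)
   - Z (- RtoC (INR n)) (s + RtoC (INR n)))%C.

(** [v] is the [n]-th summand at [s], as a meromorphic function of [s]. At
    [s = 2] both double zeta values sit on the polar line [s1 + s2 = 2], but the
    singularity of their difference is removable, so its value is the limit. *)
Definition summand_value (Z : C -> C -> C) (n : nat) (s v : C) : Prop :=
  (s <> RtoC 2 -> v = summand Z n s) /\
  (s = RtoC 2 -> filterlim (summand Z n) (locally' s) (locally v)).

(* Main.v *)
Require Import Defs.
From Stdlib Require Import Reals Lra Lia Arith.
From Stdlib Require Import IndefiniteDescription Classical.
From Coquelicot Require Import Coquelicot.
Open Scope R_scope.

(** Comparing the inner sum [sum_{N > m} N^(-w)] with its integral
    [m^(1-w) / (w-1)] continues the double zeta function to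
    [Re w > 1, Re (z + w) > 1], with a pole only on [z + w = 2]; in the [n]-th
    summand the two residues cancel up to [(s-2) / ((n+1) (s+n-1))], so the summand
    is holomorphic for [Re s > 1]. Put [A_m(w) = sum_{N > m} (m/N)^w - m / (w-1)]:
    up to a term of size [n^(-2)] the [n]-th summand is the sum over [m] of
    [m^(-s) (A_m(n+2) - A_m(n+s))], and the difference is [O(1/n)] for [m >= n] and
    [O(m/n^2)] always. Hence the series converges normally and its sum is
    holomorphic for [Re s > 1]. For [Re s > 5] summing the geometric series in [n]
    first leaves [sum_{m < N} (m^(1-s) (1/(N-m) - 1/N) - N^(1-s) / (N-m))], which
    telescopes through harmonic numbers to [zeta s]; the identity theorem extends
    this to [Re s > 1].

    All holomorphy is expressed through the weighted l1-norm of power series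
    coefficients, for which locally analytic functions form a Banach algebra. *)

(* [sum_n] over [C] has type [AbelianMonoid.sort C_AbelianMonoid], which [ring]
   does not recognize. *)
Ltac cring := match goal with |- @eq _ ?a ?b => change (@eq C a b); ring end.

(** * Limits and series of complex numbers *)

(** The continuation is an abstract total function, constrained at its regular points only. An
    equality with an explicit formula therefore cannot be carried along a path: it may fail on the
    zero set of any local denominator. What can be carried is that a point is a limit of open sets
    on which the equality holds; the regularity clause is then used once, at the end point.

    With the l1-norm, a series of functions with summable norms is again a power series by mere
    rearrangement, so limits of analytic functions need neither Cauchy's formula nor complex
    derivatives. The price is that every estimate must be made inside the algebra, hence the exact
    factorizations that precede the bounds. A function of [s] alone is treated as a function of two
    variables constant in the second, so one identity theorem serves both uses.

    The two bounds on the difference are joined by interpolation: the one that applies is at most a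
    constant times m^(eps - sigma) n^(-1-eps), where sigma > 1 bounds Re s from below. This
    separates the variables, and for 0 < eps < sigma - 1 both sums converge. *)

Definition Clim (u : nat -> C) (l : C) : Prop :=
  is_lim_seq (fun n => Cmod (u n - l)%C) 0.

Definition Cser (a : nat -> C) (l : C) : Prop := Clim (sum_n a) l.

Lemma Csum_Sn (a : nat -> C) (n : nat) :
  sum_n a (S n) = (sum_n a n + a (S n))%C :> C.
Proof. now rewrite sum_Sn. Qed.

Lemma Rsum_Sn (a : nat -> R) (n : nat) :
  sum_n a (S n) = sum_n a n + a (S n) :> R.
Proof. now rewrite sum_Sn. Qed.

Lemma Csum_0 (a : nat -> C) : sum_n a 0%nat = a 0%nat :> C.
Proof. now rewrite sum_O. Qed.

Lemma Rsum_0 (a : nat -> R) : sum_n a 0%nat = a 0%nat :> R.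
Proof. now rewrite sum_O. Qed.

Lemma Csum_plus (a b : nat -> C) (n : nat) :
  sum_n (fun k => (a k + b k)%C) n = (sum_n a n + sum_n b n)%C :> C.
Proof. exact (sum_n_plus a b n). Qed.

Lemma Csum_mult_l (c : C) (a : nat -> C) (n : nat) :
  sum_n (fun k => (c * a k)%C) n = (c * sum_n a n)%C :> C.
Proof. exact (sum_n_mult_l (K := C_Ring) c a n). Qed.

Lemma Csum_minus (a b : nat -> C) (n : nat) :
  sum_n (fun k => (a k - b k)%C) n = (sum_n a n - sum_n b n)%C :> C.
Proof.
  induction n as [|n IH].
  - now rewrite !Csum_0.
  - rewrite !Csum_Sn, IH. ring.
Qed.

Lemma Rsum_plus (a b : nat -> R) (n : nat) :
  sum_n (fun k => a k + b k) n = sum_n a n + sum_n b n :> R.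
Proof. exact (sum_n_plus a b n). Qed.

Lemma Rsum_mult_l (c : R) (a : nat -> R) (n : nat) :
  sum_n (fun k => c * a k) n = c * sum_n a n :> R.
Proof. exact (sum_n_mult_l (K := R_Ring) c a n). Qed.

Lemma Csum_Cmod (a : nat -> C) (n : nat) :
  Cmod (sum_n a n) <= sum_n (fun k => Cmod (a k)) n.
Proof.
  induction n as [|n IH].
  - rewrite Csum_0, Rsum_0. lra.
  - rewrite Csum_Sn, Rsum_Sn.
    eapply Rle_trans; [apply Cmod_triangle|lra].
Qed.

Lemma Rsum_le (a b : nat -> R) (n : nat) :
  (forall k, (k <= n)%nat -> a k <= b k) -> sum_n a n <= sum_n b n.
Proof.
  induction n as [|n IH]; intros H.
  - rewrite !Rsum_0. apply H; lia.
  - rewrite !Rsum_Sn. apply Rplus_le_compat; [apply IH; intros; apply H; lia|apply H; lia].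
Qed.

Lemma Rsum_nonneg (a : nat -> R) (n : nat) :
  (forall k, 0 <= a k) -> 0 <= sum_n a n.
Proof.
  intros H. induction n as [|n IH].
  - rewrite Rsum_0. apply H.
  - rewrite Rsum_Sn. specialize (H (S n)). lra.
Qed.

Lemma Rsum_incr (a : nat -> R) (n m : nat) :
  (forall k, 0 <= a k) -> (n <= m)%nat -> sum_n a n <= sum_n a m.
Proof.
  intros H Hnm. induction Hnm as [|m Hnm IH]; [lra|].
  rewrite Rsum_Sn. specialize (H (S m)). lra.
Qed.

Lemma Rsum_term_le (a : nat -> R) (n k : nat) :
  (forall i, 0 <= a i) -> (k <= n)%nat -> a k <= sum_n a n.
Proof.
  intros H Hk. eapply Rle_trans; [|apply (Rsum_incr a k n H Hk)].
  destruct k; [rewrite Rsum_0; lra|].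
  rewrite Rsum_Sn. assert (0 <= sum_n a k) by (apply Rsum_nonneg; auto). lra.
Qed.

Lemma Cmod_minus_sym (a b : C) : Cmod (a - b)%C = Cmod (b - a)%C.
Proof. rewrite <- Cmod_opp. f_equal. ring. Qed.

Lemma Cmod_minus_le (a b : C) : Cmod (a - b)%C <= Cmod a + Cmod b.
Proof. unfold Cminus. rewrite <- (Cmod_opp b). apply Cmod_triangle. Qed.

Lemma Clim_filterlim (u : nat -> C) (l : C) :
  Clim u l <-> filterlim u eventually (locally l).
Proof.
  unfold Clim. split.
  - intros H P [eps HP].
    apply is_lim_seq_spec in H. destruct (H eps) as [N HN].
    exists N. intros n Hn. apply HP.
    apply C_NormedModule_mixin_compat1.
    specialize (HN n Hn). rewrite Rminus_0_r, Rabs_pos_eq in HN by apply Cmod_ge_0.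
    exact HN.
  - intros H. apply is_lim_seq_spec. intros eps.
    (* The uniform structure of [C] is that of a product: a ball of radius [d] only gives a modulus
       below [sqrt 2] times [d]. *)
    assert (He : 0 < eps / sqrt 2).
    { apply Rdiv_lt_0_compat; [apply cond_pos|apply sqrt_lt_R0; lra]. }
    destruct (H (fun x => ball l (mkposreal _ He) x)) as [N HN].
    { exists (mkposreal _ He). now intros. }
    exists N. intros n Hn. rewrite Rminus_0_r, Rabs_pos_eq by apply Cmod_ge_0.
    specialize (HN n Hn). apply (C_NormedModule_mixin_compat2 l (u n)) in HN.
    simpl in HN. replace (sqrt 2 * (eps / sqrt 2)) with (pos eps) in HN; [exact HN|].
    field. apply Rgt_not_eq, sqrt_lt_R0. lra.
Qed.

Lemma Cser_is_series (a : nat -> C) (l : C) : Cser a l <-> is_series a l.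
Proof. apply Clim_filterlim. Qed.

Lemma Clim_squeeze (u : nat -> C) (l : C) (e : nat -> R) :
  (forall n, Cmod (u n - l)%C <= e n) -> is_lim_seq e 0 -> Clim u l.
Proof.
  intros H He. unfold Clim.
  apply (is_lim_seq_le_le (fun _ => 0) _ e 0); auto.
  - intros n. split; [apply Cmod_ge_0|apply H].
  - apply is_lim_seq_const.
Qed.

Lemma Clim_ext (u v : nat -> C) (l : C) :
  (forall n, u n = v n) -> Clim u l -> Clim v l.
Proof.
  intros H. apply is_lim_seq_ext. intros n. now rewrite H.
Qed.

Lemma Clim_const (c : C) : Clim (fun _ => c) c.
Proof.
  apply Clim_squeeze with (fun _ => 0); [|apply is_lim_seq_const].
  intros n. replace (c - c)%C with (RtoC 0) by ring. rewrite Cmod_0. lra.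
Qed.

Lemma Clim_plus (u v : nat -> C) (k l : C) :
  Clim u k -> Clim v l -> Clim (fun n => u n + v n)%C (k + l)%C.
Proof.
  intros Hu Hv.
  apply Clim_squeeze with (fun n => Cmod (u n - k)%C + Cmod (v n - l)%C).
  - intros n. eapply Rle_trans; [|apply Cmod_triangle].
    right. f_equal. ring.
  - replace 0 with (0 + 0) by ring. now apply is_lim_seq_plus'.
Qed.

Lemma Clim_scal (c : C) (u : nat -> C) (l : C) :
  Clim u l -> Clim (fun n => c * u n)%C (c * l)%C.
Proof.
  intros Hu. apply Clim_squeeze with (fun n => Cmod c * Cmod (u n - l)%C).
  - intros n. rewrite <- Cmod_mult. right. f_equal. ring.
  - replace 0 with (Cmod c * 0) by ring. now apply (is_lim_seq_scal_l _ _ 0).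
Qed.

Lemma Clim_minus (u v : nat -> C) (k l : C) :
  Clim u k -> Clim v l -> Clim (fun n => u n - v n)%C (k - l)%C.
Proof.
  intros Hu Hv.
  apply (Clim_ext (fun n => u n + (-(1)) * v n)%C); [intros; ring|].
  replace (k - l)%C with (k + (-(1)) * l)%C by ring.
  apply Clim_plus; [exact Hu|now apply Clim_scal].
Qed.

Lemma Clim_bound (u : nat -> C) (l : C) (M : R) :
  (forall n, Cmod (u n) <= M) -> Clim u l -> Cmod l <= M.
Proof.
  intros H Hu.
  assert (Hl : is_lim_seq (fun n => M + Cmod (u n - l)%C) (M + 0)).
  { apply is_lim_seq_plus'; [apply is_lim_seq_const|exact Hu]. }
  rewrite Rplus_0_r in Hl.
  apply (is_lim_seq_le (fun _ => Cmod l) _ (Cmod l) M) in Hl; auto.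
  - intros n. replace l with (u n - (u n - l))%C at 1 by ring.
    eapply Rle_trans; [apply Cmod_minus_le|]. specialize (H n). lra.
  - apply is_lim_seq_const.
Qed.

Lemma Clim_unique (u : nat -> C) (k l : C) : Clim u k -> Clim u l -> k = l.
Proof.
  intros Hk Hl.
  assert (H : Clim (fun n => u n - u n)%C (k - l)%C) by now apply Clim_minus.
  apply Clim_bound with (M := 0) in H.
  - assert (H0 : Cmod (k - l)%C = 0) by (pose proof (Cmod_ge_0 (k - l)%C); lra).
    apply Cmod_eq_0 in H0. replace k with ((k - l) + l)%C by ring. rewrite H0. ring.
  - intros n. replace (u n - u n)%C with (RtoC 0) by ring. rewrite Cmod_0. lra.
Qed.

Lemma Clim_incr_1 (u : nat -> C) (l : C) : Clim (fun n => u (S n)) l -> Clim u l.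
Proof. intros H. now apply is_lim_seq_incr_1. Qed.

Lemma Clim_incr_n (u : nat -> C) (l : C) (n : nat) :
  Clim u l -> Clim (fun k => u (n + k)%nat) l.
Proof.
  intros H. unfold Clim.
  apply (is_lim_seq_incr_n _ n) in H.
  eapply is_lim_seq_ext; [|exact H]. intros k. simpl. now rewrite Nat.add_comm.
Qed.

Lemma Cser_ext (a b : nat -> C) (l : C) :
  (forall n, a n = b n) -> Cser a l -> Cser b l.
Proof. intros H. apply Clim_ext. intros n. now apply sum_n_ext. Qed.

Lemma Cser_plus (a b : nat -> C) (k l : C) :
  Cser a k -> Cser b l -> Cser (fun n => a n + b n)%C (k + l)%C.
Proof.
  intros Ha Hb. eapply Clim_ext; [|apply (Clim_plus _ _ _ _ Ha Hb)].
  intros n. simpl. now rewrite Csum_plus.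
Qed.

Lemma Cser_minus (a b : nat -> C) (k l : C) :
  Cser a k -> Cser b l -> Cser (fun n => a n - b n)%C (k - l)%C.
Proof.
  intros Ha Hb. eapply Clim_ext; [|apply (Clim_minus _ _ _ _ Ha Hb)].
  intros n. simpl. now rewrite Csum_minus.
Qed.

Lemma Cser_scal (c : C) (a : nat -> C) (l : C) :
  Cser a l -> Cser (fun n => c * a n)%C (c * l)%C.
Proof.
  intros Ha. eapply Clim_ext; [|apply (Clim_scal c _ _ Ha)].
  intros n. simpl. now rewrite Csum_mult_l.
Qed.

Lemma Cser_shift (a : nat -> C) (l : C) :
  Cser (fun n => a (S n)) l -> Cser a (a 0%nat + l)%C.
Proof.
  intros H. apply Clim_incr_1.
  eapply Clim_ext; [|apply (Clim_plus _ _ _ _ (Clim_const (a 0%nat)) H)].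
  intros n. simpl. induction n as [|n IH].
  - now rewrite Csum_Sn, !Csum_0.
  - rewrite (Csum_Sn _ (S n)), Csum_Sn, <- IH. ring.
Qed.

Lemma Re_sum_n (a : nat -> C) (n : nat) : Re (sum_n a n) = sum_n (fun k => Re (a k)) n.
Proof.
  induction n as [|n IH]; [now rewrite !sum_O|].
  rewrite Csum_Sn, Rsum_Sn, <- IH. reflexivity.
Qed.

Lemma Im_sum_n (a : nat -> C) (n : nat) : Im (sum_n a n) = sum_n (fun k => Im (a k)) n.
Proof.
  induction n as [|n IH]; [now rewrite !sum_O|].
  rewrite Csum_Sn, Rsum_Sn, <- IH. reflexivity.
Qed.

Lemma Im_le_Cmod (c : C) : Rabs (Im c) <= Cmod c.
Proof.
  eapply Rle_trans; [|apply Rmax_Cmod]. apply Rmax_r.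
Qed.

Lemma Cser_Re (a : nat -> C) (l : C) : Cser a l -> is_series (fun n => Re (a n)) (Re l).
Proof.
  intros H. apply (is_lim_seq_spec _ (Finite (Re l))).
  intros eps. apply is_lim_seq_spec in H. destruct (H eps) as [N HN].
  exists N. intros n Hn. specialize (HN n Hn).
  rewrite Rminus_0_r, Rabs_pos_eq in HN by apply Cmod_ge_0.
  rewrite <- Re_sum_n. eapply Rle_lt_trans; [|exact HN].
  apply (re_le_Cmod (sum_n a n - l)%C).
Qed.

Lemma Cser_Im (a : nat -> C) (l : C) : Cser a l -> is_series (fun n => Im (a n)) (Im l).
Proof.
  intros H. apply (is_lim_seq_spec _ (Finite (Im l))).
  intros eps. apply is_lim_seq_spec in H. destruct (H eps) as [N HN].
  exists N. intros n Hn. specialize (HN n Hn).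
  rewrite Rminus_0_r, Rabs_pos_eq in HN by apply Cmod_ge_0.
  rewrite <- Im_sum_n. eapply Rle_lt_trans; [|exact HN].
  apply (Im_le_Cmod (sum_n a n - l)%C).
Qed.

Lemma CSeries_unique (a : nat -> C) (l : C) : Cser a l -> CSeries a = l.
Proof.
  intros H. unfold CSeries.
  rewrite (is_series_unique _ _ (Cser_Re _ _ H)), (is_series_unique _ _ (Cser_Im _ _ H)).
  now destruct l.
Qed.

(** Completeness of [C] yields some limit, which is then identified with the componentwise sum
    [CSeries]. *)
Lemma Cser_CSeries (a : nat -> C) (b : nat -> R) :
  (forall n, Cmod (a n) <= b n) -> ex_series b -> Cser a (CSeries a).
Proof.
  intros H Hb.
  assert (Ha : ex_series (V := C_NormedModule) a).
  { apply (ex_series_le (V := C_CompleteNormedModule) a b); [|exact Hb].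
    intros n. exact (H n). }
  destruct Ha as [l Hl].
  apply Cser_is_series in Hl. now rewrite (CSeries_unique _ _ Hl).
Qed.

Lemma ex_series_pos_le (a b : nat -> R) :
  (forall n, 0 <= a n <= b n) -> ex_series b -> ex_series a.
Proof.
  intros H Hb. apply (ex_series_le (V := R_CompleteNormedModule) a b); auto.
  intros n. unfold norm; simpl. unfold abs; simpl.
  rewrite Rabs_pos_eq; apply H.
Qed.

Lemma sum_n_le_Series (b : nat -> R) (n : nat) :
  (forall k, 0 <= b k) -> ex_series b -> sum_n b n <= Series b.
Proof.
  intros Hp Hb. apply Series_correct in Hb.
  apply (is_lim_seq_incr_compare (sum_n b) (Series b)); [exact Hb|].
  intros k. rewrite Rsum_Sn. specialize (Hp (S k)). lra.
Qed.

Lemma ex_series_bounded (a : nat -> R) (M : R) :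
  (forall n, 0 <= a n) -> (forall n, sum_n a n <= M) -> ex_series a /\ Series a <= M.
Proof.
  intros Hp HM.
  assert (Hex : ex_finite_lim_seq (sum_n a)).
  { apply ex_finite_lim_seq_incr with M; auto.
    intros n. rewrite Rsum_Sn. specialize (Hp (S n)). lra. }
  destruct Hex as [l Hl].
  assert (Hs : is_series a l) by exact Hl.
  split; [now exists l|]. rewrite (is_series_unique _ _ Hs).
  apply (is_lim_seq_le (sum_n a) (fun _ => M) l M); auto. apply is_lim_seq_const.
Qed.

Lemma Cser_bound (a : nat -> C) (l : C) (b : nat -> R) :
  (forall n, Cmod (a n) <= b n) -> ex_series b -> Cser a l -> Cmod l <= Series b.
Proof.
  intros H Hb Hl. apply Clim_bound with (sum_n a); [|exact Hl].
  intros n. eapply Rle_trans; [apply Csum_Cmod|].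
  eapply Rle_trans; [apply Rsum_le; intros; apply H|].
  apply sum_n_le_Series; auto.
  intros k. eapply Rle_trans; [apply Cmod_ge_0|apply H].
Qed.

(** Dominated convergence: the first [n] terms tend to 0 for fixed [n], and the rest is at most the
    tail of [B], whatever [K] is. *)
Lemma Tannery_R (e : nat -> nat -> R) (B : nat -> R) :
  (forall K m, 0 <= e K m <= B m) -> ex_series B ->
  (forall m, is_lim_seq (fun K => e K m) 0) ->
  is_lim_seq (fun K => Series (e K)) 0.
Proof.
  intros He HB Hl. apply is_lim_seq_spec. intros eps.
  assert (HeK : forall K, ex_series (e K)) by (intros K; now apply ex_series_pos_le with B).
  assert (Hlim := Series_correct _ HB).
  assert (Hh : 0 < eps / 2) by (pose proof (cond_pos eps); lra).
  assert (Hlim' : is_lim_seq (sum_n B) (Series B)) by exact Hlim.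
  apply is_lim_seq_spec in Hlim'.
  (* The cut [n] is chosen from [B] alone, before [K]. *)
  destruct (Hlim' (mkposreal _ Hh)) as [n Hn]. simpl in Hn.
  assert (Hfin : is_lim_seq (fun K => sum_n (e K) n) 0).
  { clear Hn. induction n as [|n IH].
    - eapply is_lim_seq_ext; [|apply (Hl 0%nat)]. intros K. now rewrite Rsum_0.
    - apply (is_lim_seq_ext (fun K => sum_n (e K) n + e K (S n))).
      + intros K. now rewrite Rsum_Sn.
      + replace 0 with (0 + 0) by ring. apply is_lim_seq_plus'; auto. }
  apply is_lim_seq_spec in Hfin. destruct (Hfin (mkposreal _ Hh)) as [N HN]. simpl in HN.
  exists N. intros K HK. specialize (HN K HK).
  assert (H0 : 0 <= Series (e K)).
  { eapply Rle_trans; [|apply (sum_n_le_Series (e K) 0); [intros; apply He|apply HeK]].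
    rewrite Rsum_0. apply He. }
  rewrite Rminus_0_r, Rabs_pos_eq by exact H0.
  rewrite Rminus_0_r, Rabs_pos_eq in HN by (apply Rsum_nonneg; intros; apply He).
  specialize (Hn n (Nat.le_refl n)). apply Rabs_def2 in Hn.
  assert (Hmain : Series (e K) <= sum_n (e K) n + (Series B - sum_n B n)).
  { assert (Hs : is_series (e K) (Series (e K))) by now apply Series_correct.
    apply (is_lim_seq_le_loc (sum_n (e K)) (fun _ => sum_n (e K) n + (Series B - sum_n B n))
             (Series (e K)) (sum_n (e K) n + (Series B - sum_n B n))); [|exact Hs|apply is_lim_seq_const].
    exists n. intros p Hp.
    assert (Hd : sum_n (e K) p - sum_n (e K) n <= sum_n B p - sum_n B n).
    { induction Hp as [|p Hp IH]; [lra|]. rewrite !Rsum_Sn.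
      destruct (He K (S p)). lra. }
    assert (sum_n B p <= Series B).
    { apply sum_n_le_Series; auto. intros k. destruct (He K k). lra. }
    lra. }
  lra.
Qed.

(** The moduli of [u K m - v m] are dominated by [2 B]. This is the tool behind the later
    interchanges of two infinite summations. *)
Lemma Tannery (u : nat -> nat -> C) (v lu : nat -> C) (lv : C) (B : nat -> R) :
  (forall K m, Cmod (u K m) <= B m) -> ex_series B ->
  (forall m, Clim (fun K => u K m) (v m)) ->
  (forall K, Cser (u K) (lu K)) -> Cser v lv -> Clim lu lv.
Proof.
  intros Hu HB Hl Hlu Hlv.
  assert (Hv : forall m, Cmod (v m) <= B m).
  { intros m. now apply Clim_bound with (fun K => u K m). }
  apply Clim_squeeze with (fun K => Series (fun m => Cmod (u K m - v m)%C)).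
  - intros K. apply Cser_bound with (fun m => (u K m - v m)%C).
    + intros; lra.
    + apply ex_series_pos_le with (fun m => B m + B m).
      * intros m. split; [apply Cmod_ge_0|]. eapply Rle_trans; [apply Cmod_minus_le|].
        specialize (Hu K m). specialize (Hv m). lra.
      * now apply (ex_series_plus B B).
    + now apply Cser_minus.
  - apply Tannery_R with (fun m => B m + B m).
    + intros K m. split; [apply Cmod_ge_0|]. eapply Rle_trans; [apply Cmod_minus_le|].
      specialize (Hu K m). specialize (Hv m). lra.
    + now apply (ex_series_plus B B).
    + exact Hl.
Qed.

Lemma Cser_finite (a : nat -> C) (n : nat) :
  (forall k, (n < k)%nat -> a k = RtoC 0) -> Cser a (sum_n a n).
Proof.
  intros H.
  assert (E : forall k, sum_n a (n + k)%nat = sum_n a n :> C).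
  { induction k as [|k IH]; [now rewrite Nat.add_0_r|].
    rewrite Nat.add_succ_r, Csum_Sn, IH, H by lia. ring. }
  unfold Cser, Clim. apply (is_lim_seq_incr_n _ n).
  eapply is_lim_seq_ext; [|apply (Clim_const (sum_n a n))].
  intros k. simpl. now rewrite Nat.add_comm, E.
Qed.

(** * The Banach algebra of absolutely convergent double power series *)

Definition dsum {G : AbelianMonoid} (a : nat -> nat -> G) (N : nat) : G :=
  sum_n (fun j => sum_n (fun k => a j k) N) N.

(** The increment of the sums over squares, a column and a row with the corner counted once. It
    turns a double series into an ordinary one. *)
Definition shell {G : AbelianMonoid} (a : nat -> nat -> G) (N : nat) : G :=
  match N with
  | O => a O O
  | S n => plus (sum_n (fun j => a j (S n)) n) (sum_n (fun k => a (S n) k) (S n))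
  end.

Lemma sum_shell {G : AbelianMonoid} (a : nat -> nat -> G) (N : nat) :
  sum_n (shell a) N = dsum a N.
Proof.
  unfold dsum. induction N as [|N IH].
  - now rewrite !sum_O.
  - rewrite sum_Sn, IH. rewrite (sum_Sn (fun j => sum_n _ (S N))). simpl shell.
    rewrite plus_assoc. f_equal.
    rewrite <- sum_n_plus. apply sum_n_ext. intros j. now rewrite sum_Sn.
Qed.

Lemma dsum_Cmod (a : nat -> nat -> C) (N : nat) :
  Cmod (dsum a N) <= dsum (fun j k => Cmod (a j k)) N.
Proof.
  unfold dsum. eapply Rle_trans; [apply Csum_Cmod|].
  apply Rsum_le. intros j _. apply Csum_Cmod.
Qed.

Lemma dsumR_le (a b : nat -> nat -> R) (N : nat) :
  (forall j k, a j k <= b j k) -> dsum a N <= dsum b N.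
Proof. intros H. apply Rsum_le. intros j _. apply Rsum_le. intros k _. apply H. Qed.

Lemma dsumR_scal (x : R) (a : nat -> nat -> R) (N : nat) :
  dsum (fun j k => x * a j k) N = x * dsum a N :> R.
Proof.
  unfold dsum. rewrite <- Rsum_mult_l. apply sum_n_ext. intros j. apply Rsum_mult_l.
Qed.

Lemma dsumC_scal (x : C) (a : nat -> nat -> C) (N : nat) :
  dsum (fun j k => x * a j k)%C N = (x * dsum a N)%C :> C.
Proof.
  unfold dsum. rewrite <- Csum_mult_l. apply sum_n_ext. intros j. apply Csum_mult_l.
Qed.

Lemma dsum_ext {G : AbelianMonoid} (a b : nat -> nat -> G) (N : nat) :
  (forall j k, a j k = b j k) -> dsum a N = dsum b N.
Proof. intros H. apply sum_n_ext. intros j. apply sum_n_ext. intros k. apply H. Qed.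

Lemma dsum_plus {G : AbelianMonoid} (a b : nat -> nat -> G) (N : nat) :
  dsum (fun j k => plus (a j k) (b j k)) N = plus (dsum a N) (dsum b N).
Proof.
  unfold dsum. rewrite <- sum_n_plus. apply sum_n_ext. intros j. apply sum_n_plus.
Qed.

Lemma sum_n_delta {G : AbelianMonoid} (y : nat -> G) (q N : nat) :
  sum_n (fun k => if (k =? q)%nat then y k else zero) N
  = if (q <=? N)%nat then y q else zero.
Proof.
  induction N as [|N IH].
  - rewrite sum_O. destruct q; reflexivity.
  - rewrite sum_Sn, IH.
    destruct (Nat.leb_spec q N), (Nat.eqb_spec (S N) q), (Nat.leb_spec q (S N));
      try lia; subst; rewrite ?plus_zero_l, ?plus_zero_r; reflexivity.
Qed.

Lemma dsum_delta {G : AbelianMonoid} (x : nat -> nat -> G) (p q N : nat) :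
  dsum (fun j k => if (j =? p)%nat then if (k =? q)%nat then x j k else zero else zero) N
  = if (p <=? N)%nat then if (q <=? N)%nat then x p q else zero else zero.
Proof.
  unfold dsum.
  rewrite (sum_n_ext _ (fun j => if (j =? p)%nat then
    (if (q <=? N)%nat then x j q else zero) else zero)).
  - apply sum_n_delta.
  - intros j. destruct (j =? p)%nat; [apply sum_n_delta|].
    induction N as [|N IH]; [now rewrite sum_O|now rewrite sum_Sn, IH, plus_zero_l].
Qed.

Lemma is_series_sum_n {K : AbsRing} {V : NormedModule K}
    (g : nat -> nat -> V) (l : nat -> V) (n : nat) :
  (forall k, is_series (fun m => g m k) (l k)) ->
  is_series (fun m => sum_n (g m) n) (sum_n l n).
Proof.
  intros H. induction n as [|n IH].
  - rewrite sum_O. eapply is_series_ext; [|apply H]. intros m. now rewrite sum_O.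
  - rewrite sum_Sn. eapply is_series_ext; [|apply (is_series_plus _ _ _ _ IH (H (S n)))].
    intros m. now rewrite sum_Sn.
Qed.

Lemma is_series_dsum {K : AbsRing} {V : NormedModule K}
    (g : nat -> nat -> nat -> V) (l : nat -> nat -> V) (n : nat) :
  (forall j k, is_series (fun m => g m j k) (l j k)) ->
  is_series (fun m => dsum (g m) n) (dsum l n).
Proof.
  intros H. unfold dsum. apply (is_series_sum_n (fun m j => sum_n (g m j) n)).
  intros j. apply (is_series_sum_n (fun m k => g m j k)). apply H.
Qed.

(** [ana z0 w0 r M f]: on the closed polydisc of radius [r] around [(z0, w0)]
    the function [f] is the sum of a power series whose weighted l1-norm is at
    most [M]. *)
Definition ana (z0 w0 : C) (r M : R) (f : C -> C -> C) : Prop :=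
  exists c : nat -> nat -> C,
    (forall N, dsum (fun j k => Cmod (c j k) * (r ^ j * r ^ k)) N <= M) /\
    forall z w : C, Cmod (z - z0)%C <= r -> Cmod (w - w0)%C <= r ->
      Clim (dsum (fun j k => c j k * ((z - z0) ^ j * (w - w0) ^ k))%C) (f z w).

Lemma mono_le (z w : C) (r : R) (j k : nat) :
  Cmod z <= r -> Cmod w <= r -> Cmod (z ^ j * w ^ k)%C <= r ^ j * r ^ k.
Proof.
  intros Hz Hw. rewrite Cmod_mult, !Cmod_pow.
  apply Rmult_le_compat; try (apply pow_le, Cmod_ge_0);
    apply pow_incr; split; auto; apply Cmod_ge_0.
Qed.

Lemma pseries_abs_le (c : nat -> nat -> C) (r M : R) (z w : C) (N : nat) :
  (forall N, dsum (fun j k => Cmod (c j k) * (r ^ j * r ^ k)) N <= M) ->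
  Cmod z <= r -> Cmod w <= r ->
  dsum (fun j k => Cmod (c j k * (z ^ j * w ^ k))%C) N <= M.
Proof.
  intros H Hz Hw. eapply Rle_trans; [|apply (H N)]. apply dsumR_le. intros j k.
  rewrite Cmod_mult. apply Rmult_le_compat_l; [apply Cmod_ge_0|now apply mono_le].
Qed.

Section Algebra.

Variables (z0 w0 : C) (r : R).
Hypothesis Hr : 0 < r.

Lemma ana_ext (M : R) (f g : C -> C -> C) :
  (forall z w, Cmod (z - z0)%C <= r -> Cmod (w - w0)%C <= r -> f z w = g z w) ->
  ana z0 w0 r M f -> ana z0 w0 r M g.
Proof.
  intros H [c [Hc Hf]]. exists c. split; [exact Hc|].
  intros z w Hz Hw. rewrite <- H by assumption. now apply Hf.
Qed.

Lemma ana_le (M M' : R) (f : C -> C -> C) :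
  M <= M' -> ana z0 w0 r M f -> ana z0 w0 r M' f.
Proof.
  intros H [c [Hc Hf]]. exists c. split; [|exact Hf].
  intros N. eapply Rle_trans; [apply Hc|exact H].
Qed.

Lemma ana_bound (M : R) (f : C -> C -> C) (z w : C) :
  ana z0 w0 r M f -> Cmod (z - z0)%C <= r -> Cmod (w - w0)%C <= r ->
  Cmod (f z w) <= M.
Proof.
  intros [c [Hc Hf]] Hz Hw. eapply Clim_bound; [|apply Hf; assumption].
  intros N. eapply Rle_trans; [apply dsum_Cmod|].
  now apply pseries_abs_le with r.
Qed.

Lemma ana_nonneg (M : R) (f : C -> C -> C) : ana z0 w0 r M f -> 0 <= M.
Proof.
  intros H. eapply Rle_trans; [apply Cmod_ge_0|apply (ana_bound M f z0 w0 H)];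
    replace (z0 - z0)%C with (RtoC 0) by ring;
    replace (w0 - w0)%C with (RtoC 0) by ring; rewrite Cmod_0; lra.
Qed.

Lemma ana_plus (M M' : R) (f g : C -> C -> C) :
  ana z0 w0 r M f -> ana z0 w0 r M' g ->
  ana z0 w0 r (M + M') (fun z w => f z w + g z w)%C.
Proof.
  intros [c [Hc Hf]] [d [Hd Hg]]. exists (fun j k => c j k + d j k)%C. split.
  - intros N. eapply Rle_trans; [|apply Rplus_le_compat; [apply (Hc N)|apply (Hd N)]].
    change (dsum (fun j k => Cmod (c j k) * (r ^ j * r ^ k)) N
      + dsum (fun j k => Cmod (d j k) * (r ^ j * r ^ k)) N)
    with (plus (dsum (fun j k => Cmod (c j k) * (r ^ j * r ^ k)) N)
      (dsum (fun j k => Cmod (d j k) * (r ^ j * r ^ k)) N)).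
    rewrite <- dsum_plus. apply dsumR_le. intros j k.
    assert (0 <= r ^ j * r ^ k) by (apply Rmult_le_pos; apply pow_le; lra).
    pose proof (Cmod_triangle (c j k) (d j k)).
    unfold plus; simpl. nra.
  - intros z w Hz Hw.
    eapply Clim_ext; [|apply (Clim_plus _ _ _ _ (Hf z w Hz Hw) (Hg z w Hz Hw))].
    intros N. simpl. symmetry. etransitivity; [|apply (dsum_plus (G := C_AbelianMonoid))].
    apply dsum_ext. intros j k. unfold plus; simpl. ring.
Qed.

Lemma ana_scal (a : C) (M : R) (f : C -> C -> C) :
  ana z0 w0 r M f -> ana z0 w0 r (Cmod a * M) (fun z w => a * f z w)%C.
Proof.
  intros [c [Hc Hf]]. exists (fun j k => a * c j k)%C. split.
  - intros N. eapply Rle_trans; [|apply Rmult_le_compat_l; [apply Cmod_ge_0|apply (Hc N)]].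
    rewrite <- dsumR_scal. right. apply dsum_ext. intros j k. rewrite Cmod_mult.
    apply Rmult_assoc.
  - intros z w Hz Hw. eapply Clim_ext; [|apply (Clim_scal a _ _ (Hf z w Hz Hw))].
    intros N. simpl. rewrite <- dsumC_scal. apply dsum_ext. intros j k. simpl. ring.
Qed.

Lemma ana_mono (p q : nat) :
  ana z0 w0 r (r ^ p * r ^ q) (fun z w => (z - z0) ^ p * (w - w0) ^ q)%C.
Proof.
  exists (fun j k => if (j =? p)%nat then if (k =? q)%nat then RtoC 1 else RtoC 0 else RtoC 0).
  assert (Hp : 0 <= r ^ p * r ^ q) by (apply Rmult_le_pos; apply pow_le; lra).
  split.
  - intros N.
    rewrite (dsum_ext _ (fun j k => if (j =? p)%nat then if (k =? q)%nat then
      (r ^ j * r ^ k) else zero else zero)).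
    + rewrite (dsum_delta (fun j k => r ^ j * r ^ k)).
      destruct (p <=? N)%nat, (q <=? N)%nat; unfold zero; simpl; lra.
    + intros j k. unfold zero; simpl.
      destruct (j =? p)%nat, (k =? q)%nat; rewrite ?Cmod_1, ?Cmod_0; ring.
  - intros z w Hz Hw.
    apply (is_lim_seq_incr_n _ (p + q)%nat).
    eapply is_lim_seq_ext; [|apply (Clim_const ((z - z0) ^ p * (w - w0) ^ q)%C)].
    intros n. simpl. do 2 f_equal.
    rewrite (dsum_ext _ (fun j k => if (j =? p)%nat then if (k =? q)%nat then
      ((z - z0) ^ j * (w - w0) ^ k)%C else zero else zero)).
    + rewrite (dsum_delta (fun j k => ((z - z0) ^ j * (w - w0) ^ k)%C)).
      destruct (Nat.leb_spec p (n + (p + q))), (Nat.leb_spec q (n + (p + q)));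
        try lia; reflexivity.
    + intros j k. unfold zero; simpl.
      destruct (j =? p)%nat, (k =? q)%nat; ring.
Qed.

Lemma ana_const (a : C) : ana z0 w0 r (Cmod a) (fun _ _ => a).
Proof.
  apply ana_ext with (fun z w => a * ((z - z0) ^ 0 * (w - w0) ^ 0))%C.
  - intros z w _ _. simpl. ring.
  - apply ana_le with (Cmod a * (r ^ 0 * r ^ 0)); [simpl; lra|].
    apply ana_scal, ana_mono.
Qed.

Lemma ana_fst : ana z0 w0 r r (fun z _ => z - z0)%C.
Proof.
  apply ana_ext with (fun z w => ((z - z0) ^ 1 * (w - w0) ^ 0))%C.
  - intros z w _ _. simpl. ring.
  - apply ana_le with (r ^ 1 * r ^ 0); [simpl; lra|]. apply ana_mono.
Qed.

Lemma ana_snd : ana z0 w0 r r (fun _ w => w - w0)%C.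
Proof.
  apply ana_ext with (fun z w => ((z - z0) ^ 0 * (w - w0) ^ 1))%C.
  - intros z w _ _. simpl. ring.
  - apply ana_le with (r ^ 0 * r ^ 1); [simpl; lra|]. apply ana_mono.
Qed.

Lemma ana_opp (M : R) (f : C -> C -> C) :
  ana z0 w0 r M f -> ana z0 w0 r M (fun z w => - f z w)%C.
Proof.
  intros H. apply ana_ext with (fun z w => (-(1)) * f z w)%C; [intros; ring|].
  apply ana_le with (Cmod (-(1))%C * M).
  - rewrite Cmod_opp, Cmod_1. lra.
  - now apply ana_scal.
Qed.

Lemma ana_minus (M M' : R) (f g : C -> C -> C) :
  ana z0 w0 r M f -> ana z0 w0 r M' g ->
  ana z0 w0 r (M + M') (fun z w => f z w - g z w)%C.
Proof. intros Hf Hg. apply ana_plus; [exact Hf|now apply ana_opp]. Qed.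

Lemma ana_sum_n (A : nat -> R) (h : nat -> C -> C -> C) (n : nat) :
  (forall k, ana z0 w0 r (A k) (h k)) ->
  ana z0 w0 r (sum_n A n) (fun z w => sum_n (fun k => h k z w) n).
Proof.
  intros H. induction n as [|n IH].
  - rewrite Rsum_0. eapply ana_ext; [|apply (H 0%nat)]. intros. now rewrite Csum_0.
  - rewrite Rsum_Sn. eapply ana_ext; [|apply (ana_plus _ _ _ _ IH (H (S n)))].
    intros. now rewrite Csum_Sn.
Qed.

(** The Weierstrass test in norm. Coefficients are summed one by one; the norm of the result is
    bounded on each finite square by exchanging it with the sum over [m], and its values are
    identified by [Tannery] with [M] as dominating sequence. *)
Lemma ana_series (M : nat -> R) (f : nat -> C -> C -> C) (F : C -> C -> C) :
  (forall m, ana z0 w0 r (M m) (f m)) -> ex_series M ->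
  (forall z w, Cmod (z - z0)%C <= r -> Cmod (w - w0)%C <= r ->
    Cser (fun m => f m z w) (F z w)) ->
  ana z0 w0 r (Series M) F.
Proof.
  intros Hf HM HF.
  destruct (functional_choice _ Hf) as [c Hc]. clear Hf.
  assert (Hp : forall j k, 0 < r ^ j * r ^ k) by (intros; apply Rmult_lt_0_compat; now apply pow_lt).
  (* A single weighted coefficient is below the norm, so each coefficient series converges
     absolutely. *)
  assert (Hcm : forall m j k, Cmod (c m j k) * (r ^ j * r ^ k) <= M m).
  { intros m j k. destruct (Hc m) as [H _].
    eapply Rle_trans; [|apply (H (j + k)%nat)]. unfold dsum.
    assert (Hq : forall j k, 0 <= Cmod (c m j k) * (r ^ j * r ^ k)).
    { intros. apply Rmult_le_pos; [apply Cmod_ge_0|left; apply Hp]. }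
    eapply Rle_trans; [|apply (Rsum_term_le _ (j + k) j); [|lia]].
    - apply (Rsum_term_le (fun k => Cmod (c m j k) * (r ^ j * r ^ k)) (j + k) k); [|lia].
      intros; apply Hq.
    - intros i. apply Rsum_nonneg. intros; apply Hq. }
  assert (Hex : forall j k, ex_series (fun m => Cmod (c m j k) * (r ^ j * r ^ k))).
  { intros j k. apply ex_series_pos_le with M; [|exact HM].
    intros m. split; [|apply Hcm]. apply Rmult_le_pos; [apply Cmod_ge_0|left; apply Hp]. }
  assert (Hcs : forall j k, Cser (fun m => c m j k) (CSeries (fun m => c m j k))).
  { intros j k. apply Cser_CSeries with (fun m => Cmod (c m j k) * (r ^ j * r ^ k) * / (r ^ j * r ^ k)).
    - intros m. right. specialize (Hp j k). field. split; apply pow_nonzero; lra.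
    - apply ex_series_scal_r, Hex. }
  exists (fun j k => CSeries (fun m => c m j k)). split.
  - intros N.
    set (T := fun m => dsum (fun j k => Cmod (c m j k) * (r ^ j * r ^ k)) N).
    assert (HT : is_series T (dsum (fun j k => Series (fun m => Cmod (c m j k) * (r ^ j * r ^ k))) N)).
    { apply (is_series_dsum (fun m j k => Cmod (c m j k) * (r ^ j * r ^ k))).
      intros j k. now apply Series_correct. }
    apply Rle_trans with (Series T).
    + rewrite (is_series_unique _ _ HT). apply dsumR_le. intros j k.
      rewrite Series_scal_r. apply Rmult_le_compat_r; [left; apply Hp|].
      apply Cser_bound with (fun m => c m j k); [intros; lra| |apply Hcs].
      eapply ex_series_ext; [|apply (ex_series_scal_r (/ (r ^ j * r ^ k)) _ (Hex j k))].
      intros m. simpl. specialize (Hp j k). field. split; apply pow_nonzero; lra.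
    + apply Series_le; [|exact HM]. intros m. split; [|apply Hc].
      apply Rsum_nonneg. intros j. apply Rsum_nonneg. intros k.
      apply Rmult_le_pos; [apply Cmod_ge_0|left; apply Hp].
  - intros z w Hz Hw.
    apply (Tannery (fun N m => dsum (fun j k => c m j k * ((z - z0) ^ j * (w - w0) ^ k))%C N)
      (fun m => f m z w) _ _ M).
    + intros N m. eapply Rle_trans; [apply dsum_Cmod|].
      apply pseries_abs_le with r; auto. apply Hc.
    + exact HM.
    + intros m. apply Hc; assumption.
    + intros N. apply Cser_is_series.
      apply (is_series_dsum (fun m j k => c m j k * ((z - z0) ^ j * (w - w0) ^ k))%C).
      intros j k. apply Cser_is_series.
      rewrite (Cmult_comm (CSeries _)). eapply Cser_ext; [|apply Cser_scal, Hcs]. intros m. simpl. ring.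
    + now apply HF.
Qed.

(** Summation along shells reduces this to [ana_series]. Putting other functions in the place of the
    monomials of a power series gives products and compositions. *)
Lemma ana_dseries (M : R) (d : nat -> nat -> C) (A : nat -> nat -> R)
    (h : nat -> nat -> C -> C -> C) (F : C -> C -> C) :
  (forall N, dsum (fun j k => Cmod (d j k) * A j k) N <= M) ->
  (forall j k, ana z0 w0 r (A j k) (h j k)) ->
  (forall z w, Cmod (z - z0)%C <= r -> Cmod (w - w0)%C <= r ->
    Clim (dsum (fun j k => d j k * h j k z w)%C) (F z w)) ->
  ana z0 w0 r M F.
Proof.
  intros HM Hh HF.
  assert (Hpos : forall j k, 0 <= Cmod (d j k) * A j k).
  { intros. apply Rmult_le_pos; [apply Cmod_ge_0|apply (ana_nonneg _ _ (Hh j k))]. }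
  set (B := shell (fun j k => Cmod (d j k) * A j k)).
  assert (HB : ex_series B /\ Series B <= M).
  { apply ex_series_bounded.
    - intros [|n]; [apply Hpos|]. apply Rplus_le_le_0_compat; apply Rsum_nonneg; intros; apply Hpos.
    - intros n. unfold B. rewrite sum_shell. apply HM. }
  apply ana_le with (Series B); [apply HB|].
  assert (Ht : forall j k, ana z0 w0 r (Cmod (d j k) * A j k) (fun z w => d j k * h j k z w)%C).
  { intros. now apply ana_scal. }
  apply ana_series with (fun n z w => shell (fun j k => d j k * h j k z w)%C n).
  - intros [|n]; [apply Ht|].
    apply (ana_plus _ _ (fun z w => sum_n (fun j => d j (S n) * h j (S n) z w)%C n)).
    + apply (ana_sum_n (fun j => Cmod (d j (S n)) * A j (S n)) (fun j z w => d j (S n) * h j (S n) z w)%C).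
      intros; apply Ht.
    + apply (ana_sum_n (fun k => Cmod (d (S n) k) * A (S n) k) (fun k z w => d (S n) k * h (S n) k z w)%C).
      intros; apply Ht.
  - apply HB.
  - intros z w Hz Hw. unfold Cser. eapply Clim_ext; [|apply (HF z w Hz Hw)].
    intros N. now rewrite sum_shell.
Qed.

Lemma ana_mult_mono (M : R) (g : C -> C -> C) (p q : nat) :
  ana z0 w0 r M g ->
  ana z0 w0 r (r ^ p * r ^ q * M) (fun z w => (z - z0) ^ p * (w - w0) ^ q * g z w)%C.
Proof.
  intros [c [Hc Hg]].
  assert (Hp : 0 <= r ^ p * r ^ q) by (apply Rmult_le_pos; apply pow_le; lra).
  apply ana_dseries with c (fun j k => r ^ (p + j) * r ^ (q + k))
    (fun j k z w => (z - z0) ^ (p + j) * (w - w0) ^ (q + k))%C.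
  - intros N. eapply Rle_trans; [|apply Rmult_le_compat_l; [exact Hp|apply (Hc N)]].
    rewrite <- dsumR_scal. right. apply dsum_ext. intros j k. rewrite !pow_add.
    change (AbelianMonoid.sort R_AbelianMonoid) with R. ring.
  - intros. apply ana_mono.
  - intros z w Hz Hw. eapply Clim_ext; [|apply (Clim_scal _ _ _ (Hg z w Hz Hw))].
    intros N. simpl. rewrite <- dsumC_scal. apply dsum_ext. intros j k.
    rewrite !Cpow_add_r. change (AbelianMonoid.sort C_AbelianMonoid) with C. ring.
Qed.

(** Only [f] is expanded into monomials; [g] stays whole as a factor of each, so no Cauchy product
    of coefficients has to be formed. *)
Lemma ana_mult (M M' : R) (f g : C -> C -> C) :
  ana z0 w0 r M f -> ana z0 w0 r M' g ->
  ana z0 w0 r (M * M') (fun z w => f z w * g z w)%C.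
Proof.
  intros [c [Hc Hf]] Hg.
  apply ana_dseries with c (fun j k => r ^ j * r ^ k * M')
    (fun j k z w => (z - z0) ^ j * (w - w0) ^ k * g z w)%C.
  - intros N. rewrite Rmult_comm.
    eapply Rle_trans; [|apply Rmult_le_compat_l; [apply (ana_nonneg _ _ Hg)|apply (Hc N)]].
    rewrite <- dsumR_scal. right. apply dsum_ext. intros j k.
    change (AbelianMonoid.sort R_AbelianMonoid) with R. ring.
  - intros. now apply ana_mult_mono.
  - intros z w Hz Hw. rewrite (Cmult_comm (f z w)).
    eapply Clim_ext; [|apply (Clim_scal (g z w) _ _ (Hf z w Hz Hw))].
    intros N. simpl. rewrite <- dsumC_scal. apply dsum_ext. intros j k.
    change (AbelianMonoid.sort C_AbelianMonoid) with C. ring.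
Qed.

Lemma ana_pow (M : R) (f : C -> C -> C) (n : nat) :
  ana z0 w0 r M f -> ana z0 w0 r (M ^ n) (fun z w => f z w ^ n)%C.
Proof.
  intros H. induction n as [|n IH].
  - simpl. eapply ana_le; [|apply (ana_const (RtoC 1))]. rewrite Cmod_1. lra.
  - simpl. now apply (ana_mult M (M ^ n) f (fun z w => f z w ^ n)%C).
Qed.

(** Powers of the inner differences have norm at most [rho ^ j] and [rho ^ k], so the substituted
    series is dominated by the weighted norm of [f] itself. *)
Lemma ana_comp (z1 w1 : C) (rho M : R) (f a b : C -> C -> C) :
  ana z1 w1 rho M f ->
  ana z0 w0 r rho (fun z w => a z w - z1)%C ->
  ana z0 w0 r rho (fun z w => b z w - w1)%C ->
  ana z0 w0 r M (fun z w => f (a z w) (b z w)).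
Proof.
  intros [c [Hc Hf]] Ha Hb.
  apply ana_dseries with c (fun j k => rho ^ j * rho ^ k)
    (fun j k z w => (a z w - z1) ^ j * (b z w - w1) ^ k)%C.
  - exact Hc.
  - intros. apply (ana_mult _ _ (fun z w => (a z w - z1) ^ j)%C (fun z w => (b z w - w1) ^ k)%C).
    + now apply (ana_pow rho (fun z w => a z w - z1)%C).
    + now apply (ana_pow rho (fun z w => b z w - w1)%C).
  - intros z w Hz Hw. apply Hf.
    + exact (ana_bound _ _ z w Ha Hz Hw).
    + exact (ana_bound _ _ z w Hb Hz Hw).
Qed.

End Algebra.

(** * The exponential and the inverse in the algebra *)

Lemma Cexp_plus (a b : C) : Cexp (a + b)%C = (Cexp a * Cexp b)%C.
Proof.
  destruct a as [a1 a2], b as [b1 b2]. unfold Cexp, Cplus, Cmult; simpl.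
  rewrite exp_plus, cos_plus, sin_plus. f_equal; ring.
Qed.

Lemma Cexp_0 : Cexp 0%C = RtoC 1.
Proof. unfold Cexp; simpl. rewrite exp_0, cos_0, sin_0. apply f_equal2; ring. Qed.

Lemma Cexp_R (x : R) : Cexp (RtoC x) = RtoC (exp x).
Proof. unfold Cexp, RtoC; simpl. rewrite cos_0, sin_0. apply f_equal2; ring. Qed.

Lemma Cmod_Cexp (a : C) : Cmod (Cexp a) = exp (Re a).
Proof.
  unfold Cmod, Cexp; simpl.
  replace (exp (Re a) * cos (Im a) * (exp (Re a) * cos (Im a) * 1)
     + exp (Re a) * sin (Im a) * (exp (Re a) * sin (Im a) * 1))
    with (Rsqr (exp (Re a)) * (Rsqr (sin (Im a)) + Rsqr (cos (Im a)))) by (unfold Rsqr; ring).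
  rewrite sin2_cos2, Rmult_1_r. apply sqrt_Rsqr. left. apply exp_pos.
Qed.

Lemma Cmod_le_sum (x : C) : Cmod x <= Rabs (Re x) + Rabs (Im x).
Proof.
  replace x with (RtoC (Re x) + RtoC (Im x) * Ci)%C at 1.
  - eapply Rle_trans; [apply Cmod_triangle|].
    rewrite Cmod_mult, !Cmod_R, Cmod_Ci. lra.
  - destruct x. unfold Cplus, Cmult, RtoC, Ci; simpl. apply f_equal2; ring.
Qed.

Definition exp_coef (k : nat) : R := / INR (fact k).

Lemma exp_coef_pos (k : nat) : 0 < exp_coef k.
Proof. apply Rinv_0_lt_compat, lt_0_INR, lt_O_fact. Qed.

Lemma is_series_exp (x : R) : is_series (fun k => exp_coef k * x ^ k) (exp x).
Proof.
  eapply is_series_ext; [|apply (is_exp_Reals x)].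
  intros n. unfold scal; simpl. unfold mult; simpl.
  rewrite pow_n_pow. unfold exp_coef. ring.
Qed.

Lemma Derive_n_Re_Cexp (z : C) (n : nat) :
  forall c t : R, forall d : R,
  Derive_n (fun t => Re ((c, d) * Cexp (RtoC t * z))%C) n t
  = Re ((c, d) * z ^ n * Cexp (RtoC t * z))%C
  /\ ex_derive_n (fun t => Re ((c, d) * Cexp (RtoC t * z))%C) n t.
Proof.
  intros c t d. revert t.
  assert (Hd : forall (e : C) (t : R), is_derive (fun t => Re (e * Cexp (RtoC t * z))%C) t
    (Re (e * z * Cexp (RtoC t * z))%C)).
  { intros [e1 e2] t. destruct z as [z1 z2].
    assert (E : forall t, Cexp (RtoC t * (z1, z2))%C
      = (exp (t * z1) * cos (t * z2), exp (t * z1) * sin (t * z2))).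
    { intros u. unfold Cexp; simpl.
      now rewrite !Rmult_0_l, Rminus_0_r, Rplus_0_r. }
    apply (is_derive_ext (fun t => e1 * (exp (t * z1) * cos (t * z2))
      - e2 * (exp (t * z1) * sin (t * z2)))).
    - intros u. now rewrite E.
    - rewrite E. simpl. auto_derive; [exact I|ring]. }
  induction n as [|n IH]; intros t.
  - simpl Derive_n. simpl ex_derive_n. split; [|exact I].
    replace ((c, d) * z ^ 0)%C with (c, d) by (simpl; rewrite Cmult_1_r; reflexivity). reflexivity.
  - assert (H : is_derive (Derive_n (fun t => Re ((c, d) * Cexp (RtoC t * z))%C) n) t
      (Re ((c, d) * z ^ S n * Cexp (RtoC t * z))%C)).
    { apply (is_derive_ext (fun t => Re ((c, d) * z ^ n * Cexp (RtoC t * z))%C)).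
      - intros u. symmetry. apply IH.
      - replace ((c, d) * z ^ S n)%C with ((c, d) * z ^ n * z)%C by (simpl; ring).
        apply Hd. }
    split; [exact (is_derive_unique _ _ _ H)|]. eexists. exact H.
Qed.

(** Taylor-Lagrange is a real theorem, so it is applied on [[0, 1]] to the real part of a constant
    times exp (t z). Leaving the constant free gives both components of the error. *)
Lemma exp_remainder (z : C) (n : nat) (c d : R) :
  Rabs (Re ((c, d) * (sum_n (fun k => RtoC (exp_coef k) * z ^ k) n - Cexp z))%C)
  <= Cmod (c, d) * (exp_coef (S n) * Cmod z ^ S n * exp (Cmod z)).
Proof.
  set (g := fun t => Re ((c, d) * Cexp (RtoC t * z))%C).
  assert (H1 : forall k t, Derive_n g k t = Re ((c, d) * z ^ k * Cexp (RtoC t * z))%C).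
  { intros k t. apply Derive_n_Re_Cexp. }
  destruct (Taylor_Lagrange g n 0 1) as [x [Hx E]]; [lra|intros t _ k _; apply Derive_n_Re_Cexp|].
  assert (E0 : sum_f_R0 (fun m => (1 - 0) ^ m / INR (fact m) * Derive_n g m 0) n
    = Re ((c, d) * sum_n (fun k => RtoC (exp_coef k) * z ^ k) n)%C).
  { rewrite <- sum_n_Reals, <- Csum_mult_l, Re_sum_n. apply sum_n_ext. intros k.
    rewrite H1, Rminus_0_r, pow1.
    replace (RtoC 0 * z)%C with (RtoC 0) by ring. rewrite Cexp_0.
    replace ((c, d) * (RtoC (exp_coef k) * z ^ k))%C
      with (RtoC (exp_coef k) * ((c, d) * z ^ k * RtoC 1))%C by ring.
    unfold Rdiv. rewrite Rmult_1_l. fold (exp_coef k).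
    generalize ((c, d) * z ^ k * RtoC 1)%C. intros [y1 y2]. simpl. ring. }
  rewrite E0, H1, Rminus_0_r, pow1 in E. unfold g in E.
  replace (RtoC 1 * z)%C with z in E by ring.
  replace (Re ((c, d) * (sum_n (fun k => RtoC (exp_coef k) * z ^ k) n - Cexp z))%C)
    with (- (exp_coef (S n) * Re ((c, d) * z ^ S n * Cexp (RtoC x * z))%C)).
  - rewrite Rabs_Ropp, Rabs_mult, (Rabs_pos_eq (exp_coef (S n))) by (left; apply exp_coef_pos).
    replace (Cmod (c, d) * (exp_coef (S n) * Cmod z ^ S n * exp (Cmod z)))
      with (exp_coef (S n) * (Cmod (c, d) * Cmod z ^ S n * exp (Cmod z))) by ring.
    apply Rmult_le_compat_l; [left; apply exp_coef_pos|].
    eapply Rle_trans; [apply re_le_Cmod|].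
    rewrite !Cmod_mult, Cmod_pow, Cmod_Cexp.
    apply Rmult_le_compat_l.
    + apply Rmult_le_pos; [apply Cmod_ge_0|apply pow_le, Cmod_ge_0].
    + assert (Hre : Re (RtoC x * z)%C = x * Re z) by (destruct z; simpl; ring).
      rewrite Hre. pose proof (re_le_Cmod z) as Hz. apply Rabs_le_between in Hz.
      pose proof (Cmod_ge_0 z).
      destruct (Rle_lt_or_eq_dec (x * Re z) (Cmod z)) as [Hlt|Heq]; [nra| |].
      * left. now apply exp_increasing.
      * rewrite Heq. lra.
  - replace ((c, d) * (sum_n (fun k => RtoC (exp_coef k) * z ^ k) n - Cexp z))%C
      with ((c, d) * sum_n (fun k => RtoC (exp_coef k) * z ^ k) n - (c, d) * Cexp z)%C by ring.
    unfold Rdiv in E. rewrite Rmult_1_l in E. fold (exp_coef (S n)) in E.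
    change (Re ((c, d) * sum_n (fun k => RtoC (exp_coef k) * z ^ k)%C n - (c, d) * Cexp z)%C)
      with (Re ((c, d) * sum_n (fun k => RtoC (exp_coef k) * z ^ k)%C n)%C
        - Re ((c, d) * Cexp z)%C).
    lra.
Qed.

Lemma Cser_exp (z : C) : Cser (fun k => RtoC (exp_coef k) * z ^ k)%C (Cexp z).
Proof.
  set (e := fun n => exp_coef (S n) * Cmod z ^ S n * exp (Cmod z)).
  apply Clim_squeeze with (fun n => 2 * e n).
  - intros n. eapply Rle_trans; [apply Cmod_le_sum|].
    (* The constants 1 and -i extract the real and the imaginary part. *)
    pose proof (exp_remainder z n 1 0) as H1. pose proof (exp_remainder z n 0 (-1)) as H2.
    replace (Cmod (1, 0)) with 1 in H1 by (symmetry; apply Cmod_1).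
    replace (Cmod (0, -1)) with 1 in H2.
    + unfold e. set (D := (sum_n _ n - Cexp z)%C) in *.
      replace (Re ((1, 0) * D)%C) with (Re D) in H1 by (destruct D; simpl; ring).
      replace (Re ((0, -1) * D)%C) with (Im D) in H2 by (destruct D; simpl; ring).
      lra.
    + unfold Cmod; simpl. replace (0 * (0 * 1) + -1 * (-1 * 1)) with 1 by ring. now rewrite sqrt_1.
  - replace 0 with (2 * 0) by ring. apply (is_lim_seq_scal_l _ _ 0).
    unfold e. replace 0 with (0 * exp (Cmod z)) by ring. apply (is_lim_seq_scal_r _ _ 0).
    apply (is_lim_seq_incr_1 (fun n => exp_coef n * Cmod z ^ n)).
    apply ex_series_lim_0. eexists. apply is_series_exp.
Qed.

Lemma Cser_shift_inv (a : nat -> C) (l : C) :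
  Cser a l -> Cser (fun n => a (S n)) (l - a 0%nat)%C.
Proof.
  intros H.
  assert (H' : Clim (fun n => sum_n a (S n)) l) by now apply is_lim_seq_incr_1 in H.
  eapply Clim_ext; [|apply (Clim_minus _ _ _ _ H' (Clim_const (a 0%nat)))].
  intros n. simpl. induction n as [|n IH].
  - rewrite Csum_Sn, !Csum_0. change (AbelianMonoid.sort C_AbelianMonoid) with C. ring.
  - rewrite (Csum_Sn a (S n)), (Csum_Sn (fun n => a (S n)) n), <- IH.
    change (AbelianMonoid.sort C_AbelianMonoid) with C. ring.
Qed.

Lemma is_series_shift_inv (a : nat -> R) (l : R) :
  is_series a l -> is_series (fun n => a (S n)) (l - a 0%nat).
Proof.
  intros H. apply is_series_incr_1. unfold plus; simpl.
  now replace (l - a 0%nat + a 0%nat) with l by ring.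
Qed.

Lemma exp_m1_le (M : R) : 0 <= M -> exp M - 1 <= M * exp M.
Proof.
  intros H. pose proof (exp_ineq1_le (- M)) as H1. pose proof (exp_pos M).
  assert (E : exp (- M) * exp M = 1) by (rewrite <- exp_plus, Rplus_opp_l; apply exp_0).
  nra.
Qed.

Lemma exp_m2_le (M : R) : 0 <= M -> exp M - 1 - M <= M * M * exp M.
Proof.
  intros H. pose proof (exp_m1_le M H). nra.
Qed.

Lemma exp_le (x y : R) : x <= y -> exp x <= exp y.
Proof. intros [H|H]; [left; now apply exp_increasing|subst; lra]. Qed.

Lemma is_series_1_exp (M : R) : is_series (fun k => exp_coef (S k) * M ^ S k) (exp M - 1).
Proof.
  pose proof (is_series_shift_inv _ _ (is_series_exp M)) as H. simpl in H.
  replace (exp_coef 0 * 1) with 1 in H by (unfold exp_coef; simpl; field).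
  exact H.
Qed.

Lemma is_series_2_exp (M : R) :
  is_series (fun k => exp_coef (S (S k)) * M ^ S (S k)) (exp M - 1 - M).
Proof.
  pose proof (is_series_shift_inv _ _ (is_series_1_exp M)) as H. simpl in H.
  replace (exp_coef 1 * (M * 1)) with M in H by (unfold exp_coef; simpl; field).
  exact H.
Qed.

Lemma Cser_geom (q : C) : Cmod q < 1 -> Cser (fun n => q ^ n)%C (/ (1 - q))%C.
Proof.
  intros Hq.
  assert (Hn : (1 - q)%C <> RtoC 0).
  { intros E. assert (q = RtoC 1) as ->; [|rewrite Cmod_1 in Hq; lra].
    replace q with (1 - (1 - q))%C by ring. rewrite E. ring. }
  assert (E : forall n, sum_n (fun n => q ^ n)%C n = ((1 - q ^ S n) * / (1 - q))%C :> C).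
  { induction n as [|n IH].
    - rewrite Csum_0. simpl. field. exact Hn.
    - rewrite Csum_Sn, IH. simpl. field. exact Hn. }
  apply Clim_squeeze with (fun n => Cmod q ^ n * (Cmod q * Cmod (/ (1 - q))%C)).
  - intros n. rewrite E.
    replace ((1 - q ^ S n) * / (1 - q) - / (1 - q))%C with (- (q ^ S n * / (1 - q)))%C by ring.
    rewrite Cmod_opp, Cmod_mult, Cmod_pow. simpl. right. ring.
  - replace 0 with (0 * (Cmod q * Cmod (/ (1 - q))%C)) by ring.
    apply (is_lim_seq_scal_r _ _ 0). apply is_lim_seq_geom.
    rewrite Rabs_pos_eq by apply Cmod_ge_0. exact Hq.
Qed.

Lemma Cmod_exp_coef (k : nat) : Cmod (RtoC (exp_coef k)) = exp_coef k.
Proof. rewrite Cmod_R. apply Rabs_pos_eq. left. apply exp_coef_pos. Qed.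

Section ExpInv.

Variables (z0 w0 : C) (r : R).
Hypothesis Hr : 0 < r.

Lemma ana_exp_term (M : R) (f : C -> C -> C) (k : nat) :
  ana z0 w0 r M f ->
  ana z0 w0 r (exp_coef k * M ^ k) (fun z w => RtoC (exp_coef k) * f z w ^ k)%C.
Proof.
  intros H. rewrite <- (Cmod_exp_coef k) at 1.
  apply (ana_scal z0 w0 r (RtoC (exp_coef k)) (M ^ k) (fun z w => f z w ^ k)%C).
  now apply ana_pow.
Qed.

Lemma ana_exp (M : R) (f : C -> C -> C) :
  ana z0 w0 r M f -> ana z0 w0 r (exp M) (fun z w => Cexp (f z w)).
Proof.
  intros H. rewrite <- (is_series_unique _ _ (is_series_exp M)).
  apply ana_series with (fun k z w => RtoC (exp_coef k) * f z w ^ k)%C; [exact Hr| | |].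
  - intros k. now apply ana_exp_term.
  - eexists. apply is_series_exp.
  - intros z w _ _. apply Cser_exp.
Qed.

(** The constant term is removed from the exponential series before norms are taken; the bound is
    therefore of first order in [M]. *)
Lemma ana_exp_m1 (M : R) (f : C -> C -> C) :
  ana z0 w0 r M f -> ana z0 w0 r (M * exp M) (fun z w => Cexp (f z w) - 1)%C.
Proof.
  intros H. apply ana_le with (exp M - 1).
  { apply exp_m1_le. now apply (ana_nonneg z0 w0 r Hr M f). }
  rewrite <- (is_series_unique _ _ (is_series_1_exp M)).
  apply ana_series with (fun k z w => RtoC (exp_coef (S k)) * f z w ^ S k)%C; [exact Hr| | |].
  - intros k. now apply ana_exp_term.
  - eexists. apply is_series_1_exp.
  - intros z w _ _. pose proof (Cser_shift_inv _ _ (Cser_exp (f z w))) as E.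
    replace (Cexp (f z w) - 1)%C with (Cexp (f z w) - RtoC (exp_coef 0) * f z w ^ 0)%C; [exact E|].
    unfold exp_coef; simpl. rewrite Rinv_1. ring.
Qed.

(** Removing two terms of the series makes the bound quadratic in [M]; this is the source of all
    second-order gains below. *)
Lemma ana_exp_m2 (M : R) (f : C -> C -> C) :
  ana z0 w0 r M f ->
  ana z0 w0 r (M * M * exp M) (fun z w => Cexp (f z w) - 1 - f z w)%C.
Proof.
  intros H. apply ana_le with (exp M - 1 - M).
  { apply exp_m2_le. now apply (ana_nonneg z0 w0 r Hr M f). }
  rewrite <- (is_series_unique _ _ (is_series_2_exp M)).
  apply ana_series with (fun k z w => RtoC (exp_coef (S (S k))) * f z w ^ S (S k))%C; [exact Hr| | |].
  - intros k. now apply ana_exp_term.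
  - eexists. apply is_series_2_exp.
  - intros z w _ _.
    pose proof (Cser_shift_inv _ _ (Cser_shift_inv _ _ (Cser_exp (f z w)))) as E.
    replace (Cexp (f z w) - 1 - f z w)%C
      with (Cexp (f z w) - RtoC (exp_coef 0) * f z w ^ 0 - RtoC (exp_coef 1) * f z w ^ 1)%C;
      [exact E|].
    unfold exp_coef; simpl. rewrite Rinv_1. ring.
Qed.

(** The Neumann series of 1/f around the constant [c]: 1/c times the geometric series in -(f - c)/c,
    whose norm is at most rho/|c| < 1. *)
Lemma ana_inv (c : C) (rho : R) (f : C -> C -> C) :
  ana z0 w0 r rho (fun z w => f z w - c)%C -> rho < Cmod c ->
  ana z0 w0 r (/ (Cmod c - rho)) (fun z w => / f z w)%C.
Proof.
  intros H Hc.
  pose proof (ana_nonneg z0 w0 r Hr _ _ H) as H0.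
  assert (Hc0 : c <> RtoC 0) by (apply Cmod_gt_0; lra).
  set (q := rho / Cmod c).
  assert (Hq : 0 <= q < 1).
  { unfold q. split; [apply Rdiv_le_0_compat; lra|]. apply Rlt_div_l; lra. }
  assert (Hs : is_series (fun k => / Cmod c * q ^ k) (/ (Cmod c - rho))).
  { replace (/ (Cmod c - rho)) with (/ Cmod c * / (1 - q)).
    - apply (is_series_scal_l (V := R_NormedModule)). apply is_series_geom.
      rewrite Rabs_pos_eq; lra.
    - unfold q. field. lra. }
  rewrite <- (is_series_unique _ _ Hs).
  apply ana_series with (fun k z w => / c * (- / c * (f z w - c)) ^ k)%C; [exact Hr| | |].
  - intros k. rewrite <- (Cmod_inv c Hc0).
    apply (ana_scal z0 w0 r (/ c) (q ^ k) (fun z w => (- / c * (f z w - c)) ^ k)%C).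
    apply (ana_pow z0 w0 r Hr q (fun z w => - / c * (f z w - c))%C).
    apply ana_le with (Cmod (- / c)%C * rho).
    + rewrite Cmod_opp, Cmod_inv by exact Hc0. unfold q. right. field. lra.
    + apply (ana_scal z0 w0 r (- / c)%C rho (fun z w => f z w - c)%C). exact H.
  - eexists. exact Hs.
  - intros z w Hz Hw.
    pose proof (ana_bound z0 w0 r _ _ z w H Hz Hw) as Hb. simpl in Hb.
    assert (Hf : f z w <> RtoC 0).
    { intros E. rewrite E in Hb. replace (0 - c)%C with (- c)%C in Hb by ring.
      rewrite Cmod_opp in Hb. lra. }
    replace (/ f z w)%C with (/ c * / (1 - (- / c * (f z w - c))))%C.
    + apply Cser_scal. apply Cser_geom.
      rewrite Cmod_mult, Cmod_opp, Cmod_inv by exact Hc0.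
      apply (Rmult_lt_reg_l (Cmod c)); [lra|]. rewrite <- Rmult_assoc, Rinv_r by lra. lra.
    + assert (E : (1 - (- / c * (f z w - c)))%C = (/ c * f z w)%C) by (field; exact Hc0).
      rewrite E. field. split; assumption.
Qed.

(** Splitting off the value at [c] lets the real part of [c], and not its modulus, enter the
    exponent of the bound. All convergence questions below depend on this. *)
Lemma ana_npow (m : nat) (c : C) (rho : R) (f : C -> C -> C) :
  (1 <= m)%nat -> ana z0 w0 r rho (fun z w => f z w - c)%C ->
  ana z0 w0 r (Rpower (INR m) (Re c + rho)) (fun z w => npow m (f z w)).
Proof.
  intros Hm H.
  assert (Hl : 0 <= ln (INR m)).
  { rewrite <- ln_1. destruct (Nat.eq_dec m 1) as [->|Hne]; [simpl; lra|].
    left. apply ln_increasing; [lra|]. apply (lt_INR 1). lia. }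
  apply ana_ext with (fun z w => npow m c * Cexp (RtoC (ln (INR m)) * (f z w - c)))%C.
  - intros z w _ _. unfold npow. rewrite <- Cexp_plus. f_equal. ring.
  - apply ana_le with (Cmod (npow m c) * exp (Cmod (RtoC (ln (INR m))) * rho)).
    + unfold npow, Rpower. rewrite Cmod_Cexp, Cmod_R, Rabs_pos_eq, <- exp_plus by exact Hl.
      right. f_equal. destruct c; simpl; ring.
    + apply (ana_scal z0 w0 r (npow m c) _ (fun z w => Cexp (RtoC (ln (INR m)) * (f z w - c)))).
      apply ana_exp. now apply (ana_scal z0 w0 r _ rho (fun z w => f z w - c)%C).
Qed.

End ExpInv.

(** * Identity theorem *)

Definition near (a b : C) (eps : R) (P : C -> C -> Prop) : Prop :=
  forall z w : C, Cmod (z - a)%C < eps -> Cmod (w - b)%C < eps -> P z w.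

Definition locana (f : C -> C -> C) (z0 w0 : C) : Prop :=
  exists r M, 0 < r /\ ana z0 w0 r M f.

Lemma Cmod_sub_self (a : C) : Cmod (a - a)%C = 0.
Proof. replace (a - a)%C with (RtoC 0) by ring. apply Cmod_0. Qed.

Lemma Cmod_sub_trans (a b c : C) : Cmod (a - c)%C <= Cmod (a - b)%C + Cmod (b - c)%C.
Proof. replace (a - c)%C with ((a - b) + (b - c))%C by ring. apply Cmod_triangle. Qed.

Lemma locally_pair (z0 w0 : C) (P : C * C -> Prop) :
  locally (z0, w0) P <-> exists eps, 0 < eps /\ near z0 w0 eps (fun z w => P (z, w)).
Proof.
  split.
  - intros [eps H]. exists eps. split; [apply cond_pos|]. intros z w Hz Hw. apply H.
    split; simpl; apply C_NormedModule_mixin_compat1; assumption.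
  - intros [eps [He H]].
    assert (H2 : 0 < sqrt 2) by (apply sqrt_lt_R0; lra).
    assert (Hd : 0 < eps / sqrt 2) by (apply Rdiv_lt_0_compat; lra).
    exists (mkposreal _ Hd). intros [z w] [Hz Hw]. simpl in Hz, Hw.
    apply (C_NormedModule_mixin_compat2 z0 z (mkposreal _ Hd)) in Hz.
    apply (C_NormedModule_mixin_compat2 w0 w (mkposreal _ Hd)) in Hw. simpl in Hz, Hw.
    replace (sqrt 2 * (eps / sqrt 2)) with eps in Hz, Hw by (field; lra).
    apply H; assumption.
Qed.

Lemma ana_recenter (z0 w0 z1 w1 : C) (r rho M : R) (f : C -> C -> C) :
  0 < rho -> Cmod (z1 - z0)%C + rho <= r -> Cmod (w1 - w0)%C + rho <= r ->
  ana z0 w0 r M f -> ana z1 w1 rho M f.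
Proof.
  intros Hrho Hz Hw H.
  apply (ana_comp z1 w1 rho Hrho z0 w0 r M f (fun z _ => z) (fun _ w => w) H).
  - apply ana_le with (rho + Cmod (z1 - z0)%C); [lra|].
    apply ana_ext with (fun z _ => (z - z1) + (z1 - z0))%C; [intros; ring|].
    apply (ana_plus z1 w1 rho Hrho rho _ (fun z _ => z - z1)%C (fun _ _ => z1 - z0)%C).
    + now apply ana_fst.
    + now apply ana_const.
  - apply ana_le with (rho + Cmod (w1 - w0)%C); [lra|].
    apply ana_ext with (fun _ w => (w - w1) + (w1 - w0))%C; [intros; ring|].
    apply (ana_plus z1 w1 rho Hrho rho _ (fun _ w => w - w1)%C (fun _ _ => w1 - w0)%C).
    + now apply ana_snd.
    + now apply ana_const.
Qed.

Lemma ana_shrink (z0 w0 : C) (r rho M : R) (f : C -> C -> C) :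
  0 < rho <= r -> ana z0 w0 r M f -> ana z0 w0 rho M f.
Proof. intros H. apply ana_recenter; rewrite ?Cmod_sub_self; lra. Qed.

(** On the polydisc shrunk by [th <= 1] every nonconstant monomial is at most [th] times its weight
    at radius [r], so [f] varies by at most [th * M]. *)
Lemma ana_continuous (z0 w0 : C) (r M : R) (f : C -> C -> C) (eps : R) :
  0 < r -> ana z0 w0 r M f -> 0 < eps ->
  exists d, 0 < d /\ near z0 w0 d (fun z w => Cmod (f z w - f z0 w0)%C < eps).
Proof.
  intros Hr Ha He.
  pose proof (ana_nonneg z0 w0 r Hr M f Ha) as HM.
  assert (Hlip : forall (z w : C) (th : R), 0 <= th <= 1 ->
    Cmod (z - z0)%C <= th * r -> Cmod (w - w0)%C <= th * r ->
    Cmod (f z w - f z0 w0)%C <= th * M).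
  { intros z w th Hth Hz Hw. destruct Ha as [c [Hc Hf]].
    assert (Hz' : Cmod (z - z0)%C <= r) by nra.
    assert (Hw' : Cmod (w - w0)%C <= r) by nra.
    assert (Hs : forall a : C, Cmod (a - a)%C <= r) by (intros; rewrite Cmod_sub_self; lra).
    assert (Hl := Clim_minus _ _ _ _ (Hf z w Hz' Hw') (Hf z0 w0 (Hs z0) (Hs w0))).
    eapply Clim_bound; [|exact Hl]. intros N. simpl.
    replace (dsum (fun j k => c j k * ((z - z0) ^ j * (w - w0) ^ k))%C N
        - dsum (fun j k => c j k * ((z0 - z0) ^ j * (w0 - w0) ^ k))%C N)%C
      with (dsum (fun j k => c j k * ((z - z0) ^ j * (w - w0) ^ k)
        - c j k * ((z0 - z0) ^ j * (w0 - w0) ^ k))%C N).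
    2:{ unfold dsum. rewrite <- Csum_minus. apply sum_n_ext. intros j. apply Csum_minus. }
    eapply Rle_trans; [apply dsum_Cmod|].
    eapply Rle_trans; [|apply Rmult_le_compat_l; [apply Hth|apply (Hc N)]].
    rewrite <- dsumR_scal. apply dsumR_le. intros j k.
    replace (c j k * ((z - z0) ^ j * (w - w0) ^ k) - c j k * ((z0 - z0) ^ j * (w0 - w0) ^ k))%C
      with (c j k * ((z - z0) ^ j * (w - w0) ^ k - (z0 - z0) ^ j * (w0 - w0) ^ k))%C by ring.
    rewrite Cmod_mult, <- Rmult_assoc, (Rmult_comm th), Rmult_assoc.
    apply Rmult_le_compat_l; [apply Cmod_ge_0|].
    replace (z0 - z0)%C with (RtoC 0) by ring. replace (w0 - w0)%C with (RtoC 0) by ring.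
    assert (Hpow : forall i, 0 <= r ^ i) by (intros; apply pow_le; lra).
    assert (Hle : forall i, th ^ S i <= th).
    { intros i. simpl. assert (th ^ i <= 1) by (rewrite <- (pow1 i); now apply pow_incr).
      assert (0 <= th ^ i) by (now apply pow_le). nra. }
    assert (Hb : forall i l, (1 <= i + l)%nat ->
      Cmod ((z - z0) ^ i * (w - w0) ^ l)%C <= th * (r ^ i * r ^ l)).
    { intros i l Hil. eapply Rle_trans; [apply (mono_le _ _ (th * r)); assumption|].
      rewrite !Rpow_mult_distr.
      replace (th ^ i * r ^ i * (th ^ l * r ^ l)) with (th ^ (i + l) * (r ^ i * r ^ l))
        by (rewrite pow_add; ring).
      apply Rmult_le_compat_r; [now apply Rmult_le_pos|].
      replace (i + l)%nat with (S (i + l - 1)) by lia. apply Hle. }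
    destruct j as [|j]; [destruct k as [|k]|].
    - simpl. replace (1 * 1 - 1 * 1)%C with (RtoC 0) by ring. rewrite Cmod_0. lra.
    - rewrite (Cpow_S 0 k). replace (0 ^ 0 * (0 * 0 ^ k))%C with (RtoC 0) by ring.
      unfold Cminus. rewrite Copp_0, Cplus_0_r. apply Hb. lia.
    - rewrite (Cpow_S 0 j). replace (0 * 0 ^ j * 0 ^ k)%C with (RtoC 0) by ring.
      unfold Cminus. rewrite Copp_0, Cplus_0_r. apply Hb. lia. }
  set (th := Rmin 1 (eps / (2 * (M + 1)))).
  assert (Hq : 0 < eps / (2 * (M + 1))) by (apply Rdiv_lt_0_compat; lra).
  assert (Ht : 0 < th <= 1).
  { unfold th. split; [apply Rmin_pos; lra|apply Rmin_l]. }
  exists (th * r). split; [nra|]. intros z w Hz Hw.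
  eapply Rle_lt_trans; [apply (Hlip z w th); lra|].
  assert (Ht2 : th <= eps / (2 * (M + 1))) by apply Rmin_r.
  apply Rle_lt_trans with (eps / (2 * (M + 1)) * (M + 1)); [nra|].
  replace (eps / (2 * (M + 1)) * (M + 1)) with (eps / 2) by (field; lra). lra.
Qed.

Lemma ana_nonzero (z0 w0 : C) (r M : R) (f : C -> C -> C) :
  0 < r -> ana z0 w0 r M f -> f z0 w0 <> RtoC 0 ->
  exists d, 0 < d /\ near z0 w0 d (fun z w => f z w <> RtoC 0).
Proof.
  intros Hr Ha Hf.
  destruct (ana_continuous z0 w0 r M f (Cmod (f z0 w0)) Hr Ha) as [d [Hd H]].
  { apply Cmod_gt_0. exact Hf. }
  exists d. split; [exact Hd|]. intros z w Hz Hw E. specialize (H z w Hz Hw). simpl in H.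
  rewrite E in H. replace (0 - f z0 w0)%C with (- f z0 w0)%C in H by ring.
  rewrite Cmod_opp in H. lra.
Qed.

(** Convergence at 1 gives a positive radius of convergence; uniqueness of the expansion near 0
    kills all coefficients, hence also the sum at the end point 1. *)
Lemma real_power_series_zero (a : nat -> R) (h : R -> R) (eps : R) :
  0 < eps -> (forall t, Rabs t <= 1 -> is_series (fun j => a j * t ^ j) (h t)) ->
  (forall t, Rabs t < eps -> h t = 0) -> h 1 = 0.
Proof.
  intros He Hs Hz.
  assert (Hp : forall t, Rabs t <= 1 -> is_pseries a t (h t)).
  { intros t Ht. eapply is_series_ext; [|apply (Hs t Ht)].
    intros n. rewrite Rmult_comm. apply (f_equal (fun y => a n * y)). symmetry. apply pow_n_pow. }
  assert (Hcv : Rbar_lt 0 (CV_radius a)).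
  { apply Rbar_lt_le_trans with (Finite 1); [simpl; lra|].
    apply CV_radius_bounded.
    assert (H1 : ex_series (fun n => a n * 1 ^ n)) by (eexists; apply Hs; rewrite Rabs_R1; lra).
    apply ex_series_lim_0 in H1.
    apply is_lim_seq_abs in H1. simpl in H1. rewrite Rabs_R0 in H1.
    destruct (filterlim_bounded (V := R_NormedModule) (fun n => Rabs (a n * 1 ^ n))) as [M HM].
    { exists 0. exact H1. }
    exists M. intros n. specialize (HM n). unfold norm in HM; simpl in HM. unfold abs in HM; simpl in HM.
    now rewrite Rabs_Rabsolu in HM. }
  assert (Ha : forall n, a n = 0).
  { intros n. apply (PSeries_ext_recip a (fun _ => 0) n Hcv).
    - rewrite CV_radius_const_0. exact I.
    - assert (Hm : 0 < Rmin eps 1) by (apply Rmin_pos; lra).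
      exists (mkposreal _ Hm). intros t Ht.
      assert (Ht' : Rabs t < Rmin eps 1).
      { unfold ball in Ht; simpl in Ht. unfold AbsRing_ball, abs, minus, plus, opp in Ht; simpl in Ht.
        now rewrite Ropp_0, Rplus_0_r in Ht. }
      rewrite PSeries_const_0.
      rewrite (is_pseries_unique _ _ _ (Hp t ltac:(pose proof (Rmin_r eps 1); lra))).
      apply Hz. pose proof (Rmin_l eps 1). lra. }
  specialize (Hs 1 ltac:(rewrite Rabs_R1; lra)).
  rewrite <- (is_series_unique _ _ Hs).
  rewrite (Series_ext _ (fun n => 0 * 1)) by (intros n; rewrite Ha; ring).
  rewrite Series_scal_l. ring.
Qed.

(* Restricting to the real segment from the centre reduces to real power series. *)
Lemma ana_zero_near_center (z0 w0 : C) (r M eps : R) (f : C -> C -> C) (z w : C) :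
  0 < r -> 0 < eps -> ana z0 w0 r M f ->
  near z0 w0 eps (fun z w => f z w = RtoC 0) ->
  Cmod (z - z0)%C <= r -> Cmod (w - w0)%C <= r -> f z w = RtoC 0.
Proof.
  intros Hr He Ha Hn Hz Hw.
  assert (H1 : 0 < 1) by lra.
  assert (Hlin : forall u : C, Cmod u <= r ->
    ana 0 0 1 r (fun l _ : C => u * (l - 0))%C).
  { intros u Hu. apply ana_le with (Cmod u * 1); [lra|].
    apply (ana_scal 0 0 1 u 1 (fun l _ : C => l - 0)%C). now apply ana_fst. }
  assert (Hh : ana 0 0 1 M (fun l _ => f (z0 + l * (z - z0)) (w0 + l * (w - w0)))%C).
  { apply (ana_comp 0 0 1 H1 z0 w0 r M f (fun l _ => z0 + l * (z - z0))%C
      (fun l _ => w0 + l * (w - w0))%C Ha).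
    - eapply ana_ext; [|apply (Hlin _ Hz)]. intros; simpl; ring.
    - eapply ana_ext; [|apply (Hlin _ Hw)]. intros; simpl; ring. }
  destruct Hh as [c [_ Hc]].
  set (h := fun t : R => f (z0 + RtoC t * (z - z0))%C (w0 + RtoC t * (w - w0))%C).
  assert (Hser : forall t, Rabs t <= 1 -> Cser (fun j => c j 0%nat * RtoC (t ^ j))%C (h t)).
  { intros t Ht. specialize (Hc (RtoC t) (RtoC 0)).
    assert (Ht' : Cmod (RtoC t - 0)%C <= 1).
    { replace (RtoC t - 0)%C with (RtoC t) by ring. now rewrite Cmod_R. }
    assert (H0 : Cmod (RtoC 0 - 0)%C <= 1) by (rewrite Cmod_sub_self; lra).
    specialize (Hc Ht' H0). simpl in Hc. unfold Cser. eapply Clim_ext; [|exact Hc].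
    intros N. unfold dsum. apply sum_n_ext. intros j.
    replace (RtoC t - 0)%C with (RtoC t) by ring.
    replace (RtoC 0 - 0)%C with (RtoC 0) by ring.
    rewrite RtoC_pow. induction N as [|N IH].
    - rewrite Csum_0. simpl. cring.
    - rewrite Csum_Sn, IH, Cpow_S. cring. }
  set (B := 1 + Cmod (z - z0)%C + Cmod (w - w0)%C).
  assert (HB : 0 < B) by (unfold B; pose proof (Cmod_ge_0 (z - z0)%C); pose proof (Cmod_ge_0 (w - w0)%C); lra).
  assert (Hzero : forall t, Rabs t < eps / B -> h t = RtoC 0).
  { intros t Ht. unfold h. apply Hn.
    - replace (z0 + RtoC t * (z - z0) - z0)%C with (RtoC t * (z - z0))%C by ring.
      rewrite Cmod_mult, Cmod_R. apply Rle_lt_trans with (Rabs t * B).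
      + apply Rmult_le_compat_l; [apply Rabs_pos|]. unfold B. pose proof (Cmod_ge_0 (w - w0)%C). lra.
      + apply Rlt_div_r in Ht; lra.
    - replace (w0 + RtoC t * (w - w0) - w0)%C with (RtoC t * (w - w0))%C by ring.
      rewrite Cmod_mult, Cmod_R. apply Rle_lt_trans with (Rabs t * B).
      + apply Rmult_le_compat_l; [apply Rabs_pos|]. unfold B. pose proof (Cmod_ge_0 (z - z0)%C). lra.
      + apply Rlt_div_r in Ht; lra. }
  assert (HeB : 0 < eps / B) by now apply Rdiv_lt_0_compat.
  assert (E : h 1 = RtoC 0).
  { assert (ERe : Re (h 1) = 0).
    { apply (real_power_series_zero (fun j => Re (c j 0%nat)) (fun t => Re (h t)) _ HeB).
      - intros t Ht. eapply is_series_ext; [|apply (Cser_Re _ _ (Hser t Ht))].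
        intros j. simpl. destruct (c j 0%nat). simpl. ring.
      - intros t Ht. now rewrite Hzero. }
    assert (EIm : Im (h 1) = 0).
    { apply (real_power_series_zero (fun j => Im (c j 0%nat)) (fun t => Im (h t)) _ HeB).
      - intros t Ht. eapply is_series_ext; [|apply (Cser_Im _ _ (Hser t Ht))].
        intros j. simpl. destruct (c j 0%nat). simpl. ring.
      - intros t Ht. now rewrite Hzero. }
    destruct (h 1). simpl in ERe, EIm. now rewrite ERe, EIm. }
  unfold h in E. rewrite <- E. f_equal; ring.
Qed.

(** A supremum argument. Since [P] may be transferred between any two points near [t0], the same
    hypothesis shows that the supremum is attained and that it can be passed. *)
Lemma unit_interval_propagation (P : R -> Prop) :
  P 0 ->
  (forall t0, 0 <= t0 <= 1 -> exists d, 0 < d /\ forall t t',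
    0 <= t <= 1 -> 0 <= t' <= 1 -> Rabs (t - t0) < d -> Rabs (t' - t0) < d -> P t -> P t') ->
  P 1.
Proof.
  intros H0 Hloc.
  set (E := fun x => 0 <= x <= 1 /\ P x).
  destruct (completeness E) as [s [Hub Hlub]].
  - exists 1. intros x [Hx _]. lra.
  - exists 0. split; [lra|exact H0].
  - assert (Hs : 0 <= s <= 1).
    { split; [apply Hub; split; [lra|exact H0]|apply Hlub; intros x [Hx _]; lra]. }
    destruct (Hloc s Hs) as [d [Hd H]].
    assert (Hx : exists x, E x /\ s - d < x).
    { apply NNPP. intros Hn. assert (s <= s - d); [|lra].
      apply Hlub. intros x Hx. apply Rnot_lt_le. intros Hlt. apply Hn. now exists x. }
    destruct Hx as [x [[Hx Px] Hxd]].
    assert (Hxs : x <= s) by (apply Hub; now split).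
    assert (HP : forall t', 0 <= t' <= 1 -> Rabs (t' - s) < d -> P t').
    { intros t' Ht' Hd'. apply (H x t'); auto. rewrite Rabs_left1; lra. }
    destruct (Rlt_le_dec s 1) as [Hlt|Hge].
    + exfalso. set (t' := Rmin 1 (s + d / 2)).
      assert (Ht' : s < t' <= 1 /\ t' <= s + d / 2).
      { unfold t'. split; [split; [apply Rmin_glb_lt; lra|apply Rmin_l]|apply Rmin_r]. }
      assert (t' <= s); [|lra]. apply Hub. split; [lra|]. apply HP; [lra|].
      rewrite Rabs_pos_eq; lra.
    + apply HP; [lra|]. rewrite Rabs_pos_eq; lra.
Qed.

Definition seg (t : R) (a b : C) : C := (a + RtoC t * (b - a))%C.

Definition convex2 (V : C -> C -> Prop) : Prop :=
  forall (z w z' w' : C) (t : R), V z w -> V z' w' -> 0 <= t <= 1 ->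
    V (seg t z z') (seg t w w').

Lemma seg_0 (a b : C) : seg 0 a b = a.
Proof. unfold seg. ring. Qed.

Lemma seg_1 (a b : C) : seg 1 a b = b.
Proof. unfold seg. ring. Qed.

Lemma seg_dist (t u : R) (a b : C) :
  Cmod (seg t a b - seg u a b)%C = Rabs (t - u) * Cmod (b - a)%C.
Proof.
  rewrite <- Cmod_R, <- Cmod_mult. f_equal. unfold seg. rewrite RtoC_minus. ring.
Qed.

Lemma segments_locally_short (z w z' w' : C) (r : R) : 0 < r ->
  exists d, 0 < d /\ forall t u, Rabs (t - u) < d ->
    Cmod (seg t z z' - seg u z z')%C < r /\ Cmod (seg t w w' - seg u w w')%C < r.
Proof.
  intros Hr. pose proof (Cmod_ge_0 (z' - z)%C). pose proof (Cmod_ge_0 (w' - w)%C).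
  set (B := 1 + Cmod (z' - z)%C + Cmod (w' - w)%C).
  assert (HB : 0 < B) by (unfold B; lra).
  exists (r / B). split; [now apply Rdiv_lt_0_compat|].
  intros t u Ht. apply Rlt_div_r in Ht; [|exact HB].
  rewrite !seg_dist. pose proof (Rabs_pos (t - u)).
  split; eapply Rle_lt_trans; try exact Ht; apply Rmult_le_compat_l; unfold B; lra.
Qed.

(** Local vanishing is pushed along the segment from [(a, b)]; convexity keeps the segment in the
    domain, and [ana_zero_near_center] spreads it over a polydisc of uniform size around each
    point. *)
Lemma identity_theorem (V : C -> C -> Prop) (f : C -> C -> C) (a b : C) (eps : R) :
  convex2 V -> (forall z w, V z w -> locana f z w) ->
  V a b -> 0 < eps -> near a b eps (fun z w => f z w = RtoC 0) ->
  forall z w, V z w -> exists d, 0 < d /\ near z w d (fun z w => f z w = RtoC 0).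
Proof.
  intros HV Hf Hab He Hn z w Hzw.
  rewrite <- (seg_1 a z), <- (seg_1 b w).
  apply (unit_interval_propagation (fun t => exists d, 0 < d /\
    near (seg t a z) (seg t b w) d (fun z w => f z w = RtoC 0))).
  - rewrite !seg_0. now exists eps.
  - intros t0 Ht0. destruct (Hf _ _ (HV a b z w t0 Hab Hzw Ht0)) as [r [M [Hr Ha]]].
    (* The points at [t] and [t'] are within r/4 of each other, so the polydisc of radius r/4 at
       [t'] lies in that of radius r/2 at [t], which lies in the original one. *)
    destruct (segments_locally_short a b z w (r / 8)) as [d [Hd Hs]]; [lra|].
    exists d. split; [exact Hd|].
    intros t t' Ht Ht' Hd1 Hd2 [e [He' Hz]].
    destruct (Hs _ _ Hd1) as [A1 A2]. destruct (Hs _ _ Hd2) as [B1 B2].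
    assert (Ha' : ana (seg t a z) (seg t b w) (r / 2) M f).
    { apply ana_recenter with (seg t0 a z) (seg t0 b w) r; lra || assumption. }
    exists (r / 4). split; [lra|]. intros z1 w1 Hz1 Hw1.
    apply (ana_zero_near_center (seg t a z) (seg t b w) (r / 2) M e f z1 w1); auto; [lra| |].
    + pose proof (Cmod_sub_trans z1 (seg t' a z) (seg t a z)).
      pose proof (Cmod_sub_trans (seg t' a z) (seg t0 a z) (seg t a z)).
      rewrite (Cmod_minus_sym (seg t0 a z)) in *. lra.
    + pose proof (Cmod_sub_trans w1 (seg t' b w) (seg t b w)).
      pose proof (Cmod_sub_trans (seg t' b w) (seg t0 b w) (seg t b w)).
      rewrite (Cmod_minus_sym (seg t0 b w)) in *. lra.
Qed.

Lemma near_self (a b : C) (eps : R) (P : C -> C -> Prop) :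
  0 < eps -> near a b eps P -> P a b.
Proof. intros He H. apply H; rewrite Cmod_sub_self; exact He. Qed.

Lemma polydisc_convex (z0 w0 : C) (r : R) :
  convex2 (fun z w => Cmod (z - z0)%C < r /\ Cmod (w - w0)%C < r).
Proof.
  assert (H : forall (c a b : C) (t : R), Cmod (a - c)%C < r -> Cmod (b - c)%C < r ->
    0 <= t <= 1 -> Cmod (seg t a b - c)%C < r).
  { intros c a b t Ha Hb Ht.
    replace (seg t a b - c)%C with (RtoC (1 - t) * (a - c) + RtoC t * (b - c))%C
      by (unfold seg; rewrite RtoC_minus; ring).
    eapply Rle_lt_trans; [apply Cmod_triangle|].
    rewrite !Cmod_mult, !Cmod_R, !Rabs_pos_eq by lra.
    pose proof (Cmod_ge_0 (a - c)%C). pose proof (Cmod_ge_0 (b - c)%C).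
    destruct (Req_dec t 0) as [->|Hne]; [lra|]. nra. }
  intros z w z' w' t [A B] [A' B'] Ht. split; now apply H.
Qed.

Lemma ana_locana_polydisc (z0 w0 : C) (r M : R) (f : C -> C -> C) (z w : C) :
  ana z0 w0 r M f -> Cmod (z - z0)%C < r -> Cmod (w - w0)%C < r -> locana f z w.
Proof.
  intros Ha Hz Hw. set (rho := Rmin (r - Cmod (z - z0)%C) (r - Cmod (w - w0)%C)).
  assert (Hrho : 0 < rho) by (apply Rmin_pos; lra).
  pose proof (Rmin_l (r - Cmod (z - z0)%C) (r - Cmod (w - w0)%C)).
  pose proof (Rmin_r (r - Cmod (z - z0)%C) (r - Cmod (w - w0)%C)).
  exists rho, M. split; [exact Hrho|].
  apply ana_recenter with z0 w0 r; auto; fold rho in H, H0; lra.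
Qed.

Lemma ana_identity (z0 w0 : C) (r M : R) (f : C -> C -> C) (a b : C) (eps : R) :
  ana z0 w0 r M f -> Cmod (a - z0)%C < r -> Cmod (b - w0)%C < r -> 0 < eps ->
  near a b eps (fun z w => f z w = RtoC 0) -> near z0 w0 r (fun z w => f z w = RtoC 0).
Proof.
  intros Ha H1 H2 He Hn z w Hz Hw.
  destruct (identity_theorem (fun z w => Cmod (z - z0)%C < r /\ Cmod (w - w0)%C < r)
    f a b eps (polydisc_convex z0 w0 r)) with (z := z) (w := w) as [d [Hd H]]; auto.
  - intros z1 w1 [Hz1 Hw1]. now apply ana_locana_polydisc with z0 w0 r M.
  - exact (near_self z w d (fun z w => f z w = RtoC 0) Hd H).
Qed.

(** * Values of a meromorphic continuation *)

(** Absolute convergence at the single point (z0 + r/2, w0 + r/2) of the open polydisc is exactly a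
    bound on the weighted l1-norm at radius r/2. *)
Lemma holomorphic_at_locana (f : C -> C -> C) (z0 w0 : C) :
  holomorphic_at f z0 w0 <-> locana f z0 w0.
Proof.
  split.
  - intros [c [r [Hr H]]].
    assert (Hlt : Cmod (RtoC (r / 2)) < r) by (rewrite Cmod_R, Rabs_pos_eq; lra).
    assert (E : forall a : C, (a + RtoC (r / 2) - a)%C = RtoC (r / 2)) by (intros; ring).
    destruct (H (z0 + RtoC (r / 2))%C (w0 + RtoC (r / 2))%C) as [[M HM] _];
      [now rewrite E..|].
    rewrite !E in HM. exists (r / 2), M. split; [lra|]. exists c. split.
    + intros N. eapply Rle_trans; [|apply (HM N)]. right. apply dsum_ext. intros j k.
      rewrite !Cmod_mult, !Cmod_pow, Cmod_R, Rabs_pos_eq by lra.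
      symmetry. apply Rmult_assoc.
    + intros z w Hz Hw. apply Clim_filterlim.
      destruct (H z w) as [_ Hl]; [lra..|].
      eapply filterlim_ext; [|exact Hl]. intros N. apply dsum_ext. intros j k.
      symmetry. apply Cmult_assoc.
  - intros [r [M [Hr [c [Hc Hf]]]]]. exists c, r. split; [exact Hr|].
    intros z w Hz Hw. split.
    + exists M. intros N. eapply Rle_trans; [|apply (pseries_abs_le c r M (z - z0)%C (w - w0)%C N Hc); lra].
      right. apply dsum_ext. intros j k. now rewrite Cmult_assoc.
    + apply Clim_filterlim. eapply Clim_ext; [|apply (Hf z w); lra].
      intros N. apply dsum_ext. intros j k. apply Cmult_assoc.
Qed.

Lemma locana_common (f g : C -> C -> C) (z0 w0 : C) :
  locana f z0 w0 -> locana g z0 w0 ->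
  exists r M, 0 < r /\ forall rho, 0 < rho <= r -> ana z0 w0 rho M f /\ ana z0 w0 rho M g.
Proof.
  intros [r1 [M1 [Hr1 H1]]] [r2 [M2 [Hr2 H2]]].
  exists (Rmin r1 r2), (Rmax M1 M2). split; [now apply Rmin_pos|].
  intros rho Hrho. pose proof (Rmin_l r1 r2). pose proof (Rmin_r r1 r2). split.
  - apply ana_le with M1; [apply Rmax_l|]. apply ana_shrink with r1; auto. lra.
  - apply ana_le with M2; [apply Rmax_r|]. apply ana_shrink with r2; auto. lra.
Qed.

(** The point lies in the closure of the interior of the set where [l Z = F]. This weakening of
    equality near the point survives arbitrary values of [Z] at its non-regular points. *)
Definition eq_interior_adherent (Z l F : C -> C -> C) (z w : C) : Prop :=
  forall eta, 0 < eta -> exists a b rho, 0 < rho /\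
    Cmod (a - z)%C < eta /\ Cmod (b - w)%C < eta /\
    near a b rho (fun z w => (l z w * Z z w)%C = F z w).

(** With Z = f/g off the zeros of [g], the relation [l Z = F] becomes [F g = l f] between analytic
    functions. It spreads from an open set to the whole polydisc, and dividing by [g] recovers
    [l Z = F] off its zeros. *)
Lemma eq_interior_propagates (Z l F : C -> C -> C) (z0 w0 : C) :
  meromorphic Z -> locana l z0 w0 -> locana F z0 w0 ->
  exists r, 0 < r /\ forall z w, Cmod (z - z0)%C < r -> Cmod (w - w0)%C < r ->
    eq_interior_adherent Z l F z w ->
    (near z0 w0 r (eq_interior_adherent Z l F)) /\
    exists g, nonzero_germ g z0 w0 /\
      near z0 w0 r (fun z w => g z w <> RtoC 0 -> (l z w * Z z w)%C = F z w).
Proof.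
  intros [HZ _] Hl HF.
  destruct (HZ z0 w0) as [f [g [Hf [Hg Heq]]]].
  destruct Hg as [Hg Hgnz].
  destruct (locana_common l F z0 w0 Hl HF) as [r1 [M1 [Hr1 H1]]].
  destruct (locana_common f g z0 w0) as [r2 [M2 [Hr2 H2]]];
    [now apply holomorphic_at_locana..|].
  apply locally_pair in Heq. destruct Heq as [r3 [Hr3 H3]]. simpl in H3.
  set (r := Rmin r3 (Rmin r1 r2)).
  assert (Hr : 0 < r) by (unfold r; repeat apply Rmin_pos; assumption).
  assert (L1 : r <= r1) by (unfold r; eapply Rle_trans; [apply Rmin_r|apply Rmin_l]).
  assert (L2 : r <= r2) by (unfold r; eapply Rle_trans; [apply Rmin_r|apply Rmin_r]).
  assert (L3 : r <= r3) by (unfold r; apply Rmin_l).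
  destruct (H1 r) as [Al AF]; [lra|]. destruct (H2 r) as [Af Ag]; [lra|].
  exists r. split; [exact Hr|].
  (* The zero set of [g] has no interior: otherwise [g] would vanish on the whole polydisc, against
     its nonzero germ. So open sets with [g] nonzero come arbitrarily close to every point. *)
  assert (Hnz : forall z w eta, Cmod (z - z0)%C < r -> Cmod (w - w0)%C < r -> 0 < eta ->
    exists a b rho, 0 < rho /\ Cmod (a - z)%C < eta /\ Cmod (b - w)%C < eta /\
      Cmod (a - z0)%C < r /\ Cmod (b - w0)%C < r /\
      near a b rho (fun z w => g z w <> RtoC 0)).
  { intros z w eta Hz Hw Heta.
    set (e := Rmin eta (Rmin (r - Cmod (z - z0)%C) (r - Cmod (w - w0)%C))).
    assert (He : 0 < e) by (unfold e; repeat apply Rmin_pos; lra).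
    assert (E1 : e <= eta) by apply Rmin_l.
    assert (E2 : e <= r - Cmod (z - z0)%C) by (unfold e; eapply Rle_trans; [apply Rmin_r|apply Rmin_l]).
    assert (E3 : e <= r - Cmod (w - w0)%C) by (unfold e; eapply Rle_trans; [apply Rmin_r|apply Rmin_r]).
    destruct (classic (near z w e (fun z w => g z w = RtoC 0))) as [Hzero|Hnot].
    - exfalso. apply Hgnz. apply locally_pair. exists r. split; [exact Hr|].
      simpl. apply (ana_identity z0 w0 r M2 g z w e); auto.
    - unfold near in Hnot. apply not_all_ex_not in Hnot. destruct Hnot as [a Hnot].
      apply not_all_ex_not in Hnot. destruct Hnot as [b Hnot].
      apply imply_to_and in Hnot. destruct Hnot as [Ha Hnot].
      apply imply_to_and in Hnot. destruct Hnot as [Hb Hnot].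
      pose proof (Cmod_sub_trans a z z0). pose proof (Cmod_sub_trans b w w0).
      destruct (ana_locana_polydisc z0 w0 r M2 g a b) as [rg [Mg [Hrg Hag]]]; [assumption|lra|lra|].
      destruct (ana_nonzero a b rg Mg g Hrg Hag Hnot) as [d [Hd Hnd]].
      exists a, b, d. repeat split; auto; lra. }
  intros z w Hz Hw HQ.
  (* Inside an open set where [l Z = F], a smaller one is found where also [g] is nonzero; the
     identity theorem starts there. *)
  assert (HFg : near z0 w0 r (fun z w => (F z w * g z w - l z w * f z w)%C = RtoC 0)).
  { set (e := Rmin (r - Cmod (z - z0)%C) (r - Cmod (w - w0)%C)).
    assert (He : 0 < e) by (apply Rmin_pos; lra).
    assert (E2 : e <= r - Cmod (z - z0)%C) by apply Rmin_l.
    assert (E3 : e <= r - Cmod (w - w0)%C) by apply Rmin_r.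
    destruct (HQ e He) as [a [b [rho [Hrho [Ha [Hb Hab]]]]]].
    pose proof (Cmod_sub_trans a z z0). pose proof (Cmod_sub_trans b w w0).
    destruct (Hnz a b rho) as [a' [b' [rho' [Hrho' [Ha' [Hb' [Ha'' [Hb'' Hg']]]]]]]]; [lra..|].
    set (d := Rmin (Rmin rho' (rho - Rmax (Cmod (a' - a)%C) (Cmod (b' - b)%C)))
      (r - Rmax (Cmod (a' - z0)%C) (Cmod (b' - w0)%C))).
    assert (Hd : 0 < d).
    { unfold d. repeat apply Rmin_pos; auto; apply Rlt_0_minus; now apply Rmax_lub_lt. }
    assert (D1 : d <= rho') by (unfold d; eapply Rle_trans; [apply Rmin_l|apply Rmin_l]).
    assert (D2 : d <= rho - Rmax (Cmod (a' - a)%C) (Cmod (b' - b)%C))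
      by (unfold d; eapply Rle_trans; [apply Rmin_l|apply Rmin_r]).
    assert (D3 : d <= r - Rmax (Cmod (a' - z0)%C) (Cmod (b' - w0)%C)) by (unfold d; apply Rmin_r).
    pose proof (Rmax_l (Cmod (a' - a)%C) (Cmod (b' - b)%C)).
    pose proof (Rmax_r (Cmod (a' - a)%C) (Cmod (b' - b)%C)).
    pose proof (Rmax_l (Cmod (a' - z0)%C) (Cmod (b' - w0)%C)).
    pose proof (Rmax_r (Cmod (a' - z0)%C) (Cmod (b' - w0)%C)).
    apply (ana_identity z0 w0 r (M1 * M2 + M1 * M2) _ a' b' d); auto.
    - apply (ana_minus z0 w0 r Hr _ _ (fun z w => F z w * g z w)%C (fun z w => l z w * f z w)%C);
        now apply ana_mult.
    - intros x y Hx Hy.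
      pose proof (Cmod_sub_trans x a' a). pose proof (Cmod_sub_trans y b' b).
      pose proof (Cmod_sub_trans x a' z0). pose proof (Cmod_sub_trans y b' w0).
      assert (Hgx : g x y <> RtoC 0) by (apply Hg'; lra).
      assert (HZx : Z x y = (f x y / g x y)%C) by (apply H3; auto; lra).
      assert (HFx : (l x y * Z x y)%C = F x y) by (apply Hab; lra).
      rewrite <- HFx, HZx. field. exact Hgx. }
  assert (Hoff : near z0 w0 r (fun z w => g z w <> RtoC 0 -> (l z w * Z z w)%C = F z w)).
  { intros x y Hx Hy Hgx. specialize (HFg x y Hx Hy). simpl in HFg.
    assert (HZx : Z x y = (f x y / g x y)%C) by (apply H3; auto; lra).
    rewrite HZx. apply (f_equal (fun t => t / g x y)%C) in HFg.
    replace (l x y * (f x y / g x y))%C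
      with (F x y - (F x y * g x y - l x y * f x y) / g x y)%C by (field; exact Hgx).
    rewrite HFg. field. exact Hgx. }
  split.
  - intros x y Hx Hy eta Heta.
    destruct (Hnz x y eta Hx Hy Heta) as [a [b [rho [Hrho [Ha [Hb [Ha' [Hb' Hab]]]]]]]].
    exists a, b, (Rmin rho (Rmin (r - Cmod (a - z0)%C) (r - Cmod (b - w0)%C))).
    split; [repeat apply Rmin_pos; lra|]. split; [exact Ha|]. split; [exact Hb|].
    intros u v Hu Hv.
    set (e := Rmin rho (Rmin (r - Cmod (a - z0)%C) (r - Cmod (b - w0)%C))) in *.
    assert (E1 : e <= rho) by apply Rmin_l.
    assert (E2 : e <= r - Cmod (a - z0)%C) by (unfold e; eapply Rle_trans; [apply Rmin_r|apply Rmin_l]).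
    assert (E3 : e <= r - Cmod (b - w0)%C) by (unfold e; eapply Rle_trans; [apply Rmin_r|apply Rmin_r]).
    pose proof (Cmod_sub_trans u a z0). pose proof (Cmod_sub_trans v b w0).
    apply Hoff; [lra..|]. apply Hab; lra.
  - exists g. split; [now split|exact Hoff].
Qed.

(** The factor [l] clears the poles of [Z] throughout [V]. Adherence travels from [(a, b)] to
    [(z, w)]; there [Z = h] off the zeros of some admissible [g], and the second clause of
    [meromorphic] fixes the value. *)
Lemma meromorphic_value (V : C -> C -> Prop) (Z l F : C -> C -> C) (a b z w : C) (eps : R)
    (h : C -> C -> C) :
  meromorphic Z -> convex2 V ->
  (forall z w, V z w -> locana l z w) -> (forall z w, V z w -> locana F z w) ->
  V a b -> 0 < eps -> near a b eps (fun z w => (l z w * Z z w)%C = F z w) ->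
  V z w -> l z w <> RtoC 0 -> locana h z w ->
  (exists d, 0 < d /\ near z w d (fun z w => F z w = (l z w * h z w)%C)) ->
  Z z w = h z w.
Proof.
  intros HZ HV Hl HF Hab He Hn Hzw Hlz Hh [d [Hd Hd']].
  assert (HQ : eq_interior_adherent Z l F z w).
  { rewrite <- (seg_1 a z), <- (seg_1 b w).
    apply (unit_interval_propagation (fun t => eq_interior_adherent Z l F (seg t a z) (seg t b w))).
    - rewrite !seg_0. intros eta Heta. exists a, b, eps.
      rewrite !Cmod_sub_self. repeat split; auto.
    - intros t0 Ht0. pose proof (HV a b z w t0 Hab Hzw Ht0) as Hv.
      destruct (eq_interior_propagates Z l F _ _ HZ (Hl _ _ Hv) (HF _ _ Hv)) as [r [Hr H]].
      destruct (segments_locally_short a b z w r Hr) as [e [He' Hs]].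
      exists e. split; [exact He'|]. intros t t' Ht Ht' D1 D2 Q.
      destruct (Hs _ _ D1) as [A1 A2]. destruct (Hs _ _ D2) as [B1 B2].
      destruct (H _ _ A1 A2 Q) as [H1 _]. apply H1; assumption. }
  destruct (eq_interior_propagates Z l F z w HZ (Hl _ _ Hzw) (HF _ _ Hzw)) as [r [Hr H]].
  destruct (H z w) as [_ [g [Hg Hoff]]]; [rewrite Cmod_sub_self; exact Hr..|exact HQ|].
  destruct (Hl _ _ Hzw) as [rl [Ml [Hrl Al]]].
  destruct (ana_nonzero z w rl Ml l Hrl Al Hlz) as [e [He' Hne]].
  destruct HZ as [_ HZ2].
  apply (HZ2 z w h g); [now apply holomorphic_at_locana|exact Hg|].
  apply locally_pair. exists (Rmin r (Rmin d e)). split; [repeat apply Rmin_pos; assumption|].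
  intros x y Hx Hy Hgx. simpl in Hgx |- *.
  assert (L1 : Rmin r (Rmin d e) <= r) by apply Rmin_l.
  assert (L2 : Rmin r (Rmin d e) <= d) by (eapply Rle_trans; [apply Rmin_r|apply Rmin_l]).
  assert (L3 : Rmin r (Rmin d e) <= e) by (eapply Rle_trans; [apply Rmin_r|apply Rmin_r]).
  assert (Hlx : l x y <> RtoC 0) by (apply Hne; lra).
  assert (E : (l x y * Z x y)%C = (l x y * h x y)%C).
  { rewrite (Hoff x y) by (lra || assumption). apply Hd'; lra. }
  apply (f_equal (fun t => t / l x y)%C) in E.
  replace (Z x y) with (l x y * Z x y / l x y)%C by (field; exact Hlx).
  rewrite E. field. exact Hlx.
Qed.

(** * Analytic continuation by comparison with integrals *)

Lemma INR_ge_1 (m : nat) : (1 <= m)%nat -> 1 <= INR m.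
Proof. intros H. apply (le_INR 1). exact H. Qed.

Lemma Rpower_pos (x y : R) : 0 < Rpower x y.
Proof. apply exp_pos. Qed.

Lemma npow_plus (m : nat) (a b : C) : npow m (a + b)%C = (npow m a * npow m b)%C.
Proof. unfold npow. rewrite <- Cexp_plus. f_equal. ring. Qed.

Lemma Cmod_npow (m : nat) (s : C) : Cmod (npow m s) = Rpower (INR m) (Re s).
Proof. unfold npow, Rpower. rewrite Cmod_Cexp. f_equal. destruct s; simpl; ring. Qed.

Lemma npow_1_l (s : C) : npow 1 s = RtoC 1.
Proof. unfold npow. simpl INR. rewrite ln_1, Cmult_0_r. apply Cexp_0. Qed.

Lemma npow_R (m : nat) (x : R) : npow m (RtoC x) = RtoC (Rpower (INR m) x).
Proof. unfold npow, Rpower. rewrite <- RtoC_mult. apply Cexp_R. Qed.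

Lemma npow_1_r (m : nat) : (1 <= m)%nat -> npow m 1%C = RtoC (INR m).
Proof. intros H. rewrite npow_R, Rpower_1; [reflexivity|]. apply INR_ge_1 in H. lra. Qed.

Definition log_step (M : nat) : R := ln (INR (S M)) - ln (INR M).

Lemma log_step_bounds (M : nat) : (1 <= M)%nat -> / INR (S M) <= log_step M <= / INR M.
Proof.
  intros HM. unfold log_step. pose proof (INR_ge_1 M HM) as H1.
  rewrite S_INR. split.
  - assert (ln (INR M) - ln (INR M + 1) <= - / (INR M + 1)); [|lra].
    rewrite <- (ln_exp (- / (INR M + 1))), <- ln_div by lra.
    apply ln_le; [apply Rdiv_lt_0_compat; lra|].
    replace (INR M / (INR M + 1)) with (1 + - / (INR M + 1)) by (field; lra).
    apply exp_ineq1_le.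
  - rewrite <- (ln_exp (/ INR M)), <- ln_div by lra.
    apply ln_le; [apply Rdiv_lt_0_compat; lra|].
    replace ((INR M + 1) / INR M) with (1 + / INR M) by (field; lra).
    apply exp_ineq1_le.
Qed.

Lemma inv_succ_bounds (M : nat) : (1 <= M)%nat -> / INR M <= 2 * / INR (S M) /\ / INR M <= 1.
Proof.
  intros HM. pose proof (INR_ge_1 M HM). rewrite S_INR. split.
  - apply (Rmult_le_reg_r (INR M * (INR M + 1))); [nra|]. field_simplify; lra.
  - rewrite <- Rinv_1. apply Rinv_le_contravar; lra.
Qed.

(** The error is at most 1/M - 1/(M+1) = 1/(M (M+1)), and 1/M is at most 2/(M+1). *)
Lemma log_step_error (M : nat) : (1 <= M)%nat ->
  0 <= log_step M - / INR (S M) <= 2 * (/ INR (S M) * / INR (S M)).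
Proof.
  intros HM. pose proof (log_step_bounds M HM) as [H1 H2]. split; [lra|].
  destruct (inv_succ_bounds M HM) as [H3 _].
  pose proof (INR_ge_1 M HM).
  assert (E : / INR M - / INR (S M) = / INR M * / INR (S M)) by (rewrite S_INR; field; lra).
  assert (0 < / INR (S M)) by (apply Rinv_0_lt_compat; rewrite S_INR; lra).
  nra.
Qed.

(** The quotient of M^(-p) by (M+1)^(-p) is exp (p [log_step M]), which is at least 1 + p/(M+1).
    Summed over [M] the right side telescopes: an integral comparison without integrals. *)
Lemma Rpower_step (M : nat) (p : R) : (1 <= M)%nat -> 0 <= p ->
  p * Rpower (INR (S M)) (- p - 1) <= Rpower (INR M) (- p) - Rpower (INR (S M)) (- p).
Proof.
  intros HM Hp. pose proof (INR_ge_1 M HM).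
  assert (HS : 0 < INR (S M)) by (rewrite S_INR; lra).
  assert (E : Rpower (INR M) (- p) = Rpower (INR (S M)) (- p) * exp (p * log_step M)).
  { unfold Rpower, log_step. rewrite <- exp_plus. f_equal. ring. }
  rewrite E. unfold Rminus at 1. rewrite Rpower_plus, (Rpower_Ropp _ 1), Rpower_1 by exact HS.
  pose proof (exp_ineq1_le (p * log_step M)). pose proof (log_step_bounds M HM) as [H1 _].
  pose proof (Rpower_pos (INR (S M)) (- p)).
  assert (p * / INR (S M) <= p * log_step M) by (apply Rmult_le_compat_l; assumption).
  nra.
Qed.

Lemma sum_Rpower_tail (m n : nat) (p : R) : (1 <= m)%nat -> 0 < p ->
  sum_n (fun k => Rpower (INR (S (m + k))) (- p - 1)) n
  <= (Rpower (INR m) (- p) - Rpower (INR (S (m + n))) (- p)) / p.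
Proof.
  intros Hm Hp. apply Rle_div_r; [exact Hp|].
  induction n as [|n IH].
  - rewrite Rsum_0, Nat.add_0_r, Rmult_comm. apply Rpower_step; [exact Hm|lra].
  - rewrite Rsum_Sn, Rmult_plus_distr_r.
    pose proof (Rpower_step (m + S n) p ltac:(lia) ltac:(lra)).
    rewrite <- plus_n_Sm in *. lra.
Qed.

Lemma Series_Rpower_tail (m : nat) (p : R) : (1 <= m)%nat -> 0 < p ->
  ex_series (fun k => Rpower (INR (S (m + k))) (- p - 1)) /\
  Series (fun k => Rpower (INR (S (m + k))) (- p - 1)) <= Rpower (INR m) (- p) / p.
Proof.
  intros Hm Hp. apply ex_series_bounded.
  - intros k. left. apply Rpower_pos.
  - intros n. eapply Rle_trans; [now apply sum_Rpower_tail|].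
    apply Rmult_le_compat_r; [left; now apply Rinv_0_lt_compat|].
    pose proof (Rpower_pos (INR (S (m + n))) (- p)). lra.
Qed.

Lemma ex_series_Rpower (q : R) : 1 < q -> ex_series (fun m => Rpower (INR (S m)) (- q)).
Proof.
  intros Hq. apply ex_series_incr_1.
  destruct (Series_Rpower_tail 1 (q - 1)) as [H _]; [lia|lra|].
  eapply ex_series_ext; [|exact H]. intros k. simpl. f_equal. ring.
Qed.

(** [gap M w] is [w - 1] times the difference between [(M+1)^(-w)] and the
    integral of [x^(-w)] over [[M, M+1]]. *)
Definition gap (M : nat) (w : C) : C :=
  ((w - 1) * npow (S M) (- w) + npow (S M) (1 - w) - npow M (1 - w))%C.

(** [K] stands for the norm of [w - 1]. The first term comes from [log_step_error], the second from
    the quadratic exponential remainder with [log_step M] at most 2/(M+1). *)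
Definition gap_const (K : R) : R := 2 * K + 4 * (K * K) * exp K.

(** Both terms in the bracket are of order (M+1)^(-2), so [gap M w] has order (M+1)^(-w-1). Hence
    its tails converge for Re w > 0, one unit beyond the series of powers. *)
Lemma gap_factor (M : nat) (w : C) : (1 <= M)%nat ->
  gap M w = (npow (S M) (1 - w) *
    (RtoC (/ INR (S M) - log_step M) * (w - 1)
     - (Cexp (RtoC (log_step M) * (w - 1)) - 1 - RtoC (log_step M) * (w - 1))))%C.
Proof.
  intros HM. unfold gap.
  assert (E1 : npow M (1 - w) = (npow (S M) (1 - w) * Cexp (RtoC (log_step M) * (w - 1)))%C).
  { unfold npow, log_step. rewrite <- Cexp_plus. f_equal. rewrite RtoC_minus. ring. }
  assert (HS : INR (S M) <> 0) by (apply not_0_INR; lia).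
  assert (E2 : npow (S M) (- w) = (RtoC (/ INR (S M)) * npow (S M) (1 - w))%C).
  { unfold Cminus. rewrite npow_plus, npow_1_r by lia.
    rewrite Cmult_assoc, <- RtoC_mult, Rinv_l by exact HS. ring. }
  rewrite E1, E2, RtoC_minus. ring.
Qed.

Section Gap.

Variables (z0 w0 : C) (r : R).
Hypothesis Hr : 0 < r.

Lemma ana_shift (f : C -> C -> C) (c a : C) (rho : R) :
  ana z0 w0 r rho (fun z w => f z w - c)%C ->
  ana z0 w0 r (Cmod (c - a)%C + rho) (fun z w => f z w - a)%C.
Proof.
  intros H. apply ana_ext with (fun z w => (c - a) + (f z w - c))%C; [intros; ring|].
  apply (ana_plus z0 w0 r Hr _ _ (fun _ _ => c - a)%C (fun z w => f z w - c)%C); auto.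
  now apply ana_const.
Qed.

Lemma ana_opp_center (f : C -> C -> C) (c : C) (rho : R) :
  ana z0 w0 r rho (fun z w => f z w - c)%C ->
  ana z0 w0 r rho (fun z w => - f z w - - c)%C.
Proof.
  intros H. apply ana_ext with (fun z w => - (f z w - c))%C; [intros; ring|].
  now apply ana_opp.
Qed.

Lemma ana_gap (M : nat) (f : C -> C -> C) (c : C) (rho : R) :
  (1 <= M)%nat -> ana z0 w0 r rho (fun z w => f z w - c)%C ->
  ana z0 w0 r (gap_const (Cmod (c - 1)%C + rho) * Rpower (INR (S M)) (- (Re c - rho) - 1))
    (fun z w => gap M (f z w)).
Proof.
  intros HM H.
  pose proof (ana_nonneg z0 w0 r Hr _ _ H) as Hrho.
  set (K := Cmod (c - 1)%C + rho).
  assert (HK0 : 0 <= K) by (unfold K; pose proof (Cmod_ge_0 (c - 1)%C); lra).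
  assert (HK : ana z0 w0 r K (fun z w => f z w - 1)%C) by now apply ana_shift.
  set (L := log_step M). set (i := / INR (S M)).
  destruct (log_step_bounds M HM) as [L1 L2]. fold L in L1, L2. fold i in L1.
  destruct (inv_succ_bounds M HM) as [L3 L4]. fold i in L3.
  destruct (log_step_error M HM) as [L5 L6]. fold L i in L5, L6.
  assert (HN : 0 < INR (S M)) by (apply lt_0_INR; lia).
  assert (Hi : 0 < i) by now apply Rinv_0_lt_compat.
  apply ana_ext with (fun z w => npow (S M) (1 - f z w) *
    (RtoC (i - L) * (f z w - 1)
     - (Cexp (RtoC L * (f z w - 1)) - 1 - RtoC L * (f z w - 1))))%C.
  { intros z w _ _. symmetry. now apply gap_factor. }
  assert (HL : ana z0 w0 r (L * K) (fun z w => RtoC L * (f z w - 1))%C).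
  { replace (L * K) with (Cmod (RtoC L) * K) by (rewrite Cmod_R, Rabs_pos_eq; lra).
    now apply (ana_scal z0 w0 r (RtoC L) K (fun z w => f z w - 1)%C). }
  apply ana_le with (Rpower (INR (S M)) (Re (1 - c)%C + rho)
    * ((L - i) * K + (L * K) * (L * K) * exp (L * K))).
  - replace (Rpower (INR (S M)) (Re (1 - c)%C + rho))
      with (Rpower (INR (S M)) (- (Re c - rho) - 1) * / (i * i)).
    + rewrite (Rmult_comm (gap_const K)), Rmult_assoc.
      apply Rmult_le_compat_l; [left; apply Rpower_pos|].
      apply (Rmult_le_reg_l (i * i)); [nra|].
      rewrite <- Rmult_assoc, Rinv_r, Rmult_1_l by nra.
      unfold gap_const.
      assert (exp (L * K) <= exp K) by (apply exp_le; nra).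
      pose proof (exp_pos (L * K)).
      assert ((L * K) * (L * K) <= 4 * (i * i) * (K * K)).
      { assert (0 <= L * K <= 2 * i * K) by (split; nra). nra. }
      assert ((L - i) * K <= 2 * (i * i) * K) by nra.
      assert ((L * K) * (L * K) * exp (L * K) <= 4 * (i * i) * (K * K) * exp K).
      { apply Rmult_le_compat; try lra. nra. }
      lra.
    + replace (Re (1 - c)%C + rho) with (- (Re c - rho) - 1 + (1 + 1)) by (destruct c; simpl; ring).
      rewrite (Rpower_plus (- (Re c - rho) - 1)), (Rpower_plus 1 1), Rpower_1 by exact HN.
      f_equal. unfold i. field. lra.
  - apply (ana_mult z0 w0 r Hr _ _ (fun z w => npow (S M) (1 - f z w))
      (fun z w => RtoC (i - L) * (f z w - 1)
     - (Cexp (RtoC L * (f z w - 1)) - 1 - RtoC L * (f z w - 1)))%C).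
    + apply ana_npow; [exact Hr|lia|].
      apply ana_ext with (fun z w => - (f z w - c))%C; [intros; ring|]. now apply ana_opp.
    + apply (ana_minus z0 w0 r Hr _ _ (fun z w => RtoC (i - L) * (f z w - 1))%C).
      * replace ((L - i) * K) with (Cmod (RtoC (i - L)) * K) by (rewrite Cmod_R, Rabs_left1; lra).
        now apply (ana_scal z0 w0 r (RtoC (i - L)) K (fun z w => f z w - 1)%C).
      * now apply (ana_exp_m2 z0 w0 r Hr (L * K) (fun z w => RtoC L * (f z w - 1))%C).
Qed.

End Gap.

Lemma ana_const_center (z0 w0 c : C) (r : R) : 0 < r ->
  ana z0 w0 r 0 (fun _ _ => c - c)%C.
Proof.
  intros Hr. rewrite <- (Cmod_sub_self c). now apply ana_const.
Qed.

Lemma gap_const_nonneg (K : R) : 0 <= K -> 0 <= gap_const K.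
Proof. intros H. unfold gap_const. pose proof (exp_pos K). nra. Qed.

(** The norm bound applied to a constant function, with [rho = 0], is a pointwise bound. *)
Lemma Cmod_gap (M : nat) (w : C) : (1 <= M)%nat ->
  Cmod (gap M w) <= gap_const (Cmod (w - 1)%C) * Rpower (INR (S M)) (- Re w - 1).
Proof.
  intros HM. assert (H1 : 0 < 1) by lra.
  pose proof (ana_gap 0 0 1 H1 M (fun _ _ => w) w 0 HM (ana_const_center 0 0 w 1 H1)) as H.
  pose proof (ana_bound 0 0 1 _ _ 0%C 0%C H) as Hb.
  rewrite Rminus_0_r, Rplus_0_r in Hb. apply Hb; rewrite Cmod_sub_self; lra.
Qed.

(** For Re w > 1 this is w - 1 times the sum of N^(-w) over N > m, less m^(1-w): the remainder of
    the integral comparison. The series itself makes sense for Re w > 0. *)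
Definition tail_gap (m : nat) (w : C) : C := CSeries (fun k => gap (m + k) w).

Lemma Cser_tail_gap (m : nat) (w : C) : (1 <= m)%nat -> 0 < Re w ->
  Cser (fun k => gap (m + k) w) (tail_gap m w).
Proof.
  intros Hm Hw.
  apply Cser_CSeries with (fun k => gap_const (Cmod (w - 1)%C) * Rpower (INR (S (m + k))) (- Re w - 1)).
  - intros k. apply Cmod_gap. lia.
  - apply (ex_series_scal_l (V := R_NormedModule)). now apply Series_Rpower_tail.
Qed.

Lemma ana_tail_gap (z0 w0 : C) (r : R) (m : nat) (f : C -> C -> C) (c : C) (rho : R) :
  0 < r -> (1 <= m)%nat -> ana z0 w0 r rho (fun z w => f z w - c)%C -> 0 < Re c - rho ->
  ana z0 w0 r (gap_const (Cmod (c - 1)%C + rho) / (Re c - rho) * Rpower (INR m) (- (Re c - rho)))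
    (fun z w => tail_gap m (f z w)).
Proof.
  intros Hr Hm H Hp.
  pose proof (ana_nonneg z0 w0 r Hr _ _ H) as Hrho.
  set (K := Cmod (c - 1)%C + rho).
  assert (HK0 : 0 <= K) by (unfold K; pose proof (Cmod_ge_0 (c - 1)%C); lra).
  destruct (Series_Rpower_tail m (Re c - rho) Hm Hp) as [Hex Hle].
  apply ana_le with (Series (fun k => gap_const K * Rpower (INR (S (m + k))) (- (Re c - rho) - 1))).
  - rewrite Series_scal_l. unfold Rdiv. rewrite Rmult_assoc.
    apply Rmult_le_compat_l; [now apply gap_const_nonneg|].
    rewrite (Rmult_comm (/ _)). exact Hle.
  - apply ana_series with (fun k z w => gap (m + k) (f z w)); [exact Hr| | |].
    + intros k. apply ana_gap; [exact Hr|lia|exact H].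
    + now apply (ex_series_scal_l (V := R_NormedModule)).
    + intros z w Hz Hw. apply Cser_tail_gap; [exact Hm|].
      pose proof (ana_bound z0 w0 r _ _ z w H Hz Hw) as Hb. simpl in Hb.
      pose proof (re_le_Cmod (f z w - c)%C) as Hre. apply Rabs_le_between in Hre.
      destruct (f z w), c. simpl in *. lra.
Qed.

Lemma sum_npow_gap (m n : nat) (w : C) :
  ((w - 1) * sum_n (fun k => npow (S (m + k)) (- w)) n)%C
  = (sum_n (fun k => gap (m + k) w) n + npow m (1 - w) - npow (S (m + n)) (1 - w))%C.
Proof.
  induction n as [|n IH].
  - rewrite !Csum_0. rewrite Nat.add_0_r. unfold gap. cring.
  - rewrite !Csum_Sn. rewrite Cmult_plus_distr_l, IH.
    unfold gap. rewrite <- plus_n_Sm. cring.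
Qed.

Lemma is_lim_Rpower_neg (m : nat) (p : R) : (1 <= m)%nat -> 0 < p ->
  is_lim_seq (fun n => Rpower (INR (S (m + n))) (- p)) 0.
Proof.
  intros Hm Hp. unfold Rpower.
  apply (is_lim_seq_ext (fun n => exp (- (p * ln (INR (S (m + n))))))).
  { intros n. f_equal. ring. }
  assert (H : is_lim_seq (fun n => - (p * ln (INR (S (m + n))))) m_infty).
  { apply (is_lim_seq_opp _ p_infty).
    assert (Hl : is_lim_seq (fun n => ln (INR (S (m + n)))) p_infty).
    { apply (filterlim_comp _ _ _ (fun n => INR (S (m + n))) ln _ (Rbar_locally' p_infty)).
      - apply (is_lim_seq_ext (fun n => INR (n + S m)) _ p_infty).
        + intros n. f_equal. lia.
        + change (is_lim_seq (fun n => INR (n + S m)) p_infty).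
          apply (is_lim_seq_incr_n INR (S m) p_infty), is_lim_seq_INR.
      - apply is_lim_ln_p. }
    apply (is_lim_seq_ext (fun n => p * ln (INR (S (m + n))))); [reflexivity|].
    replace p_infty with (Rbar_mult p p_infty).
    - now apply is_lim_seq_scal_l.
    - simpl. destruct (Rle_dec 0 p) as [H0|]; [|lra].
      destruct (Rle_lt_or_eq_dec 0 p H0); [reflexivity|lra]. }
  apply (filterlim_comp _ _ _ (fun n => - (p * ln (INR (S (m + n))))) exp _ (Rbar_locally' m_infty)).
  - exact H.
  - apply is_lim_exp_m.
Qed.

Definition npow_tail (m : nat) (w : C) : C := ((npow m (1 - w) + tail_gap m w) / (w - 1))%C.

Lemma Re_gt_neq (w : C) (x : R) : x < Re w -> (w - RtoC x)%C <> RtoC 0.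
Proof.
  intros H E. apply (f_equal Re) in E. destruct w. simpl in *. lra.
Qed.

Lemma Cser_npow_tail (m : nat) (w : C) : (1 <= m)%nat -> 1 < Re w ->
  Cser (fun k => npow (S (m + k)) (- w)) (npow_tail m w).
Proof.
  intros Hm Hw.
  assert (Hne : (w - 1)%C <> RtoC 0) by now apply Re_gt_neq.
  assert (H : Clim (fun n => (sum_n (fun k => gap (m + k) w) n + npow m (1 - w)
    - npow (S (m + n)) (1 - w))%C) (tail_gap m w + npow m (1 - w) - 0)%C).
  { apply Clim_minus; [apply Clim_plus|].
    - apply Cser_tail_gap; [exact Hm|lra].
    - apply Clim_const.
    - apply Clim_squeeze with (fun n => Rpower (INR (S (m + n))) (- (Re w - 1))).
      + intros n. replace (npow (S (m + n)) (1 - w) - 0)%C with (npow (S (m + n)) (1 - w)) by ring.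
        rewrite Cmod_npow. right. f_equal. destruct w; simpl; ring.
      + apply is_lim_Rpower_neg; [exact Hm|lra]. }
  apply (Clim_scal (/ (w - 1))%C) in H.
  replace (npow_tail m w) with (/ (w - 1) * (tail_gap m w + npow m (1 - w) - 0))%C.
  - eapply Clim_ext; [|exact H]. intros n. simpl. rewrite <- sum_npow_gap.
    rewrite Cmult_assoc, Cinv_l by exact Hne. cring.
  - unfold npow_tail. field. exact Hne.
Qed.

(** The Riemann zeta function on Re u > 0 away from its pole: the term 1 plus [npow_tail 1 u], over
    a common denominator. *)
Definition zeta_cont (u : C) : C := ((u + tail_gap 1 u) / (u - 1))%C.

Lemma Cser_zeta (u : C) : 1 < Re u -> Cser (fun n => npow (S n) (- u)) (zeta_cont u).
Proof.
  intros Hu. pose proof (Cser_npow_tail 1 u ltac:(lia) Hu) as H.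
  apply (Cser_shift (fun n => npow (S n) (- u))) in H. rewrite npow_1_l in H.
  replace (zeta_cont u) with (1 + npow_tail 1 u)%C; [exact H|].
  unfold zeta_cont, npow_tail. rewrite npow_1_l. field. now apply Re_gt_neq.
Qed.

(** * Continuation of the double series *)

(** What remains of the double series, up to the factor [w - 1], once the main part m^(1-w) of each
    inner sum is removed. As [tail_gap m w] has order m^(-w), it converges for Re w > 0 and Re (z +
    w) > 1. *)
Definition weighted_gap (z w : C) : C :=
  CSeries (fun m => npow (S m) (- z) * tail_gap (S m) w)%C.

Lemma ana_weighted_gap_term (z0 w0 : C) (r : R) (m : nat) :
  0 < r -> 0 < Re w0 - r ->
  ana z0 w0 r (gap_const (Cmod (w0 - 1)%C + r) / (Re w0 - r)
      * Rpower (INR (S m)) (- (Re (z0 + w0)%C - 2 * r)))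
    (fun z w => npow (S m) (- z) * tail_gap (S m) w)%C.
Proof.
  intros Hr Hw.
  apply ana_le with (Rpower (INR (S m)) (Re (- z0)%C + r) *
    (gap_const (Cmod (w0 - 1)%C + r) / (Re w0 - r) * Rpower (INR (S m)) (- (Re w0 - r)))).
  - replace (- (Re (z0 + w0)%C - 2 * r)) with ((Re (- z0)%C + r) + - (Re w0 - r))
      by (destruct z0, w0; simpl; ring).
    rewrite (Rpower_plus (Re (- z0)%C + r) (- (Re w0 - r))). right. ring.
  - apply (ana_mult z0 w0 r Hr _ _ (fun z _ => npow (S m) (- z)) (fun _ w => tail_gap (S m) w)).
    + apply (ana_npow z0 w0 r Hr (S m) (- z0)%C r (fun z _ => - z)%C); [lia|].
      apply (ana_opp_center z0 w0 r (fun z _ => z)). now apply ana_fst.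
    + apply (ana_tail_gap z0 w0 r (S m) (fun _ w => w)); auto; [lia|]. now apply ana_snd.
Qed.

Lemma Cser_weighted_gap (z w : C) : 0 < Re w -> 1 < Re (z + w)%C ->
  Cser (fun m => npow (S m) (- z) * tail_gap (S m) w)%C (weighted_gap z w).
Proof.
  intros Hw Hzw. set (r := Rmin (Re w / 2) ((Re (z + w)%C - 1) / 4)).
  assert (Hr : 0 < r) by (apply Rmin_pos; lra).
  assert (R1 : r <= Re w / 2) by apply Rmin_l.
  assert (R2 : r <= (Re (z + w)%C - 1) / 4) by apply Rmin_r.
  apply Cser_CSeries with (fun m => gap_const (Cmod (w - 1)%C + r) / (Re w - r)
      * Rpower (INR (S m)) (- (Re (z + w)%C - 2 * r))).
  - intros m. apply (ana_bound z w r _ (fun z w => npow (S m) (- z) * tail_gap (S m) w)%C z w);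
      rewrite ?Cmod_sub_self; try lra.
    apply ana_weighted_gap_term; lra.
  - apply (ex_series_scal_l (V := R_NormedModule)). apply ex_series_Rpower. lra.
Qed.

Lemma locana_weighted_gap (z0 w0 : C) : 0 < Re w0 -> 1 < Re (z0 + w0)%C ->
  locana weighted_gap z0 w0.
Proof.
  intros Hw Hzw. set (r := Rmin (Re w0 / 2) ((Re (z0 + w0)%C - 1) / 4)).
  assert (Hr : 0 < r) by (apply Rmin_pos; lra).
  assert (R1 : r <= Re w0 / 2) by apply Rmin_l.
  assert (R2 : r <= (Re (z0 + w0)%C - 1) / 4) by apply Rmin_r.
  eexists r, _. split; [exact Hr|].
  apply ana_series with (fun m z w => npow (S m) (- z) * tail_gap (S m) w)%C; [exact Hr| | |].
  - intros m. apply ana_weighted_gap_term; lra.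
  - apply (ex_series_scal_l (V := R_NormedModule)). apply ex_series_Rpower. lra.
  - intros z w Hz Hw'.
    pose proof (re_le_Cmod (z - z0)%C) as Hre. apply Rabs_le_between in Hre.
    pose proof (re_le_Cmod (w - w0)%C) as Hre'. apply Rabs_le_between in Hre'.
    apply Cser_weighted_gap; destruct z, w, z0, w0; simpl in *; lra.
Qed.

Lemma locana_tail_gap_1 (z0 w0 : C) : 0 < Re z0 -> locana (fun z _ => tail_gap 1 z) z0 w0.
Proof.
  intros Hz. exists (Re z0 / 2). eexists. split; [lra|].
  apply (ana_tail_gap z0 w0 (Re z0 / 2) 1 (fun z _ => z) z0 (Re z0 / 2)); [lra|lia| |lra].
  apply ana_fst. lra.
Qed.

(** Summing m^(-z) [npow_tail m w] over [m]: the main parts m^(1-w) add up to zeta at z + w - 1. *)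
Definition double_zeta_cont (z w : C) : C :=
  ((weighted_gap z w + zeta_cont (z + w - 1)) / (w - 1))%C.

Lemma sum_n_above {G : AbelianMonoid} (g : nat -> G) (m n : nat) :
  sum_n (fun k => if (m <? k)%nat then g k else zero) (S (m + n))
  = sum_n (fun k => g (S (m + k))) n.
Proof.
  assert (H0 : forall K, (K <= m)%nat ->
    sum_n (fun k => if (m <? k)%nat then g k else zero) K = zero).
  { induction K as [|K IH]; intros HK.
    - rewrite sum_O. destruct (Nat.ltb_spec m 0); [lia|reflexivity].
    - rewrite sum_Sn, IH by lia. destruct (Nat.ltb_spec m (S K)); [lia|apply plus_zero_l]. }
  induction n as [|n IH].
  - rewrite sum_Sn, sum_O, Nat.add_0_r, H0, plus_zero_l by lia.
    destruct (Nat.ltb_spec m (S m)); [reflexivity|lia].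
  - rewrite sum_Sn, (sum_Sn (fun k => g (S (m + k)))), <- IH, <- plus_n_Sm. f_equal.
    destruct (Nat.ltb_spec m (S (S (m + n)))); [reflexivity|lia].
Qed.

Lemma sum_n_zero {G : AbelianMonoid} (g : nat -> G) (n : nat) :
  (forall k, (k <= n)%nat -> g k = zero) -> sum_n g n = zero.
Proof.
  induction n as [|n IH]; intros H.
  - rewrite sum_O. apply H. lia.
  - rewrite sum_Sn, IH, (H (S n)) by (intros; apply H || lia; lia). apply plus_zero_l.
Qed.

(** The sums over squares are compared with the iterated sum by [Tannery]: row [m] is dominated by
    its integral bound m^(1 - Re (z + w)) / (Re w - 1), summable since Re (z + w) > 2. *)
Lemma double_zeta_series (z w v : C) : 2 < Re (z + w)%C -> 1 < Re w ->
  is_dseries (double_zeta_term z w) v -> v = double_zeta_cont z w.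
Proof.
  intros Hzw Hw [_ Hlim]. apply Clim_filterlim in Hlim.
  assert (Hne : (w - 1)%C <> RtoC 0) by now apply Re_gt_neq.
  set (U := fun K m => sum_n (double_zeta_term z w m) K).
  assert (HU0 : forall K m, (m = 0 \/ K <= m)%nat -> U K m = RtoC 0).
  { intros K m Hm. unfold U. apply (sum_n_zero (G := C_AbelianMonoid)). intros k Hk. unfold double_zeta_term.
    destruct (Nat.leb_spec 1 m), (Nat.ltb_spec m k); simpl; try reflexivity; lia. }
  assert (HU : forall n m, (1 <= m)%nat ->
    U (S (m + n)) m = (npow m (- z) * sum_n (fun k => npow (S (m + k)) (- w)) n)%C).
  { intros n m Hm. unfold U. rewrite <- Csum_mult_l.
    rewrite <- (sum_n_above (G := C_AbelianMonoid) (fun k => npow m (- z) * npow k (- w))%C).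
    apply sum_n_ext. intros k. unfold double_zeta_term.
    destruct (Nat.leb_spec 1 m); [reflexivity|lia]. }
  (* Row 0 of the square is empty, and [npow 0] has no meaning, so index 0 is treated apart. *)
  set (v' := fun m => match m with O => RtoC 0 | S _ => (npow m (- z) * npow_tail m w)%C end).
  assert (Hv' : Cser v' (double_zeta_cont z w)).
  { replace (double_zeta_cont z w) with (v' 0%nat + double_zeta_cont z w)%C by (simpl; ring).
    apply Cser_shift. simpl.
    assert (Hu : 1 < Re (z + w - 1)%C) by (destruct z, w; simpl in *; lra).
    pose proof (Cser_plus _ _ _ _ (Cser_weighted_gap z w ltac:(lra) ltac:(lra)) (Cser_zeta _ Hu)) as H.
    apply (Cser_scal (/ (w - 1))%C) in H.
    replace (double_zeta_cont z w)
      with (/ (w - 1) * (weighted_gap z w + zeta_cont (z + w - 1)))%C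
      by (unfold double_zeta_cont; field; exact Hne).
    eapply Cser_ext; [|exact H]. intros n. cbv beta. unfold npow_tail.
    replace (- (z + w - 1))%C with (- z + (1 - w))%C by ring. rewrite npow_plus. field. exact Hne. }
  apply (Clim_unique _ _ _ Hlim).
  assert (Hp : 0 < Re w - 1) by lra.
  set (B := fun m => match m with O => 0 | S _ =>
    Rpower (INR m) (- (Re (z + w)%C - 1)) / (Re w - 1) end).
  apply (Tannery U v' (fun K => sum_n (U K) K) (double_zeta_cont z w) B).
  - intros K m. destruct m as [|m].
    { rewrite HU0 by lia. rewrite Cmod_0. simpl. lra. }
    assert (HB : 0 <= B (S m)).
    { unfold B. apply Rdiv_le_0_compat; [left; apply Rpower_pos|lra]. }
    destruct (le_lt_dec K (S m)) as [Hle|Hlt].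
    { rewrite HU0 by lia. rewrite Cmod_0. exact HB. }
    (* In the square of size [K] the second index of row [S m] runs from [S (S m)] to [K]. *)
    replace K with (S (S m + (K - S (S m)))) by lia.
    rewrite HU by lia. rewrite Cmod_mult, Cmod_npow.
    eapply Rle_trans; [apply Rmult_le_compat_l; [left; apply Rpower_pos|apply Csum_Cmod]|].
    eapply Rle_trans; [apply Rmult_le_compat_l; [left; apply Rpower_pos|]|].
    + rewrite (sum_n_ext _ (fun k => Rpower (INR (S (S m + k))) (- (Re w - 1) - 1))).
      * apply sum_Rpower_tail; [lia|exact Hp].
      * intros k. rewrite Cmod_npow. f_equal. destruct w; simpl; ring.
    + unfold B.
      replace (- (Re (z + w)%C - 1)) with (Re (- z)%C + - (Re w - 1)) by (destruct z, w; simpl; ring).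
      rewrite (Rpower_plus (Re (- z)%C)). unfold Rdiv. rewrite <- Rmult_assoc.
      apply Rmult_le_compat_r; [left; now apply Rinv_0_lt_compat|].
      apply Rmult_le_compat_l; [left; apply Rpower_pos|].
      pose proof (Rpower_pos (INR (S (S m + (K - S (S m))))) (- (Re w - 1))). lra.
  - apply ex_series_incr_1. unfold B, Rdiv.
    apply ex_series_scal_r. apply ex_series_Rpower. lra.
  - intros [|m].
    + eapply Clim_ext; [|apply (Clim_const (RtoC 0))]. intros K. symmetry. apply HU0. lia.
    + apply (is_lim_seq_incr_n _ (S (S m))).
      pose proof (Clim_scal (npow (S m) (- z)) _ _ (Cser_npow_tail (S m) w ltac:(lia) Hw)) as H.
      eapply is_lim_seq_ext; [|exact H]. intros n. simpl v'. cbv beta.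
      replace (n + S (S m))%nat with (S (S m + n)) by lia. now rewrite HU by lia.
  - intros K. apply Cser_finite. intros m Hm. apply HU0. lia.
  - exact Hv'.
Qed.

(** * Closure properties of local analyticity and affine substitutions *)

Lemma locana_plus (f g : C -> C -> C) (z0 w0 : C) :
  locana f z0 w0 -> locana g z0 w0 -> locana (fun z w => f z w + g z w)%C z0 w0.
Proof.
  intros Hf Hg. destruct (locana_common f g z0 w0 Hf Hg) as [r [M [Hr H]]].
  destruct (H r) as [A B]; [lra|]. exists r, (M + M). split; [exact Hr|]. now apply ana_plus.
Qed.

Lemma locana_mult (f g : C -> C -> C) (z0 w0 : C) :
  locana f z0 w0 -> locana g z0 w0 -> locana (fun z w => f z w * g z w)%C z0 w0.
Proof.
  intros Hf Hg. destruct (locana_common f g z0 w0 Hf Hg) as [r [M [Hr H]]].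
  destruct (H r) as [A B]; [lra|]. exists r, (M * M). split; [exact Hr|]. now apply ana_mult.
Qed.

Lemma locana_opp (f : C -> C -> C) (z0 w0 : C) :
  locana f z0 w0 -> locana (fun z w => - f z w)%C z0 w0.
Proof. intros [r [M [Hr H]]]. exists r, M. split; [exact Hr|now apply ana_opp]. Qed.

Lemma locana_minus (f g : C -> C -> C) (z0 w0 : C) :
  locana f z0 w0 -> locana g z0 w0 -> locana (fun z w => f z w - g z w)%C z0 w0.
Proof. intros Hf Hg. apply locana_plus; [exact Hf|now apply locana_opp]. Qed.

Lemma locana_const (c z0 w0 : C) : locana (fun _ _ => c) z0 w0.
Proof. exists 1, (Cmod c). split; [lra|]. apply ana_const. lra. Qed.

(** The norm of the increment is linear in the radius, for every radius. The radius can then be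
    shrunk until the map stays in the polydisc of an outer function, or away from zero. *)
Definition affine (f : C -> C -> C) (z0 w0 : C) : Prop :=
  exists k, 0 <= k /\ forall r, 0 < r -> ana z0 w0 r (k * r) (fun z w => f z w - f z0 w0)%C.

Lemma affine_fst (z0 w0 : C) : affine (fun z _ => z) z0 w0.
Proof. exists 1. split; [lra|]. intros r Hr. rewrite Rmult_1_l. now apply ana_fst. Qed.

Lemma affine_snd (z0 w0 : C) : affine (fun _ w => w) z0 w0.
Proof. exists 1. split; [lra|]. intros r Hr. rewrite Rmult_1_l. now apply ana_snd. Qed.

Lemma affine_const (c z0 w0 : C) : affine (fun _ _ => c) z0 w0.
Proof.
  exists 0. split; [lra|]. intros r Hr. rewrite Rmult_0_l. now apply ana_const_center.
Qed.

Lemma affine_plus (f g : C -> C -> C) (z0 w0 : C) :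
  affine f z0 w0 -> affine g z0 w0 -> affine (fun z w => f z w + g z w)%C z0 w0.
Proof.
  intros [k [Hk Hf]] [k' [Hk' Hg]]. exists (k + k'). split; [lra|]. intros r Hr.
  rewrite Rmult_plus_distr_r.
  apply ana_ext with (fun z w => (f z w - f z0 w0) + (g z w - g z0 w0))%C; [intros; ring|].
  apply (ana_plus z0 w0 r Hr _ _ (fun z w => f z w - f z0 w0)%C); auto.
Qed.

Lemma affine_opp (f : C -> C -> C) (z0 w0 : C) :
  affine f z0 w0 -> affine (fun z w => - f z w)%C z0 w0.
Proof.
  intros [k [Hk Hf]]. exists k. split; [lra|]. intros r Hr.
  apply ana_opp_center. auto.
Qed.

Lemma affine_minus (f g : C -> C -> C) (z0 w0 : C) :
  affine f z0 w0 -> affine g z0 w0 -> affine (fun z w => f z w - g z w)%C z0 w0.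
Proof. intros Hf Hg. apply affine_plus; [exact Hf|now apply affine_opp]. Qed.

Lemma locana_affine (f : C -> C -> C) (z0 w0 : C) : affine f z0 w0 -> locana f z0 w0.
Proof.
  intros [k [Hk Hf]]. exists 1. eexists. split; [lra|].
  apply ana_ext with (fun z w => (f z w - f z0 w0) + f z0 w0)%C; [intros; ring|].
  apply (ana_plus z0 w0 1 ltac:(lra) (k * 1) (Cmod (f z0 w0)) (fun z w => f z w - f z0 w0)%C
    (fun _ _ => f z0 w0)); [apply Hf; lra|apply ana_const; lra].
Qed.

Lemma locana_inv_affine (f : C -> C -> C) (z0 w0 : C) :
  affine f z0 w0 -> f z0 w0 <> RtoC 0 -> locana (fun z w => / f z w)%C z0 w0.
Proof.
  intros [k [Hk Hf]] Hne. apply Cmod_gt_0 in Hne.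
  set (r := Cmod (f z0 w0) / (2 * (k + 1))).
  assert (Hr : 0 < r) by (apply Rdiv_lt_0_compat; lra).
  exists r. eexists. split; [exact Hr|]. apply (ana_inv z0 w0 r Hr (f z0 w0) (k * r)).
  - now apply Hf.
  - apply Rle_lt_trans with ((k + 1) * r); [nra|]. unfold r.
    replace ((k + 1) * (Cmod (f z0 w0) / (2 * (k + 1)))) with (Cmod (f z0 w0) / 2) by (field; lra).
    lra.
Qed.

Lemma locana_comp (f a b : C -> C -> C) (z0 w0 : C) :
  locana f (a z0 w0) (b z0 w0) -> affine a z0 w0 -> affine b z0 w0 ->
  locana (fun z w => f (a z w) (b z w)) z0 w0.
Proof.
  intros [rho [M [Hrho H]]] [k [Hk Ha]] [k' [Hk' Hb]].
  set (r := rho / (k + k' + 1)).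
  assert (Hr : 0 < r) by (apply Rdiv_lt_0_compat; lra).
  assert (E : rho = (k + k' + 1) * r) by (unfold r; field; lra).
  exists r, M. split; [exact Hr|].
  apply (ana_comp z0 w0 r Hr (a z0 w0) (b z0 w0) rho M f a b H).
  - apply ana_le with (k * r); [nra|]. now apply Ha.
  - apply ana_le with (k' * r); [nra|]. now apply Hb.
Qed.

Lemma locana_tail_gap_comp (a : C -> C -> C) (z0 w0 : C) :
  affine a z0 w0 -> 0 < Re (a z0 w0) -> locana (fun z w => tail_gap 1 (a z w)) z0 w0.
Proof.
  intros Ha H. apply (locana_comp (fun z _ => tail_gap 1 z) a (fun _ _ => RtoC 0)); auto.
  - now apply locana_tail_gap_1.
  - apply affine_const.
Qed.

Ltac solve_affine := lazymatch goal with
  | |- affine (fun z w => (@?f z w - @?g z w)%C) ?a ?b =>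
      apply (affine_minus f g a b); solve_affine
  | |- affine (fun z w => (@?f z w + @?g z w)%C) ?a ?b =>
      apply (affine_plus f g a b); solve_affine
  | |- affine (fun z w => (- @?f z w)%C) ?a ?b => apply (affine_opp f a b); solve_affine
  | |- affine (fun z _ => z) ?a ?b => exact (affine_fst a b)
  | |- affine (fun _ w => w) ?a ?b => exact (affine_snd a b)
  | |- affine (fun _ _ => ?c) ?a ?b => exact (affine_const c a b)
  end.

(** * Values of the continuation beyond absolute convergence *)

(** [double_zeta_cont] times [z + w - 2], with that factor cancelled by hand against the pole of
    [zeta_cont], so that it is analytic across the polar line. *)
Definition cleared_double_zeta (z w : C) : C :=
  (((z + w - 2) * weighted_gap z w + ((z + w - 1) + tail_gap 1 (z + w - 1))) * / (w - 1))%C.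

Lemma cleared_double_zeta_eq (z w : C) : (z + w - 2)%C <> RtoC 0 -> (w - 1)%C <> RtoC 0 ->
  cleared_double_zeta z w = ((z + w - 2) * double_zeta_cont z w)%C.
Proof.
  intros H1 H2. unfold cleared_double_zeta, double_zeta_cont, zeta_cont.
  replace (z + w - 1 - 1)%C with (z + w - 2)%C by ring. field. now split.
Qed.

Lemma locana_cleared (z w : C) : 1 < Re w -> 1 < Re (z + w)%C -> locana cleared_double_zeta z w.
Proof.
  intros Hw Hzw.
  apply (locana_mult (fun z w => (z + w - 2) * weighted_gap z w + ((z + w - 1) + tail_gap 1 (z + w - 1)))%C
    (fun _ w => / (w - 1))%C).
  - apply (locana_plus (fun z w => (z + w - 2) * weighted_gap z w)%C
      (fun z w => (z + w - 1) + tail_gap 1 (z + w - 1))%C).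
    + apply (locana_mult (fun z w => z + w - 2)%C weighted_gap).
      * apply locana_affine. solve_affine.
      * apply locana_weighted_gap; lra.
    + apply (locana_plus (fun z w => z + w - 1)%C (fun z w => tail_gap 1 (z + w - 1))).
      * apply locana_affine. solve_affine.
      * apply (locana_tail_gap_comp (fun z w => z + w - 1)%C); [solve_affine|].
        destruct z, w; simpl in *; lra.
  - apply (locana_inv_affine (fun _ w => w - 1)%C); [solve_affine|now apply Re_gt_neq].
Qed.

Lemma locana_double_zeta_cont (z w : C) : 1 < Re w -> 1 < Re (z + w)%C ->
  (z + w - 2)%C <> RtoC 0 -> locana double_zeta_cont z w.
Proof.
  intros Hw Hzw Hne.
  apply (locana_mult (fun z w => weighted_gap z w + zeta_cont (z + w - 1))%C
    (fun _ w => / (w - 1))%C).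
  - apply (locana_plus weighted_gap (fun z w => zeta_cont (z + w - 1))).
    + apply locana_weighted_gap; lra.
    + apply (locana_mult (fun z w => (z + w - 1) + tail_gap 1 (z + w - 1))%C
        (fun z w => / (z + w - 1 - 1))%C).
      * apply (locana_plus (fun z w => z + w - 1)%C (fun z w => tail_gap 1 (z + w - 1))).
        -- apply locana_affine. solve_affine.
        -- apply (locana_tail_gap_comp (fun z w => z + w - 1)%C); [solve_affine|].
           destruct z, w; simpl in *; lra.
      * apply (locana_inv_affine (fun z w => z + w - 1 - 1)%C); [solve_affine|].
        replace (z + w - 1 - 1)%C with (z + w - 2)%C by ring. exact Hne.
  - apply (locana_inv_affine (fun _ w => w - 1)%C); [solve_affine|now apply Re_gt_neq].
Qed.

Lemma Re_close (a b : C) (eps : R) : Cmod (a - b)%C < eps -> Re b - eps < Re a < Re b + eps.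
Proof.
  intros H. pose proof (re_le_Cmod (a - b)%C) as Hre. apply Rabs_le_between in Hre.
  destruct a, b. simpl in *. lra.
Qed.

(** [meromorphic_value] with clearing factor [z + w - 2] on the convex region Re w > 1, Re (z + w) >
    1. *)
Lemma double_zeta_value (Z : C -> C -> C) (z w : C) :
  is_double_zeta Z -> 1 < Re w -> 1 < Re (z + w)%C -> (z + w - 2)%C <> RtoC 0 ->
  Z z w = double_zeta_cont z w.
Proof.
  intros [HZ Hser] Hw Hzw Hne.
  (* Within [eps] of the base point (z + 2, w) the sum of the arguments has real part above 1 + 2 -
     2 eps >= 2, and the second argument stays in Re > 1: the series converges there. *)
  set (eps := Rmin (Re w - 1) (1 / 2)).
  assert (He : 0 < eps) by (apply Rmin_pos; lra).
  assert (E1 : eps <= Re w - 1) by apply Rmin_l.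
  assert (E2 : eps <= 1 / 2) by apply Rmin_r.
  apply (meromorphic_value (fun z w => 1 < Re w /\ 1 < Re (z + w)%C) Z (fun z w => z + w - 2)%C
    cleared_double_zeta (z + 2)%C w z w eps); auto.
  - intros a b a' b' t [H1 H2] [H3 H4] Ht. unfold seg.
    assert (Hc : forall x y, 1 < x -> 1 < y -> 1 < x + t * (y - x)).
    { intros x y Hx Hy. destruct (Req_dec t 0) as [->|]; [lra|]. nra. }
    split.
    + replace (Re (b + RtoC t * (b' - b))%C) with (Re b + t * (Re b' - Re b))
        by (destruct b, b'; simpl; ring). now apply Hc.
    + replace (Re (a + RtoC t * (a' - a) + (b + RtoC t * (b' - b)))%C)
        with (Re (a + b)%C + t * (Re (a' + b')%C - Re (a + b)%C))
        by (destruct a, b, a', b'; simpl; ring). now apply Hc.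
  - intros. apply locana_affine. solve_affine.
  - intros a b [H1 H2]. now apply locana_cleared.
  - split; [exact Hw|]. destruct z, w; simpl in *; lra.
  - intros a b Ha Hb. apply Re_close in Ha, Hb.
    assert (H1 : 1 < Re b) by lra.
    assert (H2 : 2 < Re (a + b)%C) by (destruct a, b, z, w; simpl in *; lra).
    rewrite cleared_double_zeta_eq; [|now apply Re_gt_neq|now apply Re_gt_neq].
    f_equal. apply double_zeta_series; auto.
  - now apply locana_double_zeta_cont.
  - destruct (ana_nonzero z w 1 (2 * 1 + Cmod (z + w - 2)%C) (fun z w => z + w - 2)%C)
      as [d [Hd Hnz]]; [lra| |exact Hne|].
    { apply ana_ext with (fun z' w' => ((z' - z) + (w' - w)) + (z + w - 2))%C; [intros; ring|].
      apply (ana_plus z w 1 ltac:(lra) (2 * 1) _ (fun z' w' => (z' - z) + (w' - w))%C (fun _ _ => (z + w - 2)%C)).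
      - replace (2 * 1) with (1 + 1) by ring.
        apply (ana_plus z w 1 ltac:(lra) 1 1 (fun z' _ => z' - z)%C (fun _ w' => w' - w)%C).
        + apply ana_fst; lra.
        + apply ana_snd; lra.
      - apply ana_const; lra. }
    exists (Rmin d eps). split; [now apply Rmin_pos|].
    intros a b Ha Hb. pose proof (Rmin_l d eps). pose proof (Rmin_r d eps).
    apply cleared_double_zeta_eq.
    + apply Hnz; lra.
    + apply Re_gt_neq. apply Re_close in Hb. lra.
Qed.

(** * The summands as analytic functions of [s] *)

(** The third term is [zeta_cont (s - 1)] times the difference of the prefactors 1/(n+1) and
    1/(s+n-1), with [s - 2] cancelled; it is thus defined at [s = 2] as well. *)
Definition Dn (n : nat) (s : C) : C :=
  (weighted_gap (s - RtoC (INR n) - 2) (RtoC (INR n) + 2) * / RtoC (INR n + 1)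
   - weighted_gap (- RtoC (INR n)) (s + RtoC (INR n)) * / (s + RtoC (INR n) - 1)
   + (s - 1 + tail_gap 1 (s - 1)) * (/ RtoC (INR n + 1) * / (s + RtoC (INR n) - 1)))%C.

Lemma INR_p1_neq (n : nat) : RtoC (INR n + 1) <> RtoC 0.
Proof. intros E. apply RtoC_inj in E. pose proof (pos_INR n). lra. Qed.

Lemma summand_Dn (Z : C -> C -> C) (n : nat) (s : C) :
  is_double_zeta Z -> 1 < Re s -> s <> RtoC 2 -> summand Z n s = Dn n s.
Proof.
  intros HZ Hs Hne.
  pose proof (pos_INR n) as Hn.
  assert (Hne' : (s - 2)%C <> RtoC 0).
  { intros E. apply Hne. replace s with ((s - 2) + 2)%C by ring. rewrite E. ring. }
  unfold summand.
  assert (E1 : (s - RtoC (INR n) - 2 + (RtoC (INR n) + 2))%C = s) by ring.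
  assert (E2 : (- RtoC (INR n) + (s + RtoC (INR n)))%C = s) by ring.
  pose proof (INR_p1_neq n) as H1.
  assert (H2 : (s + RtoC (INR n) - 1)%C <> RtoC 0).
  { apply Re_gt_neq. destruct s; simpl in *; lra. }
  rewrite (double_zeta_value Z (s - RtoC (INR n) - 2)%C (RtoC (INR n) + 2)%C);
    [|exact HZ|simpl; lra|rewrite E1; exact Hs|rewrite E1; exact Hne'].
  rewrite (double_zeta_value Z (- RtoC (INR n))%C (s + RtoC (INR n))%C);
    [|exact HZ|destruct s; simpl in *; lra|rewrite E2; exact Hs|rewrite E2; exact Hne'].
  unfold double_zeta_cont. rewrite E1, E2. unfold zeta_cont, Dn.
  replace (s - 1 - 1)%C with (s - 2)%C by ring.
  replace (RtoC (INR n) + 2 - 1)%C with (RtoC (INR n + 1)) by (rewrite RtoC_plus; ring).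
  assert (E4 : (s + RtoC (INR n) - 1)%C = ((s - 2) + RtoC (INR n + 1))%C)
    by (rewrite RtoC_plus; ring).
  rewrite E4 in H2. rewrite E4.
  generalize (weighted_gap (s - RtoC (INR n) - 2) (RtoC (INR n) + 2))%C
    (weighted_gap (- RtoC (INR n)) (s + RtoC (INR n)))%C (s - 1 + tail_gap 1 (s - 1))%C.
  revert H1 H2 Hne'. clear.
  generalize (RtoC (INR n + 1)) (s - 2)%C. intros a b H1 H2 Hb x y u.
  field. repeat split; auto.
Qed.

Lemma locana_Dn (n : nat) (s w : C) : 1 < Re s -> locana (fun s _ => Dn n s) s w.
Proof.
  intros Hs. pose proof (pos_INR n) as Hn.
  assert (Hinv : locana (fun s _ => / (s + RtoC (INR n) - 1))%C s w).
  { apply (locana_inv_affine (fun s _ => s + RtoC (INR n) - 1)%C); [solve_affine|].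
    apply Re_gt_neq. destruct s; simpl in *; lra. }
  unfold Dn.
  apply (locana_plus (fun s _ => weighted_gap (s - RtoC (INR n) - 2) (RtoC (INR n) + 2) * / RtoC (INR n + 1)
   - weighted_gap (- RtoC (INR n)) (s + RtoC (INR n)) * / (s + RtoC (INR n) - 1))%C
   (fun s _ => (s - 1 + tail_gap 1 (s - 1)) * (/ RtoC (INR n + 1) * / (s + RtoC (INR n) - 1)))%C).
  - apply (locana_minus (fun s _ => weighted_gap (s - RtoC (INR n) - 2) (RtoC (INR n) + 2) * / RtoC (INR n + 1))%C
      (fun s _ => weighted_gap (- RtoC (INR n)) (s + RtoC (INR n)) * / (s + RtoC (INR n) - 1))%C).
    + apply (locana_mult (fun s _ => weighted_gap (s - RtoC (INR n) - 2) (RtoC (INR n) + 2))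
        (fun _ _ => / RtoC (INR n + 1))%C); [|apply locana_const].
      apply (locana_comp weighted_gap (fun s _ => s - RtoC (INR n) - 2)%C (fun _ _ => RtoC (INR n) + 2)%C);
        [|solve_affine..].
      apply locana_weighted_gap; destruct s; simpl in *; lra.
    + apply (locana_mult (fun s _ => weighted_gap (- RtoC (INR n)) (s + RtoC (INR n)))
        (fun s _ => / (s + RtoC (INR n) - 1))%C); [|exact Hinv].
      apply (locana_comp weighted_gap (fun _ _ => - RtoC (INR n))%C (fun s _ => s + RtoC (INR n))%C);
        [|solve_affine..].
      apply locana_weighted_gap; destruct s; simpl in *; lra.
  - apply (locana_mult (fun s _ => s - 1 + tail_gap 1 (s - 1))%C
      (fun s _ => / RtoC (INR n + 1) * / (s + RtoC (INR n) - 1))%C).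
    + apply (locana_plus (fun s _ => s - 1)%C (fun s _ => tail_gap 1 (s - 1))).
      * apply locana_affine. solve_affine.
      * apply (locana_tail_gap_comp (fun s _ => s - 1)%C); [solve_affine|].
        destruct s; simpl in *; lra.
    + apply (locana_mult (fun _ _ => / RtoC (INR n + 1))%C (fun s _ => / (s + RtoC (INR n) - 1))%C);
        [apply locana_const|exact Hinv].
Qed.

Lemma locally_C (z0 : C) (P : C -> Prop) :
  locally z0 P <-> exists eps, 0 < eps /\ forall z, Cmod (z - z0)%C < eps -> P z.
Proof.
  split.
  - intros [eps H]. exists eps. split; [apply cond_pos|]. intros z Hz. apply H.
    apply C_NormedModule_mixin_compat1; assumption.
  - intros [eps [He H]].
    assert (H2 : 0 < sqrt 2) by (apply sqrt_lt_R0; lra).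
    assert (Hd : 0 < eps / sqrt 2) by (apply Rdiv_lt_0_compat; lra).
    exists (mkposreal _ Hd). intros z Hz.
    apply (C_NormedModule_mixin_compat2 z0 z (mkposreal _ Hd)) in Hz. simpl in Hz.
    replace (sqrt 2 * (eps / sqrt 2)) with eps in Hz by (field; lra).
    apply H; assumption.
Qed.

(** Off [s = 2] the formula is exact; at [s = 2] continuity of [Dn] provides the limit. *)
Lemma summand_value_Dn (Z : C -> C -> C) (n : nat) (s : C) :
  is_double_zeta Z -> 1 < Re s -> summand_value Z n s (Dn n s).
Proof.
  intros HZ Hs. split.
  - intros Hne. symmetry. now apply summand_Dn.
  - intros Heq P HP. apply locally_C in HP. destruct HP as [eps [He HP]].
    destruct (locana_Dn n s 0 Hs) as [r [M [Hr Ha]]].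
    destruct (ana_continuous s 0 r M _ eps Hr Ha He) as [d [Hd Hc]].
    apply locally_C. exists (Rmin d (Re s - 1)). split; [apply Rmin_pos; lra|].
    intros y Hy Hne. pose proof (Rmin_l d (Re s - 1)). pose proof (Rmin_r d (Re s - 1)).
    assert (Hre : 1 < Re y) by (apply Re_close in Hy; lra).
    apply HP. rewrite summand_Dn; auto.
    + apply (Hc y 0%C); [lra|]. rewrite Cmod_sub_self. lra.
    + rewrite <- Heq. exact Hne.
Qed.

(** * Norm summability of the summands *)

(** The contribution to [Dn] of the pair (mu, N) with N = M + 1: [mu] is the outer index of the
    double series and [N] the inner one. *)
Definition Dn_term (n mu M : nat) (s : C) : C :=
  (npow mu (- (s - RtoC (INR n) - 2)) * gap M (RtoC (INR n) + 2) * / RtoC (INR n + 1)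
   - npow mu (- - RtoC (INR n)) * gap M (s + RtoC (INR n)) * / (s + RtoC (INR n) - 1))%C.

Definition log_ratio (mu M : nat) : R := ln (INR (S M)) - ln (INR mu).

(** Unlike in [gap_factor], the power taken out is N^(-w) with N = M + 1, ready to combine with the
    power of [mu] into a power of mu/N. *)
Lemma gap_factor_npow (M : nat) (w : C) : (1 <= M)%nat ->
  gap M w = (npow (S M) (- w) *
    ((w - 1) - RtoC (INR (S M)) * (Cexp (RtoC (log_step M) * (w - 1)) - 1)))%C.
Proof.
  intros HM. unfold gap.
  assert (E1 : npow M (1 - w) = (npow (S M) (1 - w) * Cexp (RtoC (log_step M) * (w - 1)))%C).
  { unfold npow, log_step. rewrite <- Cexp_plus. f_equal. rewrite RtoC_minus. ring. }
  assert (E2 : npow (S M) (1 - w) = (RtoC (INR (S M)) * npow (S M) (- w))%C).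
  { unfold Cminus. now rewrite npow_plus, npow_1_r by lia. }
  rewrite E1, E2. ring.
Qed.

Lemma ratio_pow_real (n mu M : nat) (s : C) :
  (npow mu (- (s - RtoC (INR n) - 2)) * npow (S M) (- (RtoC (INR n) + 2)))%C
  = (npow mu (- s) * RtoC (exp (- (INR n + 2) * log_ratio mu M)))%C.
Proof.
  unfold npow, log_ratio. rewrite <- Cexp_R, <- !Cexp_plus. f_equal.
  rewrite RtoC_mult, RtoC_opp, RtoC_plus, RtoC_minus. ring.
Qed.

(** Both halves of [Dn_term] share mu^(-s) (mu/N)^(n+2), where mu/N is exp of minus [log_ratio];
    this one carries the further factor (mu/N)^(s-2). *)
Lemma ratio_pow_complex (n mu M : nat) (s : C) :
  (npow mu (- - RtoC (INR n)) * npow (S M) (- (s + RtoC (INR n))))%C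
  = (npow mu (- s) * RtoC (exp (- (INR n + 2) * log_ratio mu M))
     * Cexp (RtoC (- log_ratio mu M) * (s - 2)))%C.
Proof.
  unfold npow, log_ratio. rewrite <- Cexp_R, <- !Cexp_plus. f_equal.
  rewrite !RtoC_mult, !RtoC_opp, RtoC_plus, RtoC_minus. ring.
Qed.

(* Separates the effect of changing [n + 2] into [n + s] on the power and on the
   comparison with the integral; each part is small of second order. *)
Lemma Dn_term_factor (n mu M : nat) (s : C) : (1 <= M)%nat ->
  (s + RtoC (INR n) - 1)%C <> RtoC 0 ->
  Dn_term n mu M s =
  (npow mu (- s) * RtoC (exp (- (INR n + 2) * log_ratio mu M)) *
   ((1 - Cexp (RtoC (- log_ratio mu M) * (s - 2)))
      * RtoC ((INR n + 1 - INR (S M) * (exp (log_step M * (INR n + 1)) - 1)) / (INR n + 1))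
    + Cexp (RtoC (- log_ratio mu M) * (s - 2)) *
      (RtoC (INR (S M) / (INR n + 1)) * / (s + RtoC (INR n) - 1) *
       (RtoC ((INR n + 1) * exp (log_step M * (INR n + 1)))
          * (Cexp (RtoC (log_step M) * (s - 2)) - 1 - RtoC (log_step M) * (s - 2))
        + RtoC ((INR n + 1) * log_step M * exp (log_step M * (INR n + 1))
            - (exp (log_step M * (INR n + 1)) - 1)) * (s - 2)))))%C.
Proof.
  intros HM Hne. unfold Dn_term. rewrite !gap_factor_npow by exact HM.
  pose proof (INR_p1_neq n) as Hp.
  assert (Hp' : INR n + 1 <> 0) by (pose proof (pos_INR n); lra).
  rewrite !Cmult_assoc, ratio_pow_real, ratio_pow_complex.
  replace (RtoC (INR n) + 2 - 1)%C with (RtoC (INR n + 1)) by (rewrite RtoC_plus; ring).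
  assert (E : (s + RtoC (INR n) - 1)%C = ((s - 2) + RtoC (INR n + 1))%C)
    by (rewrite RtoC_plus; ring).
  rewrite E in Hne. rewrite E.
  replace (RtoC (log_step M) * ((s - 2) + RtoC (INR n + 1)))%C
    with (RtoC (log_step M) * (s - 2) + RtoC (log_step M * (INR n + 1)))%C
    by (rewrite RtoC_mult; ring).
  rewrite <- (RtoC_mult (log_step M)), Cexp_plus, !Cexp_R.
  rewrite !RtoC_div by exact Hp'. rewrite !RtoC_minus, !RtoC_mult, !RtoC_minus.
  revert Hne Hp. clear.
  generalize (npow mu (- s)) (RtoC (exp (- (INR n + 2) * log_ratio mu M)))
    (Cexp (RtoC (- log_ratio mu M) * (s - 2))) (RtoC (INR n + 1)) (RtoC (INR (S M)))
    (RtoC (exp (log_step M * (INR n + 1)))) (Cexp (RtoC (log_step M) * (s - 2)))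
    (RtoC (log_step M)) (s - 2)%C.
  intros. field. now split.
Qed.

Lemma log_ratio_bounds (mu M : nat) : (1 <= mu <= M)%nat -> 0 <= log_ratio mu M.
Proof.
  intros H. unfold log_ratio.
  assert (ln (INR mu) <= ln (INR (S M))); [|lra].
  apply ln_le; [apply lt_0_INR; lia|apply le_INR; lia].
Qed.

(** [K] is the norm of [s - 2]. The first summand comes from 1 - (mu/N)^(s-2), the second from the
    change of the exponent in the integral comparison; [exp 2] bounds exp ((n+1) [log_step M]) when
    n <= M. *)
Definition Dn_term_const (K : R) : R :=
  8 * K * (2 + 4 * exp 2) + 8 * exp 2 * (K * K * exp K + K).

Lemma mult_le_exp (a y : R) : 0 < a -> y <= / a * exp (a * y).
Proof.
  intros Ha. apply (Rmult_le_reg_l a); [exact Ha|].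
  rewrite <- Rmult_assoc, Rinv_r, Rmult_1_l by lra.
  pose proof (exp_ineq1_le (a * y)). lra.
Qed.

(** The budget of the decay rate [x]: a quarter pays for the perturbation [K], a quarter for a
    factor [y] absorbed through [mult_le_exp], and half is kept for summation. *)
Lemma decay_combine (x K y : R) : 0 <= y -> 0 <= K -> 4 * K <= x ->
  exp (- (x + 2) * y) * exp (K * y) * exp (x / 4 * y) <= exp (- (x / 2) * y).
Proof.
  intros Hy HK Hx. rewrite <- !exp_plus. apply exp_le. nra.
Qed.

Section DnNorm.

Variables (s0 w0 : C) (r : R).
Hypothesis Hr : 0 < r.
(** On the disc [sigma] bounds Re s from below, while [K] bounds the norm of [s - 2]. *)
Let sigma := Re s0 - r.
Let K := Cmod (s0 - 2)%C + r.

Lemma norm_s_minus_2_nonneg : 0 <= K.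
Proof. unfold K. pose proof (Cmod_ge_0 (s0 - 2)%C). lra. Qed.

Lemma ana_s_minus_2 : ana s0 w0 r K (fun s _ => s - 2)%C.
Proof. apply (ana_shift s0 w0 r Hr (fun s _ => s) s0). now apply ana_fst. Qed.

Lemma ana_npow_neg (mu : nat) : (1 <= mu)%nat ->
  ana s0 w0 r (Rpower (INR mu) (- sigma)) (fun s _ => npow mu (- s)).
Proof.
  intros H. replace (- sigma) with (Re (- s0)%C + r) by (unfold sigma; destruct s0; simpl; ring).
  apply (ana_npow s0 w0 r Hr mu (- s0)%C r (fun s _ => - s)%C H).
  apply (ana_opp_center s0 w0 r (fun s _ => s)). now apply ana_fst.
Qed.

(** Here s + n - 1 is n + 1 plus s - 2, and the norm of s - 2 is at most half of n + 1, so [ana_inv]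
    applies. *)
Lemma ana_inv_shift (n : nat) : 2 * K <= INR n ->
  ana s0 w0 r (2 / (INR n + 1)) (fun s _ => / (s + RtoC (INR n) - 1))%C.
Proof.
  intros Hn. pose proof (pos_INR n) as Hn0. pose proof norm_s_minus_2_nonneg as HK.
  assert (Hc : INR n + 1 - Cmod (s0 - 2)%C <= Cmod (s0 + RtoC (INR n) - 1)%C).
  { replace (s0 + RtoC (INR n) - 1)%C with (RtoC (INR n + 1) - - (s0 - 2))%C
      by (rewrite RtoC_plus; ring).
    pose proof (Cmod_triangle (RtoC (INR n + 1) - - (s0 - 2))%C (- (s0 - 2))%C) as H.
    replace (RtoC (INR n + 1) - - (s0 - 2) + - (s0 - 2))%C with (RtoC (INR n + 1)) in H by ring.
    rewrite Cmod_opp, (Cmod_R (INR n + 1)), Rabs_pos_eq in H by lra. lra. }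
  apply ana_le with (/ (Cmod (s0 + RtoC (INR n) - 1)%C - r)).
  - unfold K in *. replace (2 / (INR n + 1)) with (/ ((INR n + 1) / 2)) by (field; lra).
    apply Rinv_le_contravar; lra.
  - apply (ana_inv s0 w0 r Hr (s0 + RtoC (INR n) - 1)%C r (fun s _ => s + RtoC (INR n) - 1)%C).
    + apply ana_ext with (fun s _ => s - s0)%C; [intros; ring|]. now apply ana_fst.
    + unfold K in *. lra.
Qed.

Lemma ana_Cexp_q (x : R) (a : R) : 0 <= a -> Rabs x = a ->
  ana s0 w0 r (a * K) (fun s _ => RtoC x * (s - 2))%C.
Proof.
  intros Ha E. rewrite <- E, <- Cmod_R.
  apply (ana_scal s0 w0 r (RtoC x) K (fun s _ => s - 2)%C). apply ana_s_minus_2.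
Qed.

(** The norm is read off factor by factor from [Dn_term_factor]. The assumption n <= mu keeps (n+1)
    [log_step M] bounded; the factor y (n+1) left by the first part, with y = [log_ratio mu M], is
    absorbed by the decay of (mu/N)^(n+2). *)
Lemma ana_Dn_term (n mu M : nat) :
  (1 <= n <= mu)%nat -> (mu <= M)%nat -> 4 * K <= INR n ->
  ana s0 w0 r (Dn_term_const K * Rpower (INR mu) (- sigma) *
      (/ INR (S M) * exp (- (INR n / 2) * log_ratio mu M)))
    (fun s _ => Dn_term n mu M s).
Proof.
  intros Hnmu HmuM HnK. pose proof norm_s_minus_2_nonneg as HK.
  assert (Hn1 : 1 <= INR n) by (apply INR_ge_1; lia).
  assert (HnM : INR n <= INR M) by (apply le_INR; lia).
  assert (HM1 : (1 <= M)%nat) by lia.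
  set (y := log_ratio mu M). set (L := log_step M). set (p := INR n + 1).
  set (N := INR (S M)). set (i := / N). set (X := exp (L * p)).
  assert (Hy : 0 <= y) by (apply log_ratio_bounds; lia).
  destruct (log_step_bounds M HM1) as [L1 L2]. fold L N in L1, L2. fold i in L1.
  destruct (inv_succ_bounds M HM1) as [L3 L4]. fold N in L3. fold i in L3.
  destruct (log_step_error M HM1) as [L5 L6]. fold L N in L5, L6. fold i in L5, L6.
  assert (HN : 0 < N) by (apply lt_0_INR; lia).
  assert (Hi : 0 < i) by now apply Rinv_0_lt_compat.
  assert (HNi : N * i = 1) by (unfold i; field; lra).
  assert (Hp : 2 <= p) by (unfold p; lra).
  (* From n <= M follows p <= 2 M, while [L] is at most 1/M. *)
  assert (HLp : 0 <= L * p <= 2).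
  { split; [apply Rmult_le_pos; lra|].
    apply Rle_trans with (/ INR M * (2 * INR M)).
    - apply Rmult_le_compat; unfold p; try lra.
    - right. field. lra. }
  assert (HX : 1 <= X <= exp 2).
  { unfold X. split; [pose proof (exp_ineq1_le (L * p)); lra|apply exp_le; lra]. }
  assert (HX1 : X - 1 - L * p <= L * p * (L * p) * X) by (apply exp_m2_le; lra).
  assert (HX0 : L * p <= X - 1) by (unfold X; pose proof (exp_ineq1_le (L * p)); lra).
  assert (HX2 : 0 <= p * L * X - (X - 1) <= L * p * (L * p) * X).
  { pose proof (exp_m1_le (L * p) ltac:(lra)) as H1. fold X in H1.
    split; nra. }
  assert (HL2 : L * L <= 4 * (i * i)) by nra.
  assert (HNL2 : N * (L * L) <= 4 * i) by nra.
  set (b := (p - N * (X - 1)) / p).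
  set (u := p * L * X - (X - 1)).
  (* With exp (L p) - 1 split into L p and its quadratic remainder, [b] becomes minus N (L - 1/N),
     of order 1/N, minus a term of order p/N. *)
  assert (Hb : Rabs b <= (2 + 4 * exp 2) * p * i).
  { unfold b.
    replace ((p - N * (X - 1)) / p) with (- (N * (L - i)) - N * (X - 1 - L * p) / p)
      by (unfold i; field; lra).
    assert (A1 : 0 <= N * (L - i) <= 2 * i) by (split; nra).
    assert (A2 : 0 <= N * (X - 1 - L * p) / p <= 4 * exp 2 * p * i).
    { split; [apply Rdiv_le_0_compat; nra|]. apply Rle_div_l; [lra|].
      apply Rle_trans with (N * (L * p * (L * p) * X)); [apply Rmult_le_compat_l; lra|].
      replace (N * (L * p * (L * p) * X)) with (N * (L * L) * (p * p * X)) by ring.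
      replace (4 * exp 2 * p * i * p) with (4 * i * (p * p * exp 2)) by ring.
      apply Rmult_le_compat; try nra. }
    apply Rabs_le. nra. }
  assert (Gq : ana s0 w0 r (y * K) (fun s _ => RtoC (- y) * (s - 2))%C).
  { apply ana_Cexp_q; [exact Hy|]. rewrite Rabs_Ropp. now apply Rabs_pos_eq. }
  assert (Lq : ana s0 w0 r (L * K) (fun s _ => RtoC L * (s - 2))%C).
  { apply ana_Cexp_q; [lra|]. apply Rabs_pos_eq; lra. }
  apply ana_ext with (fun s _ => npow mu (- s) * RtoC (exp (- (INR n + 2) * y)) *
   ((1 - Cexp (RtoC (- y) * (s - 2))) * RtoC b
    + Cexp (RtoC (- y) * (s - 2)) *
      (RtoC (N / p) * / (s + RtoC (INR n) - 1) *
       (RtoC (p * X) * (Cexp (RtoC L * (s - 2)) - 1 - RtoC L * (s - 2)) + RtoC u * (s - 2)))))%C.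
  { intros s w Hs Hw. symmetry. apply Dn_term_factor; [exact HM1|].
    pose proof (ana_bound s0 w0 r _ _ s w ana_s_minus_2 Hs Hw) as Hq. simpl in Hq.
    intros E. assert (E' : (s - 2)%C = RtoC (- (INR n + 1))).
    { rewrite RtoC_opp, RtoC_plus.
      replace (s - 2)%C with ((s + RtoC (INR n) - 1) - (RtoC (INR n) + 1))%C by ring.
      rewrite E. ring. }
    rewrite E', Cmod_R, Rabs_Ropp, Rabs_pos_eq in Hq by lra. lra. }
  apply ana_le with (Rpower (INR mu) (- sigma) * exp (- (INR n + 2) * y) *
    (y * K * exp (y * K) * Rabs b + exp (y * K) *
      (N / p * (2 / p) * (p * X * (L * K * (L * K) * exp (L * K)) + u * K)))).
  (* Both the exponential remainder and [u] are quadratic in [L], and N L^2 is at most 4/N. *)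
  - assert (S3 : N / p * (2 / p) * (p * X * (L * K * (L * K) * exp (L * K)) + u * K)
      <= 8 * exp 2 * (K * K * exp K + K) * i).
    { replace (N / p * (2 / p) * (p * X * (L * K * (L * K) * exp (L * K)) + u * K))
        with (2 * N * (X * (L * L) * (K * K * exp (L * K)) * / p + K * (u / (p * p)))) by (field; lra).
      assert (B1 : u / (p * p) <= L * L * X).
      { apply Rle_div_l; [nra|]. unfold u. nra. }
      assert (B2 : exp (L * K) <= exp K) by (apply exp_le; nra).
      assert (B3 : / p <= 1) by (rewrite <- Rinv_1; apply Rinv_le_contravar; lra).
      assert (B4 : X * (L * L) * (K * K * exp (L * K)) * / p <= X * (L * L) * (K * K * exp K)).
      { rewrite <- (Rmult_1_r (X * (L * L) * (K * K * exp K))).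
        pose proof (exp_pos (L * K)).
        assert (0 < / p) by (apply Rinv_0_lt_compat; lra).
        assert (0 <= X * (L * L)) by nra.
        assert (0 <= K * K * exp (L * K)) by nra.
        apply Rmult_le_compat; try lra; [now apply Rmult_le_pos|].
        apply Rmult_le_compat_l; [assumption|]. apply Rmult_le_compat_l; nra. }
      apply Rle_trans with (2 * N * (X * (L * L) * (K * K * exp K) + K * (L * L * X))).
      - apply Rmult_le_compat_l; [lra|]. apply Rplus_le_compat; [exact B4|].
        apply Rmult_le_compat_l; lra.
      - replace (2 * N * (X * (L * L) * (K * K * exp K) + K * (L * L * X)))
          with (N * (L * L) * (2 * X * (K * K * exp K + K))) by ring.
        replace (8 * exp 2 * (K * K * exp K + K) * i)
          with (4 * i * (2 * exp 2 * (K * K * exp K + K))) by ring.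
        pose proof (exp_pos K).
        assert (0 <= K * K * exp K + K) by nra.
        apply Rmult_le_compat; nra. }
    pose proof (mult_le_exp (INR n / 4) y ltac:(lra)) as Hye.
    set (e4 := exp (INR n / 4 * y)) in *.
    (* [mult_le_exp] with rate n/4 costs 4/n, and p <= 2 n. *)
    assert (Hyp : y * p <= 8 * e4).
    { apply Rle_trans with (/ (INR n / 4) * e4 * (2 * INR n)).
      - apply Rmult_le_compat; unfold p; lra.
      - right. field. lra. }
    assert (He4 : 1 <= e4).
    { unfold e4. pose proof (exp_ineq1_le (INR n / 4 * y)). nra. }
    pose proof (decay_combine (INR n) K y Hy HK HnK) as Hdec. fold e4 in Hdec.
    rewrite (Rmult_comm K y) in Hdec.
    set (eK := exp (y * K)) in *. set (en := exp (- (INR n + 2) * y)) in *.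
    assert (HeK : 0 < eK) by apply exp_pos. assert (Hen : 0 < en) by apply exp_pos.
    pose proof (Rpower_pos (INR mu) (- sigma)) as Hmu.
    set (P := Rpower (INR mu) (- sigma)) in *.
    assert (Hexp2 := exp_pos 2). pose proof (exp_pos K) as HexpK.
    set (Q := N / p * (2 / p) * (p * X * (L * K * (L * K) * exp (L * K)) + u * K)) in *.
    apply Rle_trans with (P * en * (eK * (Dn_term_const K * i * e4))).
    + rewrite !Rmult_assoc. apply Rmult_le_compat_l; [lra|]. apply Rmult_le_compat_l; [lra|].
      replace (y * (K * (eK * Rabs b)) + eK * Q) with (eK * (y * K * Rabs b + Q)) by ring.
      apply Rmult_le_compat_l; [lra|].
      unfold Dn_term_const.
      replace ((8 * K * (2 + 4 * exp 2) + 8 * exp 2 * (K * K * exp K + K)) * (i * e4))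
        with (K * (2 + 4 * exp 2) * i * (8 * e4) + 8 * exp 2 * (K * K * exp K + K) * i * e4) by ring.
      apply Rplus_le_compat.
      * apply Rle_trans with (y * K * ((2 + 4 * exp 2) * p * i)).
        -- apply Rmult_le_compat_l; [nra|exact Hb].
        -- replace (y * K * ((2 + 4 * exp 2) * p * i)) with (K * (2 + 4 * exp 2) * i * (y * p)) by ring.
           apply Rmult_le_compat_l; [|exact Hyp].
           apply Rmult_le_pos; [apply Rmult_le_pos; lra|lra].
      * rewrite <- (Rmult_1_r Q).
        assert (0 <= 8 * exp 2 * (K * K * exp K + K) * i).
        { apply Rmult_le_pos; [|lra]. apply Rmult_le_pos; [lra|]. nra. }
        nra.
    + replace (P * en * (eK * (Dn_term_const K * i * e4)))
        with (Dn_term_const K * P * i * (en * eK * e4)) by ring.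
      replace (Dn_term_const K * P * (i * exp (- (INR n / 2) * y)))
        with (Dn_term_const K * P * i * exp (- (INR n / 2) * y)) by ring.
      apply Rmult_le_compat_l; [|exact Hdec].
      apply Rmult_le_pos; [|lra]. apply Rmult_le_pos; [|lra].
      unfold Dn_term_const. apply Rplus_le_le_0_compat; repeat apply Rmult_le_pos; nra.
  - assert (C1 : forall x, 0 <= x -> Cmod (RtoC x) = x)
      by (intros x Hx; rewrite Cmod_R; now apply Rabs_pos_eq).
    assert (ana_r : forall x, ana s0 w0 r (Rabs x) (fun _ _ => RtoC x)).
    { intros x. rewrite <- Cmod_R. now apply ana_const. }
    assert (ana_rp : forall x, 0 <= x -> ana s0 w0 r x (fun _ _ => RtoC x)).
    { intros x Hx. rewrite <- (C1 x Hx) at 1. now apply ana_const. }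
    assert (Gexp : ana s0 w0 r (exp (y * K)) (fun s _ => Cexp (RtoC (- y) * (s - 2)))).
    { now apply (ana_exp s0 w0 r Hr _ (fun s _ => RtoC (- y) * (s - 2))%C). }
    apply (ana_mult s0 w0 r Hr _ _ (fun s _ => npow mu (- s) * RtoC (exp (- (INR n + 2) * y)))%C
      (fun s _ => (1 - Cexp (RtoC (- y) * (s - 2))) * RtoC b
    + Cexp (RtoC (- y) * (s - 2)) *
      (RtoC (N / p) * / (s + RtoC (INR n) - 1) *
       (RtoC (p * X) * (Cexp (RtoC L * (s - 2)) - 1 - RtoC L * (s - 2)) + RtoC u * (s - 2))))%C).
    + apply (ana_mult s0 w0 r Hr _ _ (fun s _ => npow mu (- s)) (fun _ _ => RtoC (exp (- (INR n + 2) * y)))).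
      * apply ana_npow_neg. lia.
      * apply ana_rp. left. apply exp_pos.
    + apply (ana_plus s0 w0 r Hr _ _ (fun s _ => (1 - Cexp (RtoC (- y) * (s - 2))) * RtoC b)%C
        (fun s _ => Cexp (RtoC (- y) * (s - 2)) *
      (RtoC (N / p) * / (s + RtoC (INR n) - 1) *
       (RtoC (p * X) * (Cexp (RtoC L * (s - 2)) - 1 - RtoC L * (s - 2)) + RtoC u * (s - 2))))%C).
      * apply (ana_mult s0 w0 r Hr _ _ (fun s _ => 1 - Cexp (RtoC (- y) * (s - 2)))%C (fun _ _ => RtoC b));
          [|apply ana_r].
        apply ana_ext with (fun s _ => - (Cexp (RtoC (- y) * (s - 2)) - 1))%C; [intros; ring|].
        apply ana_opp. now apply (ana_exp_m1 s0 w0 r Hr (y * K) (fun s _ => RtoC (- y) * (s - 2))%C).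
      * apply (ana_mult s0 w0 r Hr _ _ (fun s _ => Cexp (RtoC (- y) * (s - 2)))
          (fun s _ => RtoC (N / p) * / (s + RtoC (INR n) - 1) *
       (RtoC (p * X) * (Cexp (RtoC L * (s - 2)) - 1 - RtoC L * (s - 2)) + RtoC u * (s - 2)))%C);
          [exact Gexp|].
        apply (ana_mult s0 w0 r Hr _ _ (fun s _ => RtoC (N / p) * / (s + RtoC (INR n) - 1))%C
          (fun s _ => RtoC (p * X) * (Cexp (RtoC L * (s - 2)) - 1 - RtoC L * (s - 2)) + RtoC u * (s - 2))%C).
        -- apply (ana_mult s0 w0 r Hr _ _ (fun _ _ => RtoC (N / p)) (fun s _ => / (s + RtoC (INR n) - 1))%C).
           ++ apply ana_rp. apply Rdiv_le_0_compat; lra.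
           ++ apply ana_inv_shift. lra.
        -- apply (ana_plus s0 w0 r Hr _ _
             (fun s _ => RtoC (p * X) * (Cexp (RtoC L * (s - 2)) - 1 - RtoC L * (s - 2)))%C
             (fun s _ => RtoC u * (s - 2))%C).
           ++ apply (ana_mult s0 w0 r Hr _ _ (fun _ _ => RtoC (p * X))
                (fun s _ => Cexp (RtoC L * (s - 2)) - 1 - RtoC L * (s - 2))%C).
              ** apply ana_rp. nra.
              ** now apply (ana_exp_m2 s0 w0 r Hr (L * K) (fun s _ => RtoC L * (s - 2))%C).
           ++ apply (ana_mult s0 w0 r Hr _ _ (fun _ _ => RtoC u) (fun s _ => s - 2)%C).
              ** apply ana_rp. unfold u. lra.
              ** apply ana_s_minus_2.
Qed.

Definition Dn_coef (n mu : nat) (s : C) : C :=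
  (npow mu (- (s - RtoC (INR n) - 2)) * tail_gap mu (RtoC (INR n) + 2) * / RtoC (INR n + 1)
   - npow mu (- - RtoC (INR n)) * tail_gap mu (s + RtoC (INR n)) * / (s + RtoC (INR n) - 1))%C.

Lemma Cser_Dn_coef (n mu : nat) (s : C) : (1 <= mu)%nat -> 1 < Re s ->
  Cser (fun k => Dn_term n mu (mu + k) s) (Dn_coef n mu s).
Proof.
  intros Hmu Hs. pose proof (pos_INR n).
  assert (H1 := Cser_tail_gap mu (RtoC (INR n) + 2)%C Hmu ltac:(simpl; lra)).
  assert (H2 := Cser_tail_gap mu (s + RtoC (INR n))%C Hmu ltac:(destruct s; simpl in *; lra)).
  apply (Cser_scal (npow mu (- (s - RtoC (INR n) - 2)) * / RtoC (INR n + 1))%C) in H1.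
  apply (Cser_scal (npow mu (- - RtoC (INR n)) * / (s + RtoC (INR n) - 1))%C) in H2.
  pose proof (Cser_minus _ _ _ _ H1 H2) as H3.
  unfold Dn_coef, Dn_term.
  replace (npow mu (- (s - RtoC (INR n) - 2)) * tail_gap mu (RtoC (INR n) + 2) * / RtoC (INR n + 1)
   - npow mu (- - RtoC (INR n)) * tail_gap mu (s + RtoC (INR n)) * / (s + RtoC (INR n) - 1))%C
  with (npow mu (- (s - RtoC (INR n) - 2)) * / RtoC (INR n + 1) * tail_gap mu (RtoC (INR n) + 2)
   - npow mu (- - RtoC (INR n)) * / (s + RtoC (INR n) - 1) * tail_gap mu (s + RtoC (INR n)))%C by ring.
  eapply Cser_ext; [|exact H3]. intros k. simpl. ring.
Qed.

(** The terms are mu^p N^(-p-1) with N = mu + k + 1, so the integral bound of the tail gives 1/p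
    independently of [mu]. With [p] proportional to [n], each such summation gains a factor 1/n. *)
Lemma Series_ratio_decay (mu : nat) (p : R) : (1 <= mu)%nat -> 0 < p ->
  ex_series (fun k => / INR (S (mu + k)) * exp (- p * log_ratio mu (mu + k))) /\
  Series (fun k => / INR (S (mu + k)) * exp (- p * log_ratio mu (mu + k))) <= / p.
Proof.
  intros Hmu Hp.
  destruct (Series_Rpower_tail mu p Hmu Hp) as [Hex Hle].
  assert (E : forall k, / INR (S (mu + k)) * exp (- p * log_ratio mu (mu + k))
    = Rpower (INR mu) p * Rpower (INR (S (mu + k))) (- p - 1)).
  { intros k. assert (HS : 0 < INR (S (mu + k))) by (apply lt_0_INR; lia).
    unfold Rminus. rewrite Rpower_plus, (Rpower_Ropp _ 1), Rpower_1 by exact HS.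
    replace (exp (- p * log_ratio mu (mu + k))) with (Rpower (INR mu) p * Rpower (INR (S (mu + k))) (- p)).
    - ring.
    - unfold Rpower, log_ratio. rewrite <- exp_plus. f_equal. ring. }
  split.
  - eapply ex_series_ext; [intros k; symmetry; apply E|].
    now apply (ex_series_scal_l (V := R_NormedModule)).
  - rewrite (Series_ext _ _ E), Series_scal_l.
    apply Rle_trans with (Rpower (INR mu) p * (Rpower (INR mu) (- p) / p)).
    + apply Rmult_le_compat_l; [left; apply Rpower_pos|exact Hle].
    + right. unfold Rdiv. rewrite <- Rmult_assoc, <- Rpower_plus, Rplus_opp_r, Rpower_O; [ring|].
      apply lt_0_INR. lia.
Qed.

Hypothesis Hsigma : 1 < sigma.

Lemma Re_in_disc (s : C) : Cmod (s - s0)%C <= r -> 1 < Re s.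
Proof.
  intros H. pose proof (re_le_Cmod (s - s0)%C) as Hre. apply Rabs_le_between in Hre.
  unfold sigma in Hsigma. destruct s, s0. simpl in *. lra.
Qed.

Lemma Dn_term_const_nonneg : 0 <= Dn_term_const K.
Proof.
  pose proof norm_s_minus_2_nonneg. pose proof (exp_pos 2). pose proof (exp_pos K).
  unfold Dn_term_const. apply Rplus_le_le_0_compat; repeat apply Rmult_le_pos; nra.
Qed.

Lemma ana_Dn_coef_large (n mu : nat) : (1 <= n <= mu)%nat -> 4 * K <= INR n ->
  ana s0 w0 r (2 * Dn_term_const K * (Rpower (INR mu) (- sigma) / INR n)) (fun s _ => Dn_coef n mu s).
Proof.
  intros Hn HK.
  assert (Hn1 : 1 <= INR n) by (apply INR_ge_1; lia).
  destruct (Series_ratio_decay mu (INR n / 2)) as [Hex Hle]; [lia|lra|].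
  apply ana_le with (Series (fun k => Dn_term_const K * Rpower (INR mu) (- sigma) *
      (/ INR (S (mu + k)) * exp (- (INR n / 2) * log_ratio mu (mu + k))))).
  - rewrite Series_scal_l.
    replace (2 * Dn_term_const K * (Rpower (INR mu) (- sigma) / INR n))
      with (Dn_term_const K * Rpower (INR mu) (- sigma) * / (INR n / 2)) by (field; lra).
    apply Rmult_le_compat_l; [|exact Hle].
    apply Rmult_le_pos; [apply Dn_term_const_nonneg|left; apply Rpower_pos].
  - apply ana_series with (fun k s _ => Dn_term n mu (mu + k) s); [exact Hr| | |].
    + intros k. apply ana_Dn_term; auto; lia.
    + now apply (ex_series_scal_l (V := R_NormedModule)).
    + intros s w Hs _. apply Cser_Dn_coef; [lia|now apply Re_in_disc].
Qed.

(** Undoes the integral comparison: the main parts of the two [npow_tail] differ by mu^(1-s) (s-2) /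
    ((n+1) (s+n-1)), and the original power sums remain. This form needs no relation between [n] and
    [mu]. *)
Lemma Dn_coef_split (n mu : nat) (s : C) : (1 <= mu)%nat -> 1 < Re s ->
  Cser (fun k => npow mu (- s) * RtoC (exp (- (INR n + 2) * log_ratio mu (mu + k)))
      * (1 - Cexp (RtoC (- log_ratio mu (mu + k)) * (s - 2))))%C
    (Dn_coef n mu s + npow mu (- s) * (RtoC (INR mu / (INR n + 1)) *
       (/ (s + RtoC (INR n) - 1) * (s - 2))))%C.
Proof.
  intros Hmu Hs. pose proof (pos_INR n) as Hn.
  assert (H1 := Cser_npow_tail mu (RtoC (INR n) + 2)%C Hmu ltac:(simpl; lra)).
  assert (H2 := Cser_npow_tail mu (s + RtoC (INR n))%C Hmu ltac:(destruct s; simpl in *; lra)).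
  apply (Cser_scal (npow mu (- (s - RtoC (INR n) - 2)))) in H1.
  apply (Cser_scal (npow mu (- - RtoC (INR n)))) in H2.
  pose proof (Cser_minus _ _ _ _ H1 H2) as H3. cbv beta in H3.
  pose proof (INR_p1_neq n) as Hp.
  assert (Hp' : INR n + 1 <> 0) by lra.
  assert (Hne : (s + RtoC (INR n) - 1)%C <> RtoC 0).
  { apply Re_gt_neq. destruct s; simpl in *; lra. }
  assert (F1 : (npow mu (- (s - RtoC (INR n) - 2)) * npow mu (1 - (RtoC (INR n) + 2)))%C
    = (RtoC (INR mu) * npow mu (- s))%C).
  { rewrite <- (npow_1_r mu Hmu). rewrite <- !npow_plus. f_equal. ring. }
  assert (F2 : (npow mu (- - RtoC (INR n)) * npow mu (1 - (s + RtoC (INR n))))%C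
    = (RtoC (INR mu) * npow mu (- s))%C).
  { rewrite <- (npow_1_r mu Hmu). rewrite <- !npow_plus. f_equal. ring. }
  match goal with |- Cser _ ?l => assert (E : l =
    (npow mu (- (s - RtoC (INR n) - 2)) * npow_tail mu (RtoC (INR n) + 2) -
      npow mu (- - RtoC (INR n)) * npow_tail mu (s + RtoC (INR n)))%C) end.
  { unfold Dn_coef, npow_tail.
    replace (RtoC (INR n) + 2 - 1)%C with (RtoC (INR n + 1)) by (rewrite RtoC_plus; ring).
    unfold Cdiv. rewrite !Cmult_assoc, !Cmult_plus_distr_l, F1, F2.
    rewrite RtoC_div by exact Hp'.
    assert (E : (s + RtoC (INR n) - 1)%C = ((s - 2) + RtoC (INR n + 1))%C)
      by (rewrite RtoC_plus; ring).
    rewrite E in Hne. rewrite E. revert Hne Hp. clear.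
    generalize (npow mu (- (s - RtoC (INR n) - 2))) (tail_gap mu (RtoC (INR n) + 2))
      (RtoC (INR n + 1)) (npow mu (- - RtoC (INR n))) (tail_gap mu (s + RtoC (INR n)))
      (RtoC (INR mu)) (npow mu (- s)) (s - 2)%C.
    intros. field. now split. }
  rewrite E. eapply Cser_ext; [|exact H3].
  intros k. cbv beta. rewrite ratio_pow_real, ratio_pow_complex. ring.
Qed.

(** Both parts of [Dn_coef_split] have order mu/n^2: the power sums contribute [8 K] and the main
    part [2 K]. *)
Lemma ana_Dn_coef_small (n mu : nat) : (1 <= n)%nat -> (1 <= mu)%nat -> 4 * K <= INR n ->
  ana s0 w0 r (10 * K * (Rpower (INR mu) (- sigma) * INR mu / (INR n * INR n)))
    (fun s _ => Dn_coef n mu s).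
Proof.
  intros Hn Hmu HK. pose proof norm_s_minus_2_nonneg as HK0.
  assert (Hn1 : 1 <= INR n) by (apply INR_ge_1; lia).
  assert (Hmu1 : 1 <= INR mu) by (apply INR_ge_1; lia).
  set (P := Rpower (INR mu) (- sigma)).
  assert (HP : 0 < P) by apply Rpower_pos.
  assert (HA : ana s0 w0 r (8 * K * (P * INR mu / (INR n * INR n)))
    (fun s _ => Dn_coef n mu s + npow mu (- s) * (RtoC (INR mu / (INR n + 1)) *
       (/ (s + RtoC (INR n) - 1) * (s - 2))))%C).
  { destruct (Series_ratio_decay mu (INR n / 2)) as [Hex Hle]; [lia|lra|].
    (* The 4/n pays for absorbing [y] into exp (n y / 4). The factor [mu] belongs to mu/N = exp
       (-y), taken from the spare powers to supply the 1/N of [Series_ratio_decay], whose rate n/2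
       gives the remaining 2/n. *)
    set (c := P * (K * (4 / INR n) * INR mu)).
    assert (Hc : 0 <= c).
    { unfold c. apply Rmult_le_pos; [lra|]. apply Rmult_le_pos; [|lra].
      apply Rmult_le_pos; [lra|]. apply Rdiv_le_0_compat; lra. }
    apply ana_le with (Series (fun k => c *
      (/ INR (S (mu + k)) * exp (- (INR n / 2) * log_ratio mu (mu + k))))).
    - rewrite Series_scal_l.
      replace (8 * K * (P * INR mu / (INR n * INR n))) with (c * / (INR n / 2)) by (unfold c; field; lra).
      apply Rmult_le_compat_l; [exact Hc|exact Hle].
    - apply ana_series with (fun k s _ => npow mu (- s) * RtoC (exp (- (INR n + 2) * log_ratio mu (mu + k)))
      * (1 - Cexp (RtoC (- log_ratio mu (mu + k)) * (s - 2))))%C; [exact Hr| | |].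
      + intros k. set (y := log_ratio mu (mu + k)).
        assert (Hy : 0 <= y) by (apply log_ratio_bounds; lia).
        assert (HS : 0 < INR (S (mu + k))) by (apply lt_0_INR; lia).
        apply ana_le with (P * exp (- (INR n + 2) * y) * (y * K * exp (y * K))).
        * unfold c. rewrite !Rmult_assoc. apply Rmult_le_compat_l; [lra|].
          pose proof (mult_le_exp (INR n / 4) y ltac:(lra)) as Hye.
          assert (Hi : INR mu * / INR (S (mu + k)) = exp (- y)).
          { unfold y, log_ratio. rewrite Ropp_minus_distr. unfold Rminus.
            rewrite exp_plus, exp_Ropp, !exp_ln by lra. reflexivity. }
          replace (K * (4 / INR n * (INR mu * (/ INR (S (mu + k)) * exp (- (INR n / 2) * y)))))
            with (K * (4 / INR n) * ((INR mu * / INR (S (mu + k))) * exp (- (INR n / 2) * y))) by ring.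
          rewrite Hi.
          assert (Hd : exp (- (INR n + 2) * y) * exp (y * K) * exp (INR n / 4 * y)
            <= exp (- y) * exp (- (INR n / 2) * y)).
          { rewrite <- !exp_plus. apply exp_le. nra. }
          replace (exp (- (INR n + 2) * y) * (y * (K * exp (y * K))))
            with (K * (exp (- (INR n + 2) * y) * exp (y * K) * y)) by ring.
          rewrite (Rmult_assoc K (4 / INR n)). apply Rmult_le_compat_l; [exact HK0|].
          replace (/ (INR n / 4)) with (4 / INR n) in Hye by (field; lra).
          apply Rle_trans with (exp (- (INR n + 2) * y) * exp (y * K) * (4 / INR n * exp (INR n / 4 * y))).
          -- apply Rmult_le_compat_l; [|exact Hye].
             apply Rmult_le_pos; left; apply exp_pos.
          -- replace (exp (- (INR n + 2) * y) * exp (y * K) * (4 / INR n * exp (INR n / 4 * y)))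
               with (4 / INR n * (exp (- (INR n + 2) * y) * exp (y * K) * exp (INR n / 4 * y))) by ring.
             apply Rmult_le_compat_l; [apply Rdiv_le_0_compat; lra|exact Hd].
        * apply (ana_mult s0 w0 r Hr _ _ (fun s _ => npow mu (- s) * RtoC (exp (- (INR n + 2) * y)))%C
            (fun s _ => 1 - Cexp (RtoC (- y) * (s - 2)))%C).
          -- apply (ana_mult s0 w0 r Hr _ _ (fun s _ => npow mu (- s)) (fun _ _ => RtoC (exp (- (INR n + 2) * y)))).
             ++ now apply ana_npow_neg.
             ++ pose proof (ana_const s0 w0 r Hr (RtoC (exp (- (INR n + 2) * y)))) as H.
                rewrite Cmod_R, Rabs_pos_eq in H by (left; apply exp_pos). exact H.
          -- apply ana_ext with (fun s _ => - (Cexp (RtoC (- y) * (s - 2)) - 1))%C; [intros; ring|].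
             apply ana_opp. apply (ana_exp_m1 s0 w0 r Hr (y * K) (fun s _ => RtoC (- y) * (s - 2))%C).
             apply ana_Cexp_q; [exact Hy|]. rewrite Rabs_Ropp. now apply Rabs_pos_eq.
      + now apply (ex_series_scal_l (V := R_NormedModule)).
      + intros s w Hs _. apply Dn_coef_split; [lia|now apply Re_in_disc]. }
  assert (HB : ana s0 w0 r (2 * K * (P * INR mu / (INR n * INR n)))
    (fun s _ => npow mu (- s) * (RtoC (INR mu / (INR n + 1)) *
       (/ (s + RtoC (INR n) - 1) * (s - 2))))%C).
  { apply ana_le with (P * (INR mu / (INR n + 1) * (2 / (INR n + 1) * K))).
    - replace (P * (INR mu / (INR n + 1) * (2 / (INR n + 1) * K)))
        with (2 * K * P * INR mu * / ((INR n + 1) * (INR n + 1))) by (field; lra).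
      replace (2 * K * (P * INR mu / (INR n * INR n)))
        with (2 * K * P * INR mu * / (INR n * INR n)) by (field; lra).
      apply Rmult_le_compat_l; [repeat apply Rmult_le_pos; lra|].
      apply Rinv_le_contravar; nra.
    - apply (ana_mult s0 w0 r Hr _ _ (fun s _ => npow mu (- s))
        (fun s _ => RtoC (INR mu / (INR n + 1)) * (/ (s + RtoC (INR n) - 1) * (s - 2)))%C).
      + now apply ana_npow_neg.
      + apply (ana_mult s0 w0 r Hr _ _ (fun _ _ => RtoC (INR mu / (INR n + 1)))
          (fun s _ => / (s + RtoC (INR n) - 1) * (s - 2))%C).
        * pose proof (ana_const s0 w0 r Hr (RtoC (INR mu / (INR n + 1)))) as H.
          rewrite Cmod_R, Rabs_pos_eq in H by (apply Rdiv_le_0_compat; lra). exact H.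
        * apply (ana_mult s0 w0 r Hr _ _ (fun s _ => / (s + RtoC (INR n) - 1))%C (fun s _ => s - 2)%C).
          -- apply ana_inv_shift. lra.
          -- apply ana_s_minus_2. }
  replace (10 * K * (P * INR mu / (INR n * INR n)))
    with (8 * K * (P * INR mu / (INR n * INR n)) + 2 * K * (P * INR mu / (INR n * INR n))) by ring.
  eapply ana_ext; [|apply (ana_minus s0 w0 r Hr _ _ _ _ HA HB)]. intros; simpl; ring.
Qed.

(** The right side is 1/n times (mu/n)^eps, which is at least 1 when n <= mu and at least mu/n when
    mu <= n. *)
Lemma Rpower_interpolate (mu n eps : R) : 0 < mu -> 0 < n -> 0 <= eps <= 1 ->
  (n <= mu -> / n <= Rpower mu eps * Rpower n (- (1 + eps))) /\
  (mu <= n -> mu / (n * n) <= Rpower mu eps * Rpower n (- (1 + eps))).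
Proof.
  intros Hmu Hn He.
  assert (E : Rpower n (- (1 + eps)) = / n * Rpower n (- eps)).
  { replace (- (1 + eps)) with (- (1) + - eps) by ring.
    now rewrite Rpower_plus, (Rpower_Ropp n 1), Rpower_1. }
  assert (E2 : Rpower mu eps * Rpower n (- eps) = exp (eps * (ln mu - ln n))).
  { unfold Rpower. rewrite <- exp_plus. f_equal. ring. }
  assert (Hi : 0 < / n) by now apply Rinv_0_lt_compat.
  split; intros H.
  - rewrite E. replace (Rpower mu eps * (/ n * Rpower n (- eps)))
      with (/ n * (Rpower mu eps * Rpower n (- eps))) by ring.
    rewrite E2. rewrite <- (Rmult_1_r (/ n)) at 1. apply Rmult_le_compat_l; [lra|].
    rewrite <- exp_0. apply exp_le. pose proof (ln_le n mu Hn H). nra.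
  - rewrite E. replace (Rpower mu eps * (/ n * Rpower n (- eps)))
      with (/ n * (Rpower mu eps * Rpower n (- eps))) by ring.
    rewrite E2. replace (mu / (n * n)) with (/ n * (mu / n)) by (field; lra).
    apply Rmult_le_compat_l; [lra|].
    replace (mu / n) with (exp (ln mu - ln n)).
    + apply exp_le. pose proof (ln_le mu n Hmu H). nra.
    + unfold Rminus, Rdiv. now rewrite exp_plus, exp_Ropp, !exp_ln.
Qed.

Lemma ana_Dn_coef (n mu : nat) (eps : R) :
  (1 <= n)%nat -> (1 <= mu)%nat -> 4 * K <= INR n -> 0 <= eps <= 1 ->
  ana s0 w0 r ((2 * Dn_term_const K + 10 * K) *
      (Rpower (INR mu) (- (sigma - eps)) * Rpower (INR n) (- (1 + eps))))
    (fun s _ => Dn_coef n mu s).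
Proof.
  intros Hn Hmu HK He. pose proof norm_s_minus_2_nonneg as HK0. pose proof Dn_term_const_nonneg as HD.
  assert (Hn1 : 1 <= INR n) by (apply INR_ge_1; lia).
  assert (Hmu1 : 1 <= INR mu) by (apply INR_ge_1; lia).
  replace (- (sigma - eps)) with (- sigma + eps) by ring. rewrite Rpower_plus.
  destruct (Rpower_interpolate (INR mu) (INR n) eps) as [I1 I2]; [lra..|].
  pose proof (Rpower_pos (INR mu) (- sigma)) as HP.
  set (P := Rpower (INR mu) (- sigma)) in *.
  set (Q := Rpower (INR mu) eps * Rpower (INR n) (- (1 + eps))) in *.
  assert (HQ : 0 < Q) by (apply Rmult_lt_0_compat; apply Rpower_pos).
  replace (P * Rpower (INR mu) eps * Rpower (INR n) (- (1 + eps))) with (P * Q) by (unfold Q; ring).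
  destruct (le_lt_dec n mu) as [Hle|Hlt].
  - apply ana_le with (2 * Dn_term_const K * (P / INR n)); [|apply ana_Dn_coef_large; auto].
    specialize (I1 (le_INR _ _ Hle)).
    assert (P / INR n <= P * Q) by (apply Rmult_le_compat_l; lra).
    assert (0 <= P * Q) by nra. nra.
  - apply ana_le with (10 * K * (P * INR mu / (INR n * INR n))); [|now apply ana_Dn_coef_small].
    assert (Hle : INR mu <= INR n) by (apply le_INR; lia). specialize (I2 Hle).
    assert (P * INR mu / (INR n * INR n) <= P * Q).
    { unfold Rdiv in *. rewrite Rmult_assoc. apply Rmult_le_compat_l; lra. }
    assert (0 <= P * Q) by nra. nra.
Qed.

Lemma Cser_Dn (n : nat) (s : C) : 1 < Re s ->
  Cser (fun m => Dn_coef n (S m) s)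
    (Dn n s - (s - 1 + tail_gap 1 (s - 1)) * (/ RtoC (INR n + 1) * / (s + RtoC (INR n) - 1)))%C.
Proof.
  intros Hs. pose proof (pos_INR n).
  assert (H1 := Cser_weighted_gap (s - RtoC (INR n) - 2)%C (RtoC (INR n) + 2)%C
    ltac:(simpl; lra) ltac:(destruct s; simpl in *; lra)).
  assert (H2 := Cser_weighted_gap (- RtoC (INR n))%C (s + RtoC (INR n))%C
    ltac:(destruct s; simpl in *; lra) ltac:(destruct s; simpl in *; lra)).
  apply (Cser_scal (/ RtoC (INR n + 1))%C) in H1.
  apply (Cser_scal (/ (s + RtoC (INR n) - 1))%C) in H2.
  pose proof (Cser_minus _ _ _ _ H1 H2) as H3.
  match type of H3 with Cser _ ?l => match goal with |- Cser _ ?l' => replace l' with l end end.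
  - eapply Cser_ext; [|exact H3]. intros m. unfold Dn_coef. ring.
  - unfold Dn. ring.
Qed.

(** The constants depend on the disc only. The sum over [mu] of the interpolated bounds gives the
    first part; the term left over in [Cser_Dn] is of order n^(-2). *)
Lemma ana_Dn : exists Cst eps : R, 0 < eps /\ 0 <= Cst /\
  forall n : nat, (1 <= n)%nat -> 4 * K <= INR n ->
    ana s0 w0 r (Cst * Rpower (INR n) (- (1 + eps))) (fun s _ => Dn n s).
Proof.
  pose proof norm_s_minus_2_nonneg as HK0. pose proof Dn_term_const_nonneg as HD.
  (* [eps <= 1] is the range of the interpolation and lets n^(-2) be absorbed;
     [eps <= (sigma - 1) / 2] keeps sigma - eps above 1. *)
  set (eps := Rmin 1 ((sigma - 1) / 2)).
  assert (He : 0 < eps) by (apply Rmin_pos; lra).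
  assert (E1 : eps <= 1) by apply Rmin_l. assert (E2 : eps <= (sigma - 1) / 2) by apply Rmin_r.
  assert (Hp : 0 < Re (s0 - 1)%C - r) by (unfold sigma in Hsigma; destruct s0; simpl in *; lra).
  assert (Hs1 : ana s0 w0 r r (fun s _ => s - 1 - (s0 - 1))%C).
  { apply ana_ext with (fun s _ => s - s0)%C; [intros; ring|]. now apply ana_fst. }
  pose proof (ana_tail_gap s0 w0 r 1 (fun s _ => s - 1)%C (s0 - 1)%C r Hr ltac:(lia) Hs1 Hp) as HT.
  assert (Hs2 : ana s0 w0 r (Cmod (s0 - 1)%C + r) (fun s _ => s - 1)%C).
  { apply (ana_shift s0 w0 r Hr (fun s _ => s) s0 1). now apply ana_fst. }
  pose proof (ana_plus s0 w0 r Hr _ _ _ _ Hs2 HT) as HM0.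
  set (M0 := Cmod (s0 - 1)%C + r + _) in HM0.
  assert (HM0p : 0 <= M0) by exact (ana_nonneg s0 w0 r Hr _ _ HM0).
  set (S0 := Series (fun m => Rpower (INR (S m)) (- (sigma - eps)))).
  assert (Hex : ex_series (fun m => Rpower (INR (S m)) (- (sigma - eps)))) by (apply ex_series_Rpower; lra).
  assert (HS0 : 0 <= S0).
  { eapply Rle_trans; [|apply (sum_n_le_Series _ 0); [intros; left; apply Rpower_pos|exact Hex]].
    rewrite Rsum_0. left. apply Rpower_pos. }
  set (C2 := 2 * Dn_term_const K + 10 * K).
  exists (C2 * S0 + 2 * M0), eps. split; [exact He|]. split; [unfold C2; nra|].
  intros n Hn HKn.
  assert (Hn1 : 1 <= INR n) by (apply INR_ge_1; lia).
  set (Rn := Rpower (INR n) (- (1 + eps))).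
  assert (HA : ana s0 w0 r (C2 * S0 * Rn) (fun s _ => Dn n s
    - (s - 1 + tail_gap 1 (s - 1)) * (/ RtoC (INR n + 1) * / (s + RtoC (INR n) - 1)))%C).
  { replace (C2 * S0 * Rn) with (Series (fun m => C2 * Rn * Rpower (INR (S m)) (- (sigma - eps)))).
    - apply ana_series with (fun m s _ => Dn_coef n (S m) s); [exact Hr| | |].
      + intros m. replace (C2 * Rn * Rpower (INR (S m)) (- (sigma - eps)))
          with (C2 * (Rpower (INR (S m)) (- (sigma - eps)) * Rn)) by ring.
        apply ana_Dn_coef; auto; [lia|lra].
      + now apply (ex_series_scal_l (V := R_NormedModule)).
      + intros s w Hs _. apply Cser_Dn. now apply Re_in_disc.
    - rewrite Series_scal_l. fold S0. ring. }
  assert (HB : ana s0 w0 r (2 * M0 * Rn) (fun s _ =>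
    (s - 1 + tail_gap 1 (s - 1)) * (/ RtoC (INR n + 1) * / (s + RtoC (INR n) - 1)))%C).
  { apply ana_le with (M0 * (/ (INR n + 1) * (2 / (INR n + 1)))).
    - assert (/ (INR n + 1) * (/ (INR n + 1)) <= Rn).
      { unfold Rn. apply Rle_trans with (Rpower (INR n) (- (2))).
        - rewrite Rpower_Ropp. rewrite <- Rinv_mult. apply Rinv_le_contravar.
          + apply Rpower_pos.
          + replace 2 with (1 + 1) by ring. rewrite Rpower_plus, Rpower_1 by lra. nra.
        - apply Rle_Rpower; lra. }
      unfold Rdiv. nra.
    - apply (ana_mult s0 w0 r Hr _ _ (fun s _ => s - 1 + tail_gap 1 (s - 1))%C
        (fun s _ => / RtoC (INR n + 1) * / (s + RtoC (INR n) - 1))%C); [exact HM0|].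
      apply (ana_mult s0 w0 r Hr _ _ (fun _ _ => / RtoC (INR n + 1))%C
        (fun s _ => / (s + RtoC (INR n) - 1))%C).
      + pose proof (ana_const s0 w0 r Hr (/ RtoC (INR n + 1))%C) as H.
        rewrite Cmod_inv, Cmod_R, Rabs_pos_eq in H by (lra || apply INR_p1_neq). exact H.
      + apply ana_inv_shift. lra. }
  replace ((C2 * S0 + 2 * M0) * Rn) with (C2 * S0 * Rn + 2 * M0 * Rn) by ring.
  eapply ana_ext; [|apply (ana_plus s0 w0 r Hr _ _ _ _ HA HB)]. intros; simpl; ring.
Qed.

End DnNorm.

(** * Normal convergence of the series of summands *)

Definition Dn_sum (s : C) : C := CSeries (fun n => Dn n s).

(** The uniform bound holds for [n] large compared with the disc. The finitely many other summands
    are only known to be locally analytic, so the radius is shrunk to suit them all. *)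
Lemma Dn_sum_analytic (s0 w0 : C) : 1 < Re s0 ->
  Cser (fun n => Dn n s0) (Dn_sum s0) /\ locana (fun s _ => Dn_sum s) s0 w0.
Proof.
  intros Hs.
  set (r0 := (Re s0 - 1) / 2).
  assert (Hr0 : 0 < r0) by (unfold r0; lra).
  destruct (ana_Dn s0 w0 r0 Hr0 ltac:(unfold r0; lra)) as [Cst [eps [He [HC HDn]]]].
  (* Every n > n0 satisfies the largeness condition of [ana_Dn]. *)
  destruct (nfloor_ex (4 * (Cmod (s0 - 2)%C + r0))) as [n0 Hn0].
  { pose proof (Cmod_ge_0 (s0 - 2)%C). lra. }
  assert (Hfin : exists r, 0 < r <= r0 /\ forall n, (n <= n0)%nat ->
    exists M, ana s0 w0 r M (fun s _ => Dn n s)).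
  { clear Hn0. induction n0 as [|n0 [r [Hr IH]]].
    - destruct (locana_Dn 0 s0 w0 Hs) as [r [M [Hr H]]].
      exists (Rmin r r0). split; [split; [now apply Rmin_pos|apply Rmin_r]|].
      intros n Hn. replace n with 0%nat by lia. exists M. apply ana_shrink with r; [|exact H].
      split; [now apply Rmin_pos|apply Rmin_l].
    - destruct (locana_Dn (S n0) s0 w0 Hs) as [r' [M [Hr' H]]].
      exists (Rmin r r'). split.
      { split; [apply Rmin_pos; lra|]. pose proof (Rmin_l r r'). lra. }
      intros n Hn. destruct (Nat.eq_dec n (S n0)) as [->|Hne].
      + exists M. apply ana_shrink with r'; [|exact H].
        split; [apply Rmin_pos; lra|apply Rmin_r].
      + destruct (IH n ltac:(lia)) as [M' H']. exists M'. apply ana_shrink with r; [|exact H'].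
        split; [apply Rmin_pos; lra|apply Rmin_l]. }
  destruct Hfin as [r [Hr Hfin]].
  assert (Hall : forall n, exists M, ana s0 w0 r M (fun s _ => Dn n s) /\
    ((n0 < n)%nat -> M = Cst * Rpower (INR n) (- (1 + eps)))).
  { intros n. destruct (le_lt_dec n n0) as [Hle|Hlt].
    - destruct (Hfin n Hle) as [M H]. exists M. split; [exact H|lia].
    - exists (Cst * Rpower (INR n) (- (1 + eps))). split; [|reflexivity].
      apply ana_shrink with r0; [exact Hr|]. apply HDn; [lia|].
      assert (INR n0 + 1 <= INR n) by (rewrite <- S_INR; apply le_INR; lia). lra. }
  destruct (functional_choice _ Hall) as [M HM].
  assert (Hex : ex_series M).
  { apply (ex_series_incr_n M (S n0)).
    apply ex_series_ext with (fun k => Cst * Rpower (INR (S (n0 + k))) (- (1 + eps))).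
    - intros k. symmetry. apply HM. simpl. lia.
    - apply (ex_series_scal_l (V := R_NormedModule)).
      pose proof (ex_series_Rpower (1 + eps) ltac:(lra)) as H.
      now apply (ex_series_incr_n (fun m => Rpower (INR (S m)) (- (1 + eps))) n0) in H. }
  assert (Hser : forall s w, Cmod (s - s0)%C <= r -> Cmod (w - w0)%C <= r ->
    Cser (fun n => Dn n s) (Dn_sum s)).
  { intros s w Hs' Hw'. apply Cser_CSeries with M; [|exact Hex].
    intros n. apply (ana_bound s0 w0 r (M n) (fun s _ => Dn n s) s w); auto. apply HM. }
  split.
  - apply (Hser s0 w0); rewrite Cmod_sub_self; lra.
  - exists r, (Series M). split; [lra|].
    apply ana_series with (fun n s _ => Dn n s); [lra|apply HM|exact Hex|exact Hser].
Qed.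

(** * The identity in the half-plane [Re s > 5] *)

(** The upper index is excluded, so that empty sums exist: [sum_n] always contains the term 0, which
    does not suit rows [i < k] of a strict triangle. *)
Fixpoint psum (f : nat -> C) (n : nat) : C :=
  match n with O => RtoC 0 | S n => (psum f n + f n)%C end.

Lemma psum_sum_n (f : nat -> C) (n : nat) : sum_n f n = psum f (S n) :> C.
Proof.
  induction n as [|n IH]; [rewrite Csum_0; simpl; ring|]. rewrite Csum_Sn, IH. reflexivity.
Qed.

Lemma psum_S (f : nat -> C) (n : nat) : psum f (S n) = (psum f n + f n)%C.
Proof. reflexivity. Qed.

Lemma psum_ext (f g : nat -> C) (n : nat) :
  (forall i, (i < n)%nat -> f i = g i) -> psum f n = psum g n.
Proof.
  induction n as [|n IH]; intros H; simpl; [reflexivity|].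
  rewrite IH, (H n); auto.
Qed.

Lemma psum_plus (f g : nat -> C) (n : nat) :
  psum (fun i => f i + g i)%C n = (psum f n + psum g n)%C.
Proof. induction n as [|n IH]; simpl; [ring|rewrite IH; ring]. Qed.

Lemma psum_scal (c : C) (f : nat -> C) (n : nat) :
  psum (fun i => c * f i)%C n = (c * psum f n)%C.
Proof. induction n as [|n IH]; simpl; [ring|rewrite IH; ring]. Qed.

Lemma psum_first (f : nat -> C) (n : nat) :
  psum f (S n) = (f 0%nat + psum (fun i => f (S i)) n)%C.
Proof. induction n as [|n IH]; [simpl; ring|]. simpl in *. rewrite IH. ring. Qed.

Lemma psum_rev (g : nat -> C) (K : nat) :
  psum (fun i => g (K - i)%nat) K = psum (fun j => g (S j)) K.
Proof.
  induction K as [|K IH]; [reflexivity|].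
  rewrite psum_first. simpl (S K - 0)%nat. simpl (psum (fun j => g (S j)) (S K)).
  rewrite <- IH, Cplus_comm. reflexivity.
Qed.

Lemma psum_Cmod (f : nat -> C) (b : nat -> R) (A c : R) (n : nat) :
  (forall i, 0 <= b i) -> ex_series b -> 0 <= A ->
  (forall i, (i < n)%nat -> Cmod (f i) <= A * b i + c) ->
  Cmod (psum f n) <= A * Series b + INR n * c.
Proof.
  intros Hb Hex HA H.
  assert (HS : forall n, sum_n b n <= Series b) by (intros; now apply sum_n_le_Series).
  destruct n as [|n].
  - simpl. rewrite Cmod_0. assert (0 <= Series b); [|nra].
    eapply Rle_trans; [|apply (HS 0%nat)]. rewrite Rsum_0. apply Hb.
  - rewrite <- psum_sum_n. eapply Rle_trans; [apply Csum_Cmod|].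
    eapply Rle_trans; [apply (Rsum_le _ (fun i => A * b i + c)); intros; apply H; lia|].
    rewrite Rsum_plus, Rsum_mult_l, sum_n_const.
    apply Rplus_le_compat_r. apply Rmult_le_compat_l; [exact HA|apply HS].
Qed.

Lemma Clim_psum (u : nat -> nat -> C) (v : nat -> C) (n : nat) :
  (forall i, (i < n)%nat -> Clim (fun K => u K i) (v i)) ->
  Clim (fun K => psum (u K) n) (psum v n).
Proof.
  induction n as [|n IH]; intros H; simpl.
  - apply Clim_const.
  - apply Clim_plus; [apply IH; auto|apply H; lia].
Qed.

(** * Telescoping of the triangular sum through harmonic numbers *)

Fixpoint harmonic (n : nat) : R :=
  match n with O => 0 | S n => harmonic n + / INR (S n) end.

Lemma harmonic_diff (n j : nat) : 0 <= harmonic (n + j) - harmonic n <= INR j * / INR (S n).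
Proof.
  induction j as [|j IH].
  - rewrite Nat.add_0_r. simpl. lra.
  - rewrite Nat.add_succ_r.
    change (harmonic (S (n + j))) with (harmonic (n + j) + / INR (S (n + j))).
    assert (H1 : 0 < INR (S n)) by (apply lt_0_INR; lia).
    assert (H2 : INR (S n) <= INR (S (n + j))) by (apply le_INR; lia).
    assert (H3 : / INR (S (n + j)) <= / INR (S n)) by (apply Rinv_le_contravar; lra).
    assert (H4 : 0 < / INR (S (n + j))) by (apply Rinv_0_lt_compat; lra).
    rewrite (S_INR j). lra.
Qed.

Lemma psum_inv_rev (K : nat) :
  psum (fun i => RtoC (/ INR (K - i))) K = RtoC (harmonic K).
Proof.
  rewrite (psum_rev (fun j => RtoC (/ INR j))).
  induction K as [|K IH]; [reflexivity|].
  change (psum (fun j => RtoC (/ INR (S j))) (S K))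
    with (psum (fun j => RtoC (/ INR (S j))) K + RtoC (/ INR (S K)))%C.
  rewrite IH, <- RtoC_plus. reflexivity.
Qed.

(** Collecting the coefficient of [f i]: the column of differences telescopes to [harmonic (K - 1 -
    i) - harmonic K + harmonic (S i)], and the subtracted row k = i removes [harmonic i]. The
    induction on [K] adds one row at a time. *)
Lemma triangle_sum_harmonic (f : nat -> C) (K : nat) :
  psum (fun k => psum (fun i => f i * RtoC (/ INR (k - i) - / INR (S k)) - f k * RtoC (/ INR (k - i)))%C k) K
  = psum (fun i => f i * RtoC (/ INR (S i) - (harmonic K - harmonic (K - 1 - i))))%C K.
Proof.
  induction K as [|K IH]; [reflexivity|].
  rewrite !psum_S, IH.
  assert (E1 : psum (fun i => f i * RtoC (/ INR (K - i) - / INR (S K)) - f K * RtoC (/ INR (K - i)))%C K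
    = (psum (fun i => f i * RtoC (/ INR (K - i) - / INR (S K)))%C K - f K * RtoC (harmonic K))%C).
  { rewrite <- psum_inv_rev, <- (psum_scal (f K)).
    replace (psum (fun i => f i * RtoC (/ INR (K - i) - / INR (S K)))%C K -
      psum (fun i => f K * RtoC (/ INR (K - i)))%C K)%C
    with (psum (fun i => f i * RtoC (/ INR (K - i) - / INR (S K)))%C K +
      (-(1)) * psum (fun i => f K * RtoC (/ INR (K - i)))%C K)%C by ring.
    rewrite <- psum_scal, <- psum_plus. apply psum_ext. intros i _. ring. }
  rewrite E1.
  (* In the new entry i = K the index [S K - 1 - K] is 0 and 1/(K+1) cancels, leaving the
     contribution of the new row. *)
  assert (E3 : (f K * RtoC (/ INR (S K) - (harmonic (S K) - harmonic (S K - 1 - K))))%C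
    = (- (f K * RtoC (harmonic K)))%C).
  { replace (S K - 1 - K)%nat with 0%nat by lia.
    change (harmonic (S K)) with (harmonic K + / INR (S K)). simpl (harmonic 0).
    rewrite !RtoC_minus, RtoC_plus. ring. }
  rewrite E3.
  match goal with |- (?a + (?b - ?x))%C = _ => replace (a + (b - x))%C with ((a + b) + - x)%C by ring end.
  f_equal. rewrite <- psum_plus.
  apply psum_ext. intros i Hi.
  replace (S K - 1 - i)%nat with (K - i)%nat by lia.
  change (harmonic (S K)) with (harmonic K + / INR (S K)).
  assert (E2 : harmonic (K - i) = harmonic (K - 1 - i) + / INR (K - i)).
  { replace (K - i)%nat with (S (K - 1 - i)) by lia. reflexivity. }
  rewrite E2, <- Cmult_plus_distr_l, <- RtoC_plus. do 2 f_equal. ring.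
Qed.

(** The correction [harmonic K - harmonic (K - 1 - i)] consists of i + 1 terms at most 1/(K - i): it
    vanishes as [K] grows and never exceeds i + 1. This is why the hypothesis weights [f i] by
    [INR (S i)]. *)
Lemma triangle_sum_limit (f : nat -> C) (b : nat -> R) (l : C) :
  (forall i, Cmod (f i) * INR (S i) <= b i) -> ex_series b ->
  Cser (fun i => f i * RtoC (/ INR (S i)))%C l ->
  Clim (fun K => psum (fun k => psum (fun i =>
    f i * RtoC (/ INR (k - i) - / INR (S k)) - f k * RtoC (/ INR (k - i)))%C k) K) l.
Proof.
  intros Hb Hex Hl.
  set (u := fun K i => if (i <? K)%nat then
    (f i * RtoC (/ INR (S i) - (harmonic K - harmonic (K - 1 - i))))%C else RtoC 0).
  assert (Hh : forall K i, (i < K)%nat ->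
    0 <= harmonic K - harmonic (K - 1 - i) <= INR (S i) * / INR (K - i)).
  { intros K i Hi. pose proof (harmonic_diff (K - 1 - i) (S i)) as H.
    replace (K - 1 - i + S i)%nat with K in H by lia.
    now replace (S (K - 1 - i)) with (K - i)%nat in H by lia. }
  apply Clim_ext with (fun K => psum (u K) K).
  { intros K. rewrite triangle_sum_harmonic. apply psum_ext. intros i Hi. unfold u.
    destruct (Nat.ltb_spec i K); [reflexivity|lia]. }
  apply (Tannery u (fun i => f i * RtoC (/ INR (S i)))%C _ l b).
  - intros K i. specialize (Hb i). pose proof (Cmod_ge_0 (f i)) as Hf.
    assert (HS : 1 <= INR (S i)) by (apply INR_ge_1; lia).
    unfold u. destruct (Nat.ltb_spec i K) as [Hi|]; [|rewrite Cmod_0; nra].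
    rewrite Cmod_mult, Cmod_R. eapply Rle_trans; [|exact Hb].
    apply Rmult_le_compat_l; [exact Hf|].
    destruct (Hh K i Hi) as [H1 H2].
    assert (0 < / INR (S i) <= 1).
    { split; [apply Rinv_0_lt_compat; lra|rewrite <- Rinv_1; apply Rinv_le_contravar; lra]. }
    assert (H3 : / INR (K - i) <= 1).
    { rewrite <- Rinv_1. apply Rinv_le_contravar; [lra|]. apply INR_ge_1. lia. }
    apply Rabs_le. nra.
  - exact Hex.
  (* With K = n + S i the condition i < K holds and K - i is [S n]. *)
  - intros i. apply (is_lim_seq_incr_n _ (S i)).
    apply (is_lim_seq_le_le (fun _ => 0) _ (fun n => Cmod (f i) * INR (S i) * / INR (S n))).
    + intros n. split; [apply Cmod_ge_0|]. unfold u.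
      destruct (Nat.ltb_spec i (n + S i)) as [Hi|]; [|lia].
      replace (f i * RtoC (/ INR (S i) - (harmonic (n + S i) - harmonic (n + S i - 1 - i)))
        - f i * RtoC (/ INR (S i)))%C
        with (f i * RtoC (- (harmonic (n + S i) - harmonic (n + S i - 1 - i))))%C
        by (rewrite RtoC_minus, RtoC_opp; ring).
      destruct (Hh _ _ Hi) as [H1 H2]. replace (n + S i - i)%nat with (S n) in H2 by lia.
      rewrite Cmod_mult, Cmod_R, Rabs_Ropp, Rabs_pos_eq, Rmult_assoc by exact H1.
      apply Rmult_le_compat_l; [apply Cmod_ge_0|exact H2].
    + apply is_lim_seq_const.
    + replace 0 with (Cmod (f i) * INR (S i) * 0) by ring.
      apply (is_lim_seq_scal_l _ _ 0).
      apply (is_lim_seq_incr_1 (fun n => / INR n)).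
      apply (is_lim_seq_inv INR p_infty); [apply is_lim_seq_INR|discriminate].
  - intros K. destruct K as [|K].
    + simpl. assert (E := Cser_finite (u 0%nat) 0 (fun k _ => eq_refl)).
      rewrite Csum_0 in E. exact E.
    + rewrite <- psum_sum_n. apply Cser_finite. intros k Hk. unfold u.
      destruct (Nat.ltb_spec k (S K)); [lia|reflexivity].
  - exact Hl.
Qed.

Lemma sum_n_strict_triangle (g : nat -> C) (N K : nat) :
  sum_n (fun j => if ((1 <=? j) && (j <? N))%nat%bool then g j else RtoC 0) K
  = psum (fun i => g (S i)) (Nat.min K (N - 1)) :> C.
Proof.
  induction K as [|K IH].
  - rewrite Csum_0. reflexivity.
  - rewrite Csum_Sn, IH.
    destruct (Nat.leb_spec 1 (S K)), (Nat.ltb_spec (S K) N); try lia; simpl andb; cbv iota.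
    + rewrite (Nat.min_l K), (Nat.min_l (S K)) by lia. reflexivity.
    + rewrite (Nat.min_r K), (Nat.min_r (S K)) by lia. cring.
Qed.

(** The order of summation is switched so that the larger index is outermost, and both indices are
    lowered by one to start at 0. *)
Lemma dsum_strict_triangle (g : nat -> nat -> C) (K : nat) :
  dsum (fun m N => if ((1 <=? m) && (m <? N))%nat%bool then g m N else RtoC 0) K
  = psum (fun k => psum (fun i => g (S i) (S k)) k) K :> C.
Proof.
  unfold dsum. rewrite sum_n_switch.
  rewrite (sum_n_ext_loc _ (fun N => psum (fun i => g (S i) N) (N - 1))).
  - rewrite psum_sum_n, psum_first. simpl (psum _ (0 - 1)). rewrite Cplus_0_l.
    apply psum_ext. intros k _. simpl. now rewrite Nat.sub_0_r.
  - intros N HN. rewrite sum_n_strict_triangle. f_equal. lia.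
Qed.

(** * Summation over [n] first, for large Re s *)

Definition ratio (i k : nat) : R := INR (S i) / INR (S k).

(** The term of the 0-th summand at m = i + 1, N = k + 1; passing to the n-th summand multiplies it
    by (m/N)^n. *)
Definition head_term (s : C) (i k : nat) : C :=
  (npow (S i) (2 - s) * npow (S k) (- 2) - npow (S k) (- s))%C.

Lemma ratio_pow (n i k : nat) :
  (npow (S i) (RtoC (INR n)) * npow (S k) (- RtoC (INR n)))%C = RtoC (ratio i k ^ n).
Proof.
  assert (Hi : 0 < INR (S i)) by (apply lt_0_INR; lia).
  assert (Hk : 0 < INR (S k)) by (apply lt_0_INR; lia).
  rewrite <- RtoC_opp, !npow_R, <- RtoC_mult. f_equal.
  rewrite Rpower_Ropp, !Rpower_pow by assumption.
  unfold ratio, Rdiv. rewrite Rpow_mult_distr, pow_inv by lra. reflexivity.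
Qed.

(** For Re s > 2 both double series of the summand converge absolutely, so their partial sums over
    squares may be subtracted term by term. *)
Lemma Cser_Dn_triangle (Z : C -> C -> C) (n : nat) (s : C) :
  is_double_zeta Z -> 2 < Re s ->
  Cser (fun k => psum (fun i => RtoC (ratio i k ^ n) * head_term s i k)%C k) (Dn n s).
Proof.
  intros HZ Hs. pose proof (pos_INR n) as Hn.
  assert (Hne : s <> RtoC 2) by (intros ->; simpl in Hs; lra).
  rewrite <- (summand_Dn Z n s HZ) by (lra || assumption). unfold summand.
  destruct HZ as [_ Hser].
  destruct (Hser (s - RtoC (INR n) - 2)%C (RtoC (INR n) + 2)%C) as [_ H1];
    [destruct s; simpl in *; lra|simpl; lra|].
  destruct (Hser (- RtoC (INR n))%C (s + RtoC (INR n))%C) as [_ H2];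
    [destruct s; simpl in *; lra|destruct s; simpl in *; lra|].
  apply Clim_filterlim in H1, H2.
  pose proof (Clim_minus _ _ _ _ H1 H2) as H.
  assert (H' : Clim (psum (fun k => psum (fun i => RtoC (ratio i k ^ n) * head_term s i k)%C k))
    (Z (s - RtoC (INR n) - 2) (RtoC (INR n) + 2) - Z (- RtoC (INR n)) (s + RtoC (INR n)))%C).
  { eapply Clim_ext; [|exact H]. intros K. cbv beta.
    change (dsum (double_zeta_term (s - RtoC (INR n) - 2) (RtoC (INR n) + 2)) K -
      dsum (double_zeta_term (- RtoC (INR n)) (s + RtoC (INR n))) K =
      psum (fun k => psum (fun i => RtoC (ratio i k ^ n) * head_term s i k)%C k) K)%C.
    unfold double_zeta_term. rewrite !dsum_strict_triangle.
    match goal with |- (?a - ?b)%C = _ => replace (a - b)%C with (a + (-(1)) * b)%C by ring end.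
    rewrite <- psum_scal, <- psum_plus. apply psum_ext. intros k _.
    rewrite <- psum_scal, <- psum_plus. apply psum_ext. intros i _.
    rewrite <- ratio_pow. unfold head_term.
    replace (- (s - RtoC (INR n) - 2))%C with (RtoC (INR n) + (2 - s))%C by ring.
    replace (- (RtoC (INR n) + 2))%C with (- RtoC (INR n) + - 2)%C by ring.
    replace (- (s + RtoC (INR n)))%C with (- RtoC (INR n) + - s)%C by ring.
    replace (- - RtoC (INR n))%C with (RtoC (INR n)) by ring.
    rewrite !npow_plus. ring. }
  (* [sum_n] includes its last index and [psum] does not; a shift by one aligns them. *)
  apply (Clim_incr_n _ _ 1) in H'. eapply Clim_ext; [|exact H'].
  intros K. simpl. now rewrite psum_sum_n.
Qed.

Definition geom_term (s : C) (i k : nat) : C := (head_term s i k * / RtoC (1 - ratio i k))%C.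

Lemma ratio_lt_1 (i k : nat) : (i < k)%nat -> 0 < ratio i k < 1.
Proof.
  intros H. unfold ratio.
  assert (Hi : 0 < INR (S i)) by (apply lt_0_INR; lia).
  assert (Hk : INR (S i) < INR (S k)) by (apply lt_INR; lia).
  split; [apply Rdiv_lt_0_compat; lra|]. apply Rlt_div_l; lra.
Qed.

Lemma sum_ratio_pow (s : C) (i k P : nat) : (i < k)%nat ->
  sum_n (fun n => RtoC (ratio i k ^ n) * head_term s i k)%C P
  = (RtoC (1 - ratio i k ^ S P) * geom_term s i k)%C :> C.
Proof.
  intros Hik. pose proof (ratio_lt_1 i k Hik) as Hq. unfold geom_term.
  assert (Hne : RtoC (1 - ratio i k) <> RtoC 0) by (intros E; apply RtoC_inj in E; lra).
  rewrite RtoC_minus in *.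
  induction P as [|P IH].
  - rewrite Csum_0, RtoC_minus. simpl pow. rewrite Rmult_1_r. field. exact Hne.
  - rewrite Csum_Sn, IH, !RtoC_minus. simpl pow. rewrite !RtoC_mult. field. exact Hne.
Qed.

(** Partial fractions: with m = i + 1 and N = k + 1, m / (N (N - m)) = 1/(N - m) - 1/N. *)
Lemma geom_term_eq (s : C) (i k : nat) : (i < k)%nat ->
  geom_term s i k = (npow (S i) (1 - s) * RtoC (/ INR (k - i) - / INR (S k))
    - npow (S k) (1 - s) * RtoC (/ INR (k - i)))%C.
Proof.
  intros Hik. unfold geom_term, head_term.
  assert (Hi : 0 < INR (S i)) by (apply lt_0_INR; lia).
  assert (Hk : 0 < INR (S k)) by (apply lt_0_INR; lia).
  assert (Hd : 0 < INR (k - i)) by (apply lt_0_INR; lia).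
  assert (E : INR (k - i) = INR (S k) - INR (S i)).
  { rewrite <- minus_INR by lia. f_equal. }
  assert (F1 : npow (S k) (- 2)%C = RtoC (/ (INR (S k) * INR (S k)))).
  { rewrite npow_R. replace (-2) with (- (2)) by ring. rewrite Rpower_Ropp. do 2 f_equal.
    replace 2 with (1 + 1) by ring. now rewrite Rpower_plus, Rpower_1. }
  assert (F2 : npow (S k) (- s)%C = (RtoC (/ INR (S k)) * npow (S k) (1 - s))%C).
  { unfold Cminus. rewrite npow_plus, npow_1_r, Cmult_assoc, <- RtoC_mult, Rinv_l by (lia || lra). ring. }
  assert (F3 : npow (S i) (2 - s)%C = (RtoC (INR (S i)) * npow (S i) (1 - s))%C).
  { replace (2 - s)%C with (1 + (1 - s))%C by ring. now rewrite npow_plus, npow_1_r by lia. }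
  rewrite F1, F2, F3.
  replace (1 - ratio i k) with (INR (k - i) * / INR (S k)) by (unfold ratio; rewrite E; field; lra).
  rewrite <- RtoC_inv by (apply Rmult_integral_contrapositive_currified; [|apply Rinv_neq_0_compat]; lra).
  set (v := / (INR (k - i) * / INR (S k))).
  assert (A1 : / INR (k - i) - / INR (S k) = INR (S i) * (/ (INR (S k) * INR (S k)) * v))
    by (unfold v; rewrite E in *; field; lra).
  assert (A2 : / INR (k - i) = / INR (S k) * v) by (unfold v; field; lra).
  rewrite A1, A2, !RtoC_mult. ring.
Qed.

(** With m = i + 1 and N = k + 1, both m and N - m are at least 1, hence N/(N - m) <= 2 m: the
    geometric factor costs one power of m, which is bounded by N in the second term. *)
Lemma geom_term_bound (s : C) (i k : nat) : (i < k)%nat ->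
  Cmod (geom_term s i k) <= 2 * Rpower (INR (S k)) (- 2) * Rpower (INR (S i)) (- (Re s - 3))
    + 2 * Rpower (INR (S k)) (1 - Re s).
Proof.
  intros Hik. unfold geom_term, head_term.
  assert (Hi : 1 <= INR (S i)) by (apply INR_ge_1; lia).
  assert (Hik' : INR (S i) + 1 <= INR (S k)) by (rewrite <- S_INR; apply le_INR; lia).
  pose proof (ratio_lt_1 i k Hik) as Hq.
  assert (Hne : RtoC (1 - ratio i k) <> RtoC 0) by (intros E; apply RtoC_inj in E; lra).
  rewrite Cmod_mult, Cmod_inv, Cmod_R, Rabs_pos_eq by (lra || exact Hne).
  assert (H1 : / (1 - ratio i k) <= 2 * INR (S i)).
  { unfold ratio. replace (1 - INR (S i) / INR (S k)) with ((INR (S k) - INR (S i)) / INR (S k)) by (field; lra).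
    rewrite Rinv_div. apply Rle_div_l; [lra|]. nra. }
  assert (H2 : Cmod (npow (S i) (2 - s) * npow (S k) (- 2) - npow (S k) (- s))%C
    <= Rpower (INR (S i)) (2 - Re s) * Rpower (INR (S k)) (- 2) + Rpower (INR (S k)) (- Re s)).
  { eapply Rle_trans; [apply Cmod_minus_le|]. rewrite Cmod_mult, !Cmod_npow.
    destruct s. right. reflexivity. }
  assert (H3 : 0 < / (1 - ratio i k)) by (apply Rinv_0_lt_compat; lra).
  eapply Rle_trans; [apply Rmult_le_compat; [apply Cmod_ge_0|lra|exact H2|exact H1]|].
  replace (- (Re s - 3)) with ((2 - Re s) + 1) by ring.
  replace (1 - Re s) with (- Re s + 1) by ring.
  rewrite (Rpower_plus (2 - Re s) 1), (Rpower_plus (- Re s) 1), !Rpower_1 by lra.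
  pose proof (Rpower_pos (INR (S k)) (- Re s)).
  assert (Rpower (INR (S k)) (- Re s) * INR (S i) <= Rpower (INR (S k)) (- Re s) * INR (S k))
    by (apply Rmult_le_compat_l; lra).
  lra.
Qed.

(** Truncating the sum over [n] at [P] gives rows with weights 1 - (m/N)^(P+1); [Tannery] in [P]
    replaces the weights by 1, and [triangle_sum_limit] with f i = m^(1-s), m = i + 1, evaluates the
    result. *)
Lemma Cser_Dn_half_plane (Z : C -> C -> C) (s : C) : is_double_zeta Z -> 5 < Re s ->
  Cser (fun n => Dn n s) (zeta_cont s).
Proof.
  intros HZ Hs.
  set (b := fun i => Rpower (INR (S i)) (- (Re s - 3))).
  assert (Hb : ex_series b) by (apply ex_series_Rpower; lra).
  assert (Hbp : forall i, 0 <= b i) by (intros; left; apply Rpower_pos).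
  assert (HSb : 0 <= Series b).
  { eapply Rle_trans; [|apply (sum_n_le_Series _ 0 Hbp Hb)]. rewrite Rsum_0. apply Hbp. }
  assert (Hv : Cser (fun k => psum (fun i => geom_term s i k) k) (zeta_cont s)).
  { assert (H : Clim (psum (fun k => psum (fun i => geom_term s i k) k)) (zeta_cont s)).
    { apply Clim_ext with (fun K => psum (fun k => psum (fun i =>
        npow (S i) (1 - s) * RtoC (/ INR (k - i) - / INR (S k))
        - npow (S k) (1 - s) * RtoC (/ INR (k - i)))%C k) K).
      - intros K. apply psum_ext. intros k _. apply psum_ext. intros i Hi. symmetry.
        now apply geom_term_eq.
      - apply (triangle_sum_limit (fun i => npow (S i) (1 - s)) (fun i => Rpower (INR (S i)) (- (Re s - 2)))).
        + intros i. assert (Hi : 0 < INR (S i)) by (apply lt_0_INR; lia).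
          rewrite Cmod_npow. rewrite <- (Rpower_1 (INR (S i)) Hi) at 2. rewrite <- Rpower_plus.
          right. f_equal. destruct s; simpl; ring.
        + apply ex_series_Rpower. lra.
        + eapply Cser_ext; [|apply (Cser_zeta s); lra]. intros i. cbv beta.
          assert (Hi : 0 < INR (S i)) by (apply lt_0_INR; lia).
          unfold Cminus. rewrite npow_plus, npow_1_r by lia.
          rewrite (Cmult_comm (RtoC _)), <- Cmult_assoc, <- RtoC_mult, Rinv_r by lra. ring. }
    apply (Clim_incr_n _ _ 1) in H. eapply Clim_ext; [|exact H].
    intros K. simpl. now rewrite psum_sum_n. }
  (* The dominating sequence is [geom_term_bound] summed over the row: Re s > 5 makes the powers of
     m summable, and the k terms N^(1 - Re s) add up to at most N^(-2). *)
  apply (Tannery (fun P k => psum (fun i => RtoC (1 - ratio i k ^ S P) * geom_term s i k)%C k)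
    (fun k => psum (fun i => geom_term s i k) k) _ _
    (fun k => (2 * Series b + 2) * Rpower (INR (S k)) (- 2))).
  - intros P k.
    assert (Hk : 1 <= INR (S k)) by (apply INR_ge_1; lia).
    eapply Rle_trans; [apply (psum_Cmod _ b (2 * Rpower (INR (S k)) (- 2)) (2 * Rpower (INR (S k)) (1 - Re s)))|].
    + exact Hbp.
    + exact Hb.
    + pose proof (Rpower_pos (INR (S k)) (- 2)). lra.
    + intros i Hi. rewrite Cmod_mult, Cmod_R.
      pose proof (ratio_lt_1 i k Hi) as Hq.
      assert (Hp : 0 <= ratio i k ^ S P <= 1).
      { split; [apply pow_le; lra|]. rewrite <- (pow1 (S P)). apply pow_incr. lra. }
      rewrite Rabs_pos_eq by lra.
      eapply Rle_trans; [|apply (geom_term_bound s i k Hi)].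
      pose proof (Cmod_ge_0 (geom_term s i k)). nra.
    + assert (INR k * Rpower (INR (S k)) (1 - Re s) <= Rpower (INR (S k)) (- 2)).
      { apply Rle_trans with (INR (S k) * Rpower (INR (S k)) (1 - Re s)).
        - apply Rmult_le_compat_r; [left; apply Rpower_pos|apply le_INR; lia].
        - rewrite <- (Rpower_1 (INR (S k))) at 1 by lra. rewrite <- Rpower_plus.
          apply Rle_Rpower; lra. }
      nra.
  - apply (ex_series_scal_l (V := R_NormedModule)).
    apply ex_series_ext with (fun k => Rpower (INR (S k)) (- (2))).
    + intros k. now replace (-2) with (- (2)) by ring.
    + apply ex_series_Rpower. lra.
  - intros k. apply (Clim_psum (fun P i => RtoC (1 - ratio i k ^ S P) * geom_term s i k)%C
      (fun i => geom_term s i k)).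
    intros i Hi. pose proof (ratio_lt_1 i k Hi) as Hq.
    apply Clim_squeeze with (fun P => ratio i k ^ S P * Cmod (geom_term s i k)).
    + intros P. replace (RtoC (1 - ratio i k ^ S P) * geom_term s i k - geom_term s i k)%C
        with (RtoC (- (ratio i k ^ S P)) * geom_term s i k)%C
        by (rewrite RtoC_minus, RtoC_opp; ring).
      rewrite Cmod_mult, Cmod_R, Rabs_Ropp, Rabs_pos_eq by (apply pow_le; lra). lra.
    + replace 0 with (0 * Cmod (geom_term s i k)) by ring. apply (is_lim_seq_scal_r _ _ 0).
      apply (is_lim_seq_incr_1 (fun n => ratio i k ^ n)). apply is_lim_seq_geom.
      rewrite Rabs_pos_eq; lra.
  - intros P.
    (* For fixed [P] only finitely many series in [k] are added, so no domination is involved. *)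
    assert (H : is_series (V := C_NormedModule) (fun k => sum_n (fun n =>
      psum (fun i => RtoC (ratio i k ^ n) * head_term s i k)%C k) P) (sum_n (fun n => Dn n s) P)).
    { apply (is_series_sum_n (V := C_NormedModule)
        (fun k n => psum (fun i => RtoC (ratio i k ^ n) * head_term s i k)%C k)).
      intros n. apply Cser_is_series. apply Cser_Dn_triangle with Z; [exact HZ|lra]. }
    apply Cser_is_series in H. eapply Cser_ext; [|exact H]. intros k. cbv beta.
    rewrite (psum_ext _ (fun i => sum_n (fun n => RtoC (ratio i k ^ n) * head_term s i k)%C P))
      by (intros i Hi; symmetry; now apply sum_ratio_pow).
    induction P as [|P IH].
    + rewrite Csum_0. apply psum_ext. intros i _. now rewrite Csum_0.
    + rewrite Csum_Sn, IH, <- psum_plus.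
      * apply psum_ext. intros i _. now rewrite Csum_Sn.
      * apply Cser_is_series. apply (is_series_sum_n (V := C_NormedModule)
          (fun k n => psum (fun i => RtoC (ratio i k ^ n) * head_term s i k)%C k)).
        intros n. apply Cser_is_series. apply Cser_Dn_triangle with Z; [exact HZ|lra].
  - exact Hv.
Qed.

(** * Extension to the half-plane Re s > 1 *)

Lemma locana_zeta_cont (s w : C) : 1 < Re s -> locana (fun s _ => zeta_cont s) s w.
Proof.
  intros Hs. apply (locana_mult (fun s _ => s + tail_gap 1 s)%C (fun s _ => / (s - 1))%C).
  - apply (locana_plus (fun s _ => s) (fun s _ => tail_gap 1 s)).
    + apply locana_affine. solve_affine.
    + apply locana_tail_gap_1. lra.
  - apply (locana_inv_affine (fun s _ => s - 1)%C); [solve_affine|now apply Re_gt_neq].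
Qed.

Lemma Dn_sum_zeta (Z : C -> C -> C) (s : C) : is_double_zeta Z -> 1 < Re s ->
  Dn_sum s = zeta_cont s.
Proof.
  intros HZ Hs.
  (* The disc of radius 1 around 7 lies in Re s > 5; the second variable is a dummy. *)
  destruct (identity_theorem (fun s _ => 1 < Re s) (fun s _ => Dn_sum s - zeta_cont s)%C 7 0 1)
    with (z := s) (w := RtoC 0) as [d [Hd H]].
  - intros z w z' w' t Hz Hz' Ht. unfold seg.
    replace (Re (z + RtoC t * (z' - z))%C) with (Re z + t * (Re z' - Re z))
      by (destruct z, z'; simpl; ring).
    destruct (Req_dec t 0) as [->|]; [lra|]. nra.
  - intros z w Hz. apply (locana_minus (fun s _ => Dn_sum s) (fun s _ => zeta_cont s)).
    + now apply Dn_sum_analytic.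
    + now apply locana_zeta_cont.
  - simpl. lra.
  - lra.
  - intros z w Hz _. apply Re_close in Hz. simpl in Hz.
    unfold Dn_sum. rewrite (CSeries_unique _ (zeta_cont z)); [ring|].
    apply Cser_Dn_half_plane with Z; [exact HZ|lra].
  - exact Hs.
  - apply (near_self s 0 d (fun s _ => (Dn_sum s - zeta_cont s)%C = RtoC 0) Hd) in H.
    replace (Dn_sum s) with ((Dn_sum s - zeta_cont s) + zeta_cont s)%C by ring.
    rewrite H. ring.
Qed.

Theorem theorem1p2 (Z : C -> C -> C) (hZ : is_double_zeta Z)
    (s : C) (hs : 1 < Re s) :
  exists t : nat -> C,
    (forall n : nat, summand_value Z n s (t n)) /\ is_series t (zeta s).
Proof.
  (* [Dn] has the required value at every s with Re s > 1, so the case [s = 2] needs no separate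
     witness. *)
  exists (fun n => Dn n s). split.
  - intros n. now apply summand_value_Dn.
  - apply Cser_is_series. unfold zeta.
    rewrite (CSeries_unique _ _ (Cser_zeta s hs)), <- (Dn_sum_zeta Z s hZ hs).
    now apply (Dn_sum_analytic s 0).
Qed.
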